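(* Let $a=(a(n))_{n\ge1}$ and $b=(b(n))_{n\ge1}$ be real sequences such that, for some constants $0<c<C<\infty$, $a(n)\in[c,C]$ and $b(n)\in[-C,C]$ for all $n\ge1$, and let $J=J(a,b)$ be the associated Jacobi matrix. Let $A_n=[a(1)a(2)\cdots a(n)]^{1/n}$ and let $k_n$ be the normalized eigenvalue counting function of the top-left $n\times n$ block of $J$. Let $n_i\uparrow\infty$ be a sequence of positive integers such that the limit $k_{\{n_i\}}(E)=\lim_{i\to\infty}k_{n_i}(E)$ exists for almost every $E\in\mathbb{R}$. Then \[ 2\pi\cdot\liminf_{i\to\infty}A_{n_i}\cdot\sin\big(\pi k_{\{n_i\}}(E)\big)\,\frac{dk_{\{n_i\}}(E)}{dE}\;\ge\;1 \] for almost every $E\in\Sigma_{\mathrm{ac}}(J)$. In particular, if the integrated density of states $k(E)=\lim_{n\to\infty}k_n(E)$ exists for $J$ (i.e. for almost every $E\in\mathbb{R}$), then \[ 2\pi\cdot\lim_{n\to\infty}A_n\cdot\sin\big(\pi k(E)\big)\,\frac{dk(E)}{dE}\;\ge\;1 \] for almost every $E\in\Sigma_{\mathrm{ac}}(J)$ (the assertion that this inequality holds at $E$ includes the existence of $\lim_{n\to\infty}A_n$).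
   Context: The Jacobi matrix $J=J(a,b)$ is the bounded self-adjoint operator on $\ell^2(\mathbb{N})$, $\mathbb{N}=\{1,2,\dots\}$, given by $(J\psi)(n)=a(n-1)\psi(n-1)+a(n)\psi(n+1)+b(n)\psi(n)$ for $n\ge1$, with the formal conventions $a(0)=1$, $\psi(0)=0$. Equivalently it is the infinite symmetric tridiagonal matrix with diagonal $b(1),b(2),\dots$ and off-diagonal $a(1),a(2),\dots$. The essential support of the absolutely continuous spectrum is the set (considered modulo sets of Lebesgue measure zero) \[\Sigma_{\mathrm{ac}}(J)=\big\{E\in\mathbb{R} : \lim_{\epsilon\downarrow0}\operatorname{Im}\,(J-E-i\epsilon)^{-1}(1,1)\text{ exists and differs from }0\big\},\] where $(\cdot)(1,1)$ denotes the $(1,1)$ matrix element $\langle\delta_1,\cdot\,\delta_1\rangle$. For $n\ge1$, $k_n(E)=\frac1n\#\{1\le j\le n:\lambda_j\le E\}$, where $\lambda_1,\dots,\lambda_n$ are the eigenvalues of the top-left $n\times n$ block of $J$. The limits $k_{\{n_i\}}$ and $k$ are nondecreasing functions defined almost everywhere; they are extended to nondecreasing functions on $\mathbb{R}$ (the choice of extension is immaterial), and are therefore differentiable almost everywhere. *)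

(* Defs.v *)
From HB Require Import structures.
From mathcomp Require Import all_boot all_order all_algebra.
From mathcomp Require Import all_classical all_reals all_analysis.
From mathcomp Require Import complex polyrcf.

Set Implicit Arguments.
Unset Strict Implicit.
Unset Printing Implicit Defensive.

Import Order.TTheory GRing.Theory Num.Theory.
Import numFieldNormedType.Exports.

Local Open Scope classical_set_scope.
Local Open Scope ring_scope.

Section Jacobi.
Variable R : realType.
Implicit Types (a b : nat -> R) (phi psi : nat -> R[i]).

(* A vector of l^2({1, 2, ...}) is a function on nat that vanishes at 0, which
   is the convention psi(0) = 0. *)
Definition l2 : set (nat -> R[i]) :=
  [set psi | psi 0%N = 0 /\ cvgn (series (fun n => Normc.normc (psi n) ^+ 2))].

(* R[i] carries a topology only when it is seen as a numFieldType. *)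
Definition l2_dot phi psi : R[i] :=
  limn (series (fun n => (phi n)^*%C * psi n : (R[i] : numFieldType))).

Definition l2_delta (m : nat) : nat -> R[i] := fun n => (n == m)%:R.

(* The off-diagonal coefficient a 0 only ever multiplies psi 0 = 0, so that the
   convention a(0) = 1 is not needed. *)
Definition jacobi a b psi : nat -> R[i] := fun n =>
  if n is m.+1 then
    (a m)%:C%C * psi m + (a m.+1)%:C%C * psi m.+2 + (b m.+1)%:C%C * psi m.+1
  else 0.

(* (J - z)^-1 phi is the vector psi of l^2 such that (J - z) psi = phi; the
   value is 0 if there is no such vector. *)
Definition jacobi_resolvent a b (z : R[i]) phi : nat -> R[i] :=
  xget (fun=> 0)
    [set psi | l2 psi /\ forall n, jacobi a b psi n - z * psi n = phi n].

Definition green11 a b (z : R[i]) : R[i] :=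
  l2_dot (l2_delta 1%N) (jacobi_resolvent a b z (l2_delta 1%N)).

Definition Sigma_ac a b : set R :=
  [set E | exists2 l : R, l != 0 &
     complex.Im (green11 a b (E +i* e)%C) @[e --> 0^'+] --> l].

(* Row (column) i of 'M_n is row (column) i.+1 of the Jacobi matrix. *)
Definition jacobi_mx a b (n : nat) : 'M[R]_n :=
  \matrix_(i < n, j < n)
    if i == j then b i.+1
    else if j == i.+1 :> nat then a i.+1
    else if i == j.+1 :> nat then a j.+1
    else 0.

(* The eigenvalues in R, repeated according to their multiplicity; these are all
   the eigenvalues of a symmetric M. *)
Definition eigenvalues (n : nat) (M : 'M[R]_n) : seq R :=
  flatten [seq nseq (mup x (char_poly M)) x | x <- rootsR (char_poly M)].

Definition norm_counting a b (n : nat) (E : R) : R :=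
  (count (fun x => x <= E) (eigenvalues (jacobi_mx a b n)))%:R / n%:R.

Definition geom_mean a (n : nat) : R :=
  (\prod_(1 <= j < n.+1) a j) `^ (n%:R^-1).

End Jacobi.

(* Main.v *)
(* For z = E + i e let r_n and t_n be the geometric mean of |z - d_j| and the
   arithmetic mean of arg (z - d_j) over the eigenvalues d_j of the truncation of
   size n.  The ratios of consecutive characteristic polynomials satisfy a Riccati
   recursion with the same moduli and arguments on average; the AM-GM inequality
   and the concavity of the sine give
     e r_n + A_n^2 sin t_n <= (1 + O(1/n)) r_n^2 sin t_n.
   In the limit n = n_i this reads e <= 2 A g exp(g) sin t, where g(e) is the gap
   between the logarithmic potential of dk at E + i e and ln A, and t tends to
   pi (1 - k(E)) as e decreases to 0.  It remains to see that g(e) <= al pi e + O(e^2)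
   for every al > k'(E).  The increments of the potential satisfy this bound, so it
   suffices that the infimum of g is 0.  At almost every E of the absolutely
   continuous spectrum the orthonormal polynomials grow at most linearly, hence
   ln |P_n(E)| / n <= ln A_n + o(1), and Fatou's lemma compares this mean at e = 0
   with those at small e > 0.  Since then ln A is the infimum over e of the potential,
   which depends on k only, all limit points of A_n coincide when k_n converges. *)
Require Import Defs.
From HB Require Import structures.
From mathcomp Require Import all_boot all_order all_algebra.
From mathcomp Require Import all_classical all_reals all_analysis.
From mathcomp Require Import measurable_realfun.
From mathcomp Require Import complex polyrcf spectral ring lra.

Set Implicit Arguments.
Unset Strict Implicit.
Unset Printing Implicit Defensive.

Import Order.TTheory GRing.Theory Num.Theory.
Import numFieldNormedType.Exports.

Local Open Scope classical_set_scope.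
Local Open Scope ring_scope.

(** * Monotone functions are derivable almost everywhere *)

(** For constant coefficients the two averagings are asymptotically lossless, and inside the
    spectrum the final bound is then an equality. The obstacle is the order of the limits:
    convergence of the counting functions controls the logarithmic means at a fixed height e > 0,
    while the growth of the orthonormal polynomials controls them at e = 0, and eigenvalues close to
    E can make the two differ. Integrated over E, each eigenvalue contributes only O(e) to this
    difference, so that the mean over the eigenvalues is O(e) uniformly in n; this is why the
    comparison is made almost everywhere. Only finite matrices are diagonalized: the Green function
    of J is reached as a limit of those of the truncations. *)

Section StieltjesContraction.
Variables (R : realType) (g : cumulative R R).
Hypothesis g_lip : forall x y, x <= y -> g y - g x <= y - x.
Local Notation mu := (@lebesgue_measure R).
Local Notation nu := (lebesgue_stieltjes_measure g).

Let wlength_oc (f : cumulative R R) (x : R * R) : x.1 <= x.2 ->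
  wlength f `]x.1, x.2]%classic = (f x.2 - f x.1)%:E.
Proof. by move=> ?; rewrite wlength_itv_bnd. Qed.

(** Both outer measures are infima over the same covers by half-open intervals, so the comparison is
    made interval by interval. It makes the Stieltjes measure absolutely continuous. *)
Lemma stieltjes_contraction_le (A : set R) : (nu A <= mu A)%E.
Proof.
apply: le_ereal_inf_tmp => _ [B [mB AB] <-].
apply: (@le_trans _ _ (\sum_(k <oo) wlength g (B k))%E).
  by apply: ereal_inf_lbound; exists B.
apply: lee_nneseries => [k _ _|k _]; first exact: wlength_ge0.
have [x x12 <-] := mB k.
have [xle|xgt] := leP x.1 x.2; last first.
  by rewrite set_itv_ge ?bnd_simp -?leNgt ?(ltW xgt)// !wlength0.
by rewrite wlength_oc// [leRHS]wlength_oc// lee_fin g_lip.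
Qed.

(** A half-open interval is mapped into a closed interval whose length is its [g]-length. The outer
    measure on the left allows images that are not known to be measurable. *)
Lemma stieltjes_image_le (A : set R) :
  ((wlength idfun)^*%mu (g @` A) <= nu A)%E.
Proof.
apply: le_ereal_inf_tmp => _ [B [mB AB] <-].
have mBx k : exists x : R * R, x.1 <= x.2 /\ `]x.1, x.2]%classic = B k.
  have [x _ <-] := mB k.
  have [xle|xgt] := leP x.1 x.2; first by exists x.
  exists (x.1, x.1); split => //=.
  by rewrite !set_itv_ge ?bnd_simp -?leNgt// ltW.
have [x /all_and2[xle xB]] := choice mBx.
pose I k := `[g (x k).1, g (x k).2]%classic.
apply: (@le_trans _ _ ((wlength idfun)^*%mu (\bigcup_k I k))).
  apply: le_outer_measure => _ [y /AB[k _ Bky] <-]; exists k => //.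
  by move: Bky; rewrite -xB /I /= !in_itv/= => /andP[/ltW y1 y2];
    rewrite !cumulative_is_nondecreasing.
apply: le_trans (outer_measure_sigma_subadditive _ _) _.
apply: lee_nneseries => [k _ _|k _]; first exact: outer_measure_ge0.
rewrite -xB [leRHS](wlength_oc g (xle k)) -[leLHS]/(mu (I k)) /I.
have := @lebesgue_measure_itv R `[g (x k).1, g (x k).2].
rewrite /= lte_fin => ->; case: ifPn => // _.
by rewrite lee_fin subr_ge0 cumulative_is_nondecreasing.
Qed.

End StieltjesContraction.

Section MonotoneDerivable.
Variables (R : realType) (k : R -> R).
Hypothesis k_mono : {homo k : x y / x <= y}.
Local Notation mu := (@lebesgue_measure R).
(** Adding x makes the function expand distances; its generalized inverse [g] is then defined on the
    whole line, 1-Lipschitz, and flat across the jumps of [k]. *)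
Let G (x : R) := x + k x.
Let S (y : R) := [set x | G x <= y].
Let g (y : R) : R := sup (S y).

Let G_expand x x' : x <= x' -> x' - x <= G x' - G x.
Proof. by move=> /[dup] xx /k_mono; rewrite /G; lra. Qed.

Let S_ubound y : ubound (S y) (Num.max 0 (y - k 0)).
Proof.
move=> x; rewrite /S /G /= => xy; rewrite leNgt gt_max; apply/negP => /andP[x0 xk].
have := k_mono (ltW x0); lra.
Qed.

Let S_nonempty y : S y !=set0.
Proof.
exists (Num.min 0 (y - k 0)); rewrite /S /G /=.
have : Num.min 0 (y - k 0) <= 0 by rewrite ge_min lexx.
have : Num.min 0 (y - k 0) <= y - k 0 by rewrite ge_min lexx orbT.
by move=> h /k_mono; lra.
Qed.

Let S_has_ubound y : has_ubound (S y).
Proof. by exists (Num.max 0 (y - k 0)); exact: S_ubound. Qed.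

Let g_ge_of y x : G x <= y -> x <= g y.
Proof. by move=> xy; apply: ub_le_sup => //; exact: S_has_ubound. Qed.

Let g_le_of y x : y <= G x -> g y <= x.
Proof.
move=> yx; apply: ge_sup => [|z]; first exact: S_nonempty.
rewrite /S /= => zy; rewrite leNgt; apply/negP => xz.
by have := G_expand (ltW xz); lra.
Qed.

Let gK x : g (G x) = x.
Proof. by apply/eqP; rewrite eq_le g_le_of// g_ge_of. Qed.

Let g_mono x y : x <= y -> g x <= g y.
Proof.
move=> xy; apply: ge_sup => [|z]; first exact: S_nonempty.
by rewrite /S/= => zx; apply: g_ge_of; exact: le_trans xy.
Qed.

Let g_lip x y : x <= y -> g y - g x <= y - x.
Proof.
move=> xy; rewrite lerBlDr; apply: ge_sup => [|z]; first exact: S_nonempty.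
rewrite /S /= => zy.
have h : G (z - (y - x)) <= x.
  have : z - (y - x) <= z by lra.
  by move=> /G_expand; lra.
by have := g_ge_of h; lra.
Qed.

Let g_cont : continuous g.
Proof.
move=> x; apply/cvgrPdist_le => e e0; near=> y.
have : `|x - y| <= e.
  by near: y; apply: cvgr_dist_le => //; exact: cvg_id.
have [xy|/ltW xy] := leP x y; have := g_lip xy; have := g_mono xy;
  rewrite !ler_norml; lra.
Unshelve. all: by end_near. Qed.

(* Where g, the inverse of x + k x, has nonzero slope, x + k x is continuous and
   its difference quotients are the inverses of those of g. *)
Let derivable_of_inverse (x c : R) : c != 0 ->
  h^-1 * (g (h + G x) - g (G x)) @[h --> 0^'] --> c -> derivable k x 1.
Proof.
move=> c0 sc.
have [e /= e0 he] : \forall h \near 0^', h^-1 * (g (h + G x) - g (G x)) != 0.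
  exact: cvgr_neq0 sc c0.
have gp r : 0 < r -> r < e -> x < g (r + G x).
  move=> r0 re.
  have := he r; rewrite /ball_/= sub0r normrN (gtr0_norm r0) => /(_ re (lt0r_neq0 r0)).
  rewrite mulf_eq0 negb_or gK => /andP[_]; rewrite subr_eq0 => gx.
  by rewrite lt_neqAle eq_sym gx -{1}(gK x) g_mono// lerDr ltW.
have gm r : 0 < r -> r < e -> g (- r + G x) < x.
  move=> r0 re.
  have := he (- r); rewrite /ball_/= sub0r !normrN (gtr0_norm r0) oppr_eq0.
  move=> /(_ re (lt0r_neq0 r0)).
  rewrite mulf_eq0 negb_or gK => /andP[_]; rewrite subr_eq0 => gx.
  by rewrite lt_neqAle gx -{2}(gK x) g_mono// gerDr oppr_le0 ltW.
have Gc : G (h + x) - G x @[h --> 0^'] --> 0.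
  apply/cvgrPdist_le => d d0.
  pose r := Num.min d (e / 2).
  have r0 : 0 < r by rewrite lt_min d0 divr_gt0.
  have rd : r <= d by rewrite ge_min lexx.
  have re : r < e.
    by apply: (@le_lt_trans _ _ (e/2)); [rewrite ge_min lexx orbT|lra].
  have := gp r r0 re; have := gm r r0 re => gm' gp'.
  near=> h.
  have hp : h < g (r + G x) - x.
    by near: h; apply: nbhs_dnbhs; apply: lt_nbhsl; rewrite subr_gt0.
  have hm : g (- r + G x) - x < h.
    by near: h; apply: nbhs_dnbhs; apply: lt_nbhsr; rewrite subr_lt0.
  have p1 : G (h + x) <= r + G x.
    rewrite leNgt; apply/negP => /ltW /g_le_of; lra.
  have p2 : - r + G x <= G (h + x).
    rewrite leNgt; apply/negP => /ltW /g_ge_of; lra.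
  by rewrite sub0r normrN ler_norml; lra.
have sG : (G (h + x) - G x)^-1 * h @[h --> 0^'] --> c.
  have G0 : G (h + x) - G x @[h --> 0^'] --> 0^'.
    move=> U /= [d /= d0 dU].
    have /cvgrPdist_lt/(_ _ d0) Gd := Gc.
    suff : \forall h \near 0^', U (G (h + x) - G x) by [].
    near=> h; apply: dU => /=; first by near: h; exact: Gd.
    have h0 : h != 0 by near: h; exact: nbhs_dnbhs_neq.
    apply: contraNneq h0 => GG; rewrite -[h]subr0 -(subrr x).
    have : G (h + x) = G x by lra.
    by move=> /(congr1 g); rewrite !gK => hx; apply/eqP; lra.
  apply: cvg_trans (cvg_comp _ _ G0 sc); apply: near_eq_cvg.
  by near=> h => /=; rewrite subrK !gK addrK.
have sG' : h^-1 * (G (h + x) - G x) @[h --> 0^'] --> c^-1.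
  apply: cvg_trans (cvgV c0 sG); apply: near_eq_cvg.
  by near=> h; rewrite /= invfM invrK mulrC.
apply/cvg_ex; exists (c^-1 - 1).
have sk : h^-1 * (G (h + x) - G x) - 1 @[h --> 0^'] --> c^-1 - 1.
  by apply: cvgB => //; exact: cvg_cst.
apply: cvg_trans sk; apply: near_eq_cvg.
near=> h; rewrite /= /G /= scaler1 /GRing.scale/=.
have h0 : h != 0 by near: h; exact: nbhs_dnbhs_neq.
by field.
Unshelve. all: by end_near. Qed.

(** The measure dg has a density, equal to g' almost everywhere. A point where [k] is not derivable
    is [g (G x)] with [G x] in a Lebesgue null set or in the zero set of the density. Both are
    dg-null, so their images under [g] are Lebesgue null. *)
Lemma nondecreasing_ae_derivable : {ae mu, forall x, derivable k x 1}.
Proof.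
have g_rc : right_continuous g.
  by move=> x; apply: cvg_at_right_filter; exact: g_cont.
pose gC : cumulative R R := HB.pack g (isCumulative.Build R _ R g g_mono g_rc).
pose nu := lebesgue_stieltjes_measure gC.
have nu_mu (A : set R) : (nu A <= mu A)%E by exact: stieltjes_contraction_le.
have nu_oc (x y : R) : x <= y -> nu `]x, y]%classic = (g y - g x)%:E.
  move=> xy; rewrite /nu /= /lebesgue_stieltjes_measure /measure_extension.
  by rewrite measurable_mu_extE/= ?wlength_itv_bnd//; exact: is_ocitv.
(* Restriction to a bounded interval makes the measure finite, hence its density integrable on the
   whole line. *)
pose D (m : nat) : set (measurableTypeR R) := `](- m%:R : R), m%:R]%classic.
have mD m : measurable (D m) by exact: measurable_itv.
have nuD m : (nu (D m) < +oo)%E.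
  by rewrite nu_oc ?ltry// lerNl (le_trans _ (ler0n _ _))// oppr_le0.
(* The strict bound on y leaves room to its right inside [D m], as a two-sided difference quotient
   requires. *)
have Zm m : exists Z : set R, nu Z = 0%E /\ (forall y, D m y -> y < m%:R ->
    ~ Z y -> exists2 c, c != 0 & h^-1 * (g (h + y) - g y) @[h --> 0^'] --> c).
  pose num : {finite_measure set (measurableTypeR R) -> \bar R} := mfrestr (mD m) (nuD m).
  have num_mu : num `<< mu.
    move=> N N0 A mA AN; apply/eqP; rewrite eq_le measure_ge0 andbT.
    rewrite -(N0 A mA AN) (le_trans _ (nu_mu A))//.
    rewrite /num /= /mfrestr /mrestr; apply: le_measure; rewrite ?inE//.
    exact: measurableI.
  have [h [h0 hfin hint hE]] := radon_nikodym_sigma_finite num_mu.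
  pose f := fine \o h.
  have fE : EFin \o f = h by apply/funext => y /=; rewrite /f/= fineK.
  have fint A : measurable A -> mu.-integrable A (EFin \o f).
    by move=> mA; rewrite fE; apply: integrableS hint.
  have floc : locally_integrable [set: R] f.
    split => //; first by apply/measurable_EFinP; have /integrableP[] := fint _ measurableT.
      exact: openT.
    move=> K _ cK; have := fint K (compact_measurable cK).
    by move=> /integrableP[_].
  have [N [mN N0 subN]] := FTC1Ny (fun y => fint `]-oo, y]%classic (measurable_itv _)) floc.
  have mh0 : measurable (h @^-1` [set 0%E]).
    by rewrite -[X in measurable X]setTI; apply: (measurable_int _ hint) => //.
  exists ((N `|` (h @^-1` [set 0%E])) `&` D m); split.
    have -> : nu ((N `|` h @^-1` [set 0%E]) `&` D m) = num (N `|` h @^-1` [set 0%E]) by [].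
    apply/eqP; rewrite eq_le measure_ge0 andbT.
    apply: le_trans (measureU2 _ _ _) _ => //.
    rewrite [X in (X + _)%E](hE _ mN) [X in (_ + X)%E](hE _ mh0) null_set_integral//; last first.
      by apply: measurable_funTS; have [] := integrableP _ _ _ hint.
    by rewrite add0e integral0_eq.
  move=> y Dy ym nZ.
  have hy : h y != 0%E.
    by apply/eqP => hy; apply: nZ; split => //; right.
  have Ny : ~ N y by move=> Ny; apply: nZ; split => //; left.
  have /contrapT[dF F'] := contra_not (@subN y) Ny.
  exists (f y); first by apply: contra_neq hy => fy; rewrite -fE /= fy.
  move: dF F'; rewrite derive1E /derivable /derive => /cvg_ex[l Fl].
  rewrite (cvg_lim _ Fl)// => lf; rewrite -lf.
  apply: cvg_trans Fl; apply: near_eq_cvg.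
  have FE z : D m z -> \int[mu]_(t in `]-oo, z]) f t = g z - g (- m%:R).
    rewrite /D /= in_itv/= => /andP[z1 z2].
    rewrite /Rintegral; under eq_integral do rewrite -[(f _)%:E]/((EFin \o f) _) fE.
    rewrite -hE//= /mfrestr /mrestr.
    have -> : `]-oo, z] `&` D m = `](- m%:R), z]%classic.
      apply/seteqP; split => t; rewrite /D /setI /= !in_itv/=; first by case=> tz /andP[t1 _]; rewrite t1.
      by move=> /andP[t1 tz]; rewrite tz t1; split => //=; exact: le_trans tz z2.
    by rewrite [X in fine X](nu_oc _ _ (ltW z1)).
  have [y1 y2] : - m%:R < y /\ y <= m%:R by move: Dy; rewrite /D/= in_itv/= => /andP.
  near=> t; rewrite /= !FE//; first by rewrite [t *: 1]mulr1; congr (_ * _); ring.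
  rewrite /D /= in_itv/= [t *: 1]mulr1.
  apply/andP; split.
    by rewrite -ltrBlDr; near: t; apply: nbhs_dnbhs; apply: lt_nbhsr; rewrite subr_lt0.
  by rewrite -lerBrDr ltW//; near: t; apply: nbhs_dnbhs; apply: lt_nbhsl; rewrite subr_gt0.
have [Z /all_and2[Z0 ZP]] := choice Zm.
suff : ~` [set x | derivable k x 1] `<=` \bigcup_m (g @` Z m).
  move/(@negligibleS _ _ _ mu); apply; apply: negligible_bigcup => m.
  apply/negligible_outer_measure/eqP; rewrite eq_le outer_measure_ge0 andbT.
  by rewrite -(Z0 m); exact: (@stieltjes_image_le _ gC).
move=> x /= ndx.
pose m := (Num.truncn `|G x|).+1.
have Gm : `|G x| < m%:R by rewrite /m; exact: truncnS_gt.
exists m => //; apply: contrapT => nZ; apply: ndx.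
have Dx : D m (G x).
  by rewrite /D/= in_itv/=; move: Gm; rewrite ltr_norml => /andP[-> /ltW].
have Gx : G x < m%:R by move: Gm; rewrite ltr_norml => /andP[].
have nZ' : ~ Z m (G x) by move=> Zx; apply: nZ; exists (G x).
have [c c0 sc] := ZP m _ Dx Gx nZ'.
exact: derivable_of_inverse c0 sc.
Unshelve. all: by end_near. Qed.

End MonotoneDerivable.

(** * Spectral theorem for the truncations *)

Section OrthogonalPolynomials.
Variables (R : realType) (a b : nat -> R).

(** These are the characteristic polynomials of the truncations, expanded along the last row. *)
Fixpoint monic_op (n : nat) : {poly R} :=
  if n is m.+1 then
    ('X - (b m.+1)%:P) * monic_op m
      - (if m is l.+1 then ((a m) ^+ 2)%:P * monic_op l else 0)
  else 1.

Lemma monic_opSS n : monic_op n.+2 =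
  ('X - (b n.+2)%:P) * monic_op n.+1 - ((a n.+1) ^+ 2)%:P * monic_op n.
Proof. by []. Qed.

Definition ortho_op (n : nat) (x : R) : R :=
  (monic_op n).[x] / \prod_(1 <= j < n.+1) a j.

Hypothesis a_neq0 : forall n, (1 <= n)%N -> a n != 0.

Lemma prod_a_neq0 n : \prod_(1 <= j < n.+1) a j != 0.
Proof.
rewrite prodf_seq_neq0; apply/allP => j.
by rewrite mem_index_iota => /andP[j1 _]; exact: a_neq0.
Qed.

Lemma ortho_op0 x : ortho_op 0 x = 1.
Proof. by rewrite /ortho_op big_geq// hornerC divr1. Qed.

Lemma ortho_opS n x : a n.+1 * ortho_op n.+1 x =
  (x - b n.+1) * ortho_op n x - (if n is m.+1 then a n * ortho_op m x else 0).
Proof.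
rewrite /ortho_op; case: n => [|n].
  rewrite big_nat1 big_geq// [monic_op 1]/= subr0 mulr1 hornerXsubC hornerC.
  by field; exact: a_neq0.
rewrite monic_opSS hornerD hornerN !hornerM hornerXsubC hornerC.
move: (monic_op n.+1).[x] (monic_op n).[x] => p1 p0.
rewrite [\prod_(1 <= j < n.+3) _]big_nat_recr//= [\prod_(1 <= j < n.+2) _]big_nat_recr//=.
by field; rewrite !a_neq0//= prod_a_neq0.
Qed.

Lemma size_monic_op n : size (monic_op n) = n.+1 /\ monic_op n \is monic.
Proof.
suff: (size (monic_op n) = n.+1 /\ monic_op n \is monic) /\
      (size (monic_op n.+1) = n.+2 /\ monic_op n.+1 \is monic) by case.
elim: n => [|n [[sn mn] [sn1 mn1]]].
  rewrite /= subr0 mulr1 size_XsubC monicXsubC size_poly1 monic1//.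
split=> //; rewrite monic_opSS.
set q := ('X - _) * _; set r := _ * _.
have sq : size q = n.+3.
  by rewrite /q size_monicM ?monicXsubC ?monic_neq0// size_XsubC sn1.
have sr : (size (- r) < size q)%N.
  rewrite size_polyN sq /r mul_polyC (leq_ltn_trans (size_scale_leq _ _))//.
  by rewrite sn.
by rewrite size_polyDl// sq monicE lead_coefDl// -monicE /q monicMl// monicXsubC.
Qed.

Let T (k i : nat) : R :=
  if k == i then b k.+1 else if i == k.+1 then a k.+1
  else if k == i.+1 then a i.+1 else 0.

Let sum_delta (V : nmodType) N (i : nat) (F : nat -> V) :
  \sum_(k < N) (if k == i :> nat then F k else 0) = if (i < N)%N then F i else 0.
Proof.
rewrite -big_mkcond /=; case: ltnP => iN.
  by rewrite (big_pred1 (Ordinal iN))// => j /=; rewrite -val_eqE.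
by rewrite big_pred0// => j /=; apply/negbTE; rewrite neq_ltn (leq_trans (ltn_ord j) iN).
Qed.

Let tridiagonal_sum (v : nat -> R[i]) N i : (i < N)%N ->
  \sum_(k < N) v k * (T k i)%:C%C =
  v i * (b i.+1)%:C%C + (if i is l.+1 then v l * (a i)%:C%C else 0)
  + (if (i.+1 < N)%N then v i.+1 * (a i.+1)%:C%C else 0).
Proof.
move=> iN.
rewrite (eq_bigr (fun k : 'I_N => (if k == i :> nat then v k * (b i.+1)%:C%C else 0)
  + (if i is l.+1 then (if k == l :> nat then v k * (a i)%:C%C else 0) else 0)
  + (if k == i.+1 :> nat then v k * (a i.+1)%:C%C else 0))); last first.
  move=> [k kN] _ /=; rewrite /T.
  case: (eqVneq k i) => [->|ki].
    rewrite (ltn_eqF (ltnSn i)) addr0; case: i {iN} => [|i]; rewrite ?addr0//.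
    by rewrite (gtn_eqF (ltnSn i)) addr0.
  rewrite add0r; case: i iN ki => [|i] iN ki /=.
    by rewrite add0r; case: eqP => [->//|_]; rewrite ?mulr0//; case: eqP.
  rewrite eqSS [i == k]eq_sym; case: (eqVneq k i) => [->|ki'].
    by rewrite (ltn_eqF (leqW (ltnSn i))) addr0.
  by rewrite add0r; case: eqP => // _; rewrite mulr0.
rewrite !big_split/=; congr (_ + _ + _).
- by rewrite (sum_delta N i (fun k => v k * (b i.+1)%:C%C)) iN.
- case: i iN => [|l] lN; first by rewrite big1.
  by rewrite (sum_delta N l (fun k => v k * (a l.+1)%:C%C)) (ltn_trans (ltnSn l) lN).
- by rewrite (sum_delta N i.+1 (fun k => v k * (a i.+1)%:C%C)).
Qed.

(** By the recursion an eigenvector for [d j] is its first component times the values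
    [ortho_op n (d j)]. Hence the eigenvalues are simple, and both [monic_op] and the characteristic
    polynomial factor over them. The orthogonality relations are those of the columns of the unitary
    matrix. *)
Lemma jacobi_spectrum N : exists d w : 'I_N.+1 -> R,
  [/\ forall j, 0 <= w j,
      forall m n : 'I_N.+1,
        \sum_j w j * (ortho_op m (d j) * ortho_op n (d j)) = (m == n)%:R,
      monic_op N.+1 = \prod_j ('X - (d j)%:P) &
      forall E, norm_counting a b N.+1 E = (\sum_j (d j <= E)%R%:R) / N.+1%:R].
Proof.
pose A : 'M[R[i]]_N.+1 := map_mx (real_complex R) (jacobi_mx a b N.+1).
have AE k i : A k i = (T k i)%:C%C by rewrite !mxE /T -val_eqE.
have Tsym k i : T k i = T i k.
  rewrite /T; case: (eqVneq k i) => [->|ki] //=; rewrite ?eqxx// eq_sym in ki *.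
  by case: (eqVneq i k.+1) => [->|//]; rewrite (ltn_eqF (leqW (ltnSn k))).
have Areal (x : R) : (x%:C%C)^* = x%:C%C by rewrite /Num.conj /= oppr0.
have cM (x : R) (y : R[i]) : Num.conj (x%:C%C * y) = x%:C%C * Num.conj y.
  by rewrite rmorphM; congr (_ * _); exact: Areal.
have hA : A \is hermsymmx.
  apply/is_hermitianmxP; rewrite expr0 scale1r; apply/matrixP => i j.
  by rewrite !mxE Areal; congr (_%:C%C); rewrite -/(T i j) -/(T j i) Tsym.
set P := spectralmx A; set sp := spectral_diag A.
have PU : P \is unitarymx := spectral_unitarymx A.
have PA : P *m A = diag_mx sp *m P.
  have /orthomx_spectralP -> := hermitian_normalmx hA.
  by rewrite mulmxA mulmxA mulmxV ?spectral_unit// mul1mx.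
have spR j : exists x : R, sp 0 j = x%:C%C.
  have /mxOverP/(_ 0 j) := hermitian_spectral_diag_real hA.
  by move=> /complex_realP[x ->]; exists x.
have [d dE] := choice spR.
(* Row j of [P], extended by 0 so that the recursion can run over nat. *)
pose v j (n : nat) : R[i] := if insub n is Some i then P j i else 0.
have vE j (i : 'I_N.+1) : v j i = P j i by rewrite /v valK.
have eigv j i : (i <= N)%N ->
    v j i * (b i.+1)%:C%C + (if i is l.+1 then v j l * (a i)%:C%C else 0)
    + (if (i < N)%N then v j i.+1 * (a i.+1)%:C%C else 0) = (d j)%:C%C * v j i.
  move=> iN; have /matrixP/(_ j (Ordinal (iN : (i < N.+1)%N))) := PA.
  rewrite mul_diag_mx !mxE dE -vE/= => <-.
  rewrite -(@tridiagonal_sum (v j) N.+1)//.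
  by apply: eq_bigr => k _; rewrite -vE AE.
have aC n : (a n.+1)%:C%C != 0 :> R[i].
  by rewrite fmorph_eq0 a_neq0.
have vop j n : (n <= N)%N -> v j n = (ortho_op n (d j))%:C%C * v j 0%N.
  suff : (n <= N)%N -> v j n = (ortho_op n (d j))%:C%C * v j 0%N /\
     ((n < N)%N -> v j n.+1 = (ortho_op n.+1 (d j))%:C%C * v j 0%N).
    by move=> h /h[].
  elim: n => [|n IH] nN.
    split; first by rewrite ortho_op0 mul1r.
    move=> N0; have := eigv j 0%N nN; rewrite N0 addr0 => h.
    apply: (mulIf (aC 0%N)); rewrite mulrAC -rmorphM [_ * a 1]mulrC ortho_opS.
    by rewrite subr0 ortho_op0 mulr1 rmorphB mulrBl -h; ring.
  have [IH1 /(_ nN) IH2] := IH (ltnW nN); split => // nN'.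
  have := eigv j n.+1 nN; rewrite nN' => h.
  apply: (mulIf (aC n.+1)); rewrite mulrAC -rmorphM [_ * a _]mulrC ortho_opS.
  move: IH1 IH2 h; move: (ortho_op n.+1 (d j)) (ortho_op n (d j)) => o1 o0 -> -> h.
  rewrite rmorphB !rmorphM rmorphB -[v j n.+2 * _](addKr (o1%:C%C * v j 0%N * (b n.+2)%:C%C
    + o0%:C%C * v j 0%N * (a n.+1)%:C%C)) h; ring.
have vopi j (n : 'I_N.+1) : v j n = (ortho_op n (d j))%:C%C * v j 0%N.
  by apply: vop; exact: leq_ord.
have v0 j : v j 0%N != 0.
  apply/eqP => v0; have /unitarymxP/matrixP/(_ j j) := PU.
  rewrite !mxE eqxx big1 => [/eqP|k _]; first by rewrite eq_sym oner_eq0.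
  by rewrite -vE vopi v0 mulr0 mul0r.
(* The last row of the eigenvalue equation has no term of index N.+1; the recursion says that this
   missing term is a multiple of [ortho_op N.+1 (d j)]. *)
have vN j : root (monic_op N.+1) (d j).
  suff : ortho_op N.+1 (d j) = 0.
    rewrite /ortho_op => /eqP; rewrite mulf_eq0 invr_eq0 (negbTE (prod_a_neq0 _)) orbF.
    by [].
  apply: (mulfI (a_neq0 (ltn0Sn N))); rewrite mulr0 ortho_opS.
  apply: (fmorph_inj (real_complex R)); apply: (mulIf (v0 j)).
  have E M : (M <= N)%N ->
      (if M is m.+1 then a M * ortho_op m (d j) else 0)%:C%C * v j 0%N =
      if M is l.+1 then v j l * (a M)%:C%C else 0.
    case: M => [|M] MN; first by rewrite rmorph0 mul0r.
    rewrite (vop _ _ (ltnW MN)); move: (ortho_op M (d j)) => o.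
    by rewrite rmorphM; ring.
  have := eigv j N (leqnn _); rewrite ltnn addr0 [v j N]vop// => h.
  rewrite rmorphB mulrBl E// rmorph0 mul0r rmorphM rmorphB.
  move: h; move: (ortho_op N (d j)) => o h.
  rewrite mulrBl mulrBl -mulrA -h -addrA -opprD; apply/eqP; rewrite subr_eq0.
  by apply/eqP; congr (_ + _); ring.
pose w j := complex.Re (v j 0%N * (v j 0%N)^*).
have wE j : (w j)%:C%C = v j 0%N * (v j 0%N)^*.
  rewrite /w; case: (v j 0%N) => x y; apply/eqP; rewrite eq_complex /= eqxx/=.
  by apply/eqP; ring.
(* Rows with a common eigenvalue are nonzero multiples of one real vector with first entry 1, so
   they are not orthogonal. *)
have d_inj : injective d.
  move=> j l djl; apply/eqP; apply: contraTT isT => jl; apply/negP => _.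
  have /unitarymxP/matrixP/(_ j l) := PU.
  rewrite !mxE (negbTE jl) => /eqP; apply/negP.
  rewrite (eq_bigr (fun k : 'I_N.+1 => ((ortho_op k (d j)) ^+ 2)%:C%C
      * (v j 0%N * (v l 0%N)^*))); last first.
    move=> k _; rewrite !mxE -!vE (vopi j) (vopi l) -djl; move: (ortho_op k (d j)) => o.
    by rewrite cM rmorphXn; ring.
  rewrite -mulr_suml !mulf_eq0 fmorph_eq0 !(negbTE (v0 _)) !orbF -rmorph_sum fmorph_eq0.
  rewrite gt_eqF// big_ord_recl ortho_op0 expr1n ltr_pwDl// sumr_ge0// => i _.
  exact: sqr_ge0.
exists d, w; split.
- move=> j; rewrite -ler0c wE; exact: mul_conjC_ge0.
- move=> m n; apply: (fmorph_inj (real_complex R)).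
  have : (P^t*)%sesqui \is unitarymx by rewrite trmxC_unitary.
  move=> /unitarymxP/matrixP/(_ m n); rewrite trmxCK !mxE => H.
  transitivity ((m == n)%:R : R[i]); last by rewrite rmorph_nat.
  rewrite rmorph_sum -H; apply: eq_bigr => j _.
  rewrite !mxE -!vE (vopi _ m) (vopi _ n); move: (ortho_op m (d j)) (ortho_op n (d j)) => o1 o2.
  rewrite cM (rmorphM (real_complex R) (w j)) (rmorphM (real_complex R) o1) /= wE.
  by ring.
- pose s := [seq d j | j <- enum 'I_N.+1].
  have us : uniq s by rewrite map_inj_uniq ?enum_uniq.
  have [sN mN] := size_monic_op N.+1.
  rewrite (@all_roots_prod_XsubC _ (monic_op N.+1) s).
  + by rewrite (monicP mN) scale1r big_map big_enum.
  + by rewrite sN size_map size_enum_ord.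
  + by apply/allP => _ /mapP[j _ ->].
  + by rewrite uniq_rootsE.
move=> E.
pose s := [seq d j | j <- enum 'I_N.+1].
have us : uniq s by rewrite map_inj_uniq ?enum_uniq.
have rs j : root (char_poly (jacobi_mx a b N.+1)) (d j).
  rewrite -(fmorph_root (real_complex R)) map_char_poly -eigenvalue_root_char.
  apply/eigenvalueP; exists (row j P).
    by rewrite -row_mul -/A PA; apply/rowP => k; rewrite mxE mul_diag_mx !mxE dE.
  by apply: contra_neq (v0 j) => /rowP/(_ 0); rewrite !mxE -vE.
have cE : char_poly (jacobi_mx a b N.+1) = \prod_(x <- s) ('X - x%:P).
  rewrite (@all_roots_prod_XsubC _ (char_poly (jacobi_mx a b N.+1)) s).
  + by rewrite (monicP (char_poly_monic _)) scale1r.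
  + by rewrite size_char_poly size_map size_enum_ord.
  + by apply/allP => _ /mapP[j _ ->].
  + by rewrite uniq_rootsE.
have eE : perm_eq (eigenvalues (jacobi_mx a b N.+1)) s.
  rewrite /eigenvalues.
  have c0 : char_poly (jacobi_mx a b N.+1) != 0 by rewrite monic_neq0// char_poly_monic.
  have rE x : (x \in rootsR (char_poly (jacobi_mx a b N.+1))) = (x \in s).
    by rewrite -(roots_on_rootsR c0 x) in_itv/= cE root_prod_XsubC.
  have -> : [seq nseq (mup x (char_poly (jacobi_mx a b N.+1))) x
            | x <- rootsR (char_poly (jacobi_mx a b N.+1))] =
            [seq [:: x] | x <- rootsR (char_poly (jacobi_mx a b N.+1))].
    apply/eq_in_map => x; rewrite rE => xs.
    by rewrite cE mu_prod_XsubC count_uniq_mem// xs.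
  by rewrite flatten_seq1; apply: uniq_perm => //; exact: uniq_roots.
rewrite /norm_counting; congr (_ / _).
rewrite (permP eE) /s count_map -sum1_count big_mkcond/= natr_sum big_enum/=.
by apply: eq_bigr => j _; case: (d j <= E).
Qed.

End OrthogonalPolynomials.

(** * Spectral measures of the truncations and the Green function *)

Section SpectralData.
Variables (R : realType) (a b : nat -> R).

(* [d N j] are the eigenvalues of the block of size N.+1 and [w N j] the squares of
   the first components of its normalized eigenvectors. *)
Definition spectral_data (d w : nat -> nat -> R) := forall N,
  [/\ forall j, 0 <= w N j,
      forall m n, (m <= N)%N -> (n <= N)%N ->
        \sum_(j < N.+1) w N j * (ortho_op a b m (d N j) * ortho_op a b n (d N j))
        = (m == n)%:R,
      monic_op a b N.+1 = \prod_(j < N.+1) ('X - (d N j)%:P) &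
      forall E, norm_counting a b N.+1 E =
        (\sum_(j < N.+1) (d N j <= E)%R%:R) / N.+1%:R].

Hypothesis a_neq0 : forall n, (1 <= n)%N -> a n != 0.

Lemma exists_spectral_data : exists d w, spectral_data d w.
Proof.
have H N : exists dw : (nat -> R) * (nat -> R),
  [/\ forall j, 0 <= dw.2 j,
      forall m n, (m <= N)%N -> (n <= N)%N ->
        \sum_(j < N.+1) dw.2 j * (ortho_op a b m (dw.1 j) * ortho_op a b n (dw.1 j))
        = (m == n)%:R,
      monic_op a b N.+1 = \prod_(j < N.+1) ('X - (dw.1 j)%:P) &
      forall E, norm_counting a b N.+1 E =
        (\sum_(j < N.+1) (dw.1 j <= E)%R%:R) / N.+1%:R].
  have [d [w [w0 o p q]]] := jacobi_spectrum b a_neq0 N.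
  exists (d \o inord, w \o inord); split.
  - by move=> j; exact: w0.
  - move=> m n mN nN; rewrite -[RHS](o (Ordinal (mN : (m < N.+1)%N)) (Ordinal (nN : (n < N.+1)%N))).
    by apply: eq_bigr => j _; rewrite /= inord_val.
  - by rewrite p; apply: eq_bigr => j _; rewrite /= inord_val.
  - by move=> E; rewrite q; congr (_ / _); apply: eq_bigr => j _; rewrite /= inord_val.
have [dw dwP] := choice H.
by exists (fun N => (dw N).1), (fun N => (dw N).2) => N; exact: dwP.
Qed.

Variables d w : nat -> nat -> R.
Hypothesis dw : spectral_data d w.

Lemma ortho_op_eigenvalue N (j : 'I_N.+1) : ortho_op a b N.+1 (d N j) = 0.
Proof.
have [_ _ p _] := dw N; rewrite /ortho_op p horner_prod (bigD1 j)//=.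
by rewrite hornerXsubC subrr !mul0r.
Qed.

Lemma sum_weights N : \sum_(j < N.+1) w N j = 1.
Proof.
have [_ o _ _] := dw N; rewrite -[RHS](o 0%N 0%N (leq0n _) (leq0n _)).
by apply: eq_bigr => j _; rewrite !ortho_op0 !mulr1.
Qed.

(** Gershgorin's argument: the eigenvalue equation is read at an index where the eigenvector is
    largest in modulus, and its three coefficients are at most C. *)
Lemma eigenvalue_bound (C : R) : (forall n, (1 <= n)%N -> `|a n| <= C) ->
  (forall n, (1 <= n)%N -> `|b n| <= C) ->
  forall N (j : 'I_N.+1), `|d N j| <= 3 * C.
Proof.
move=> aC bC N j; set x := d N j.
have C0 : 0 <= C by rewrite (le_trans (normr_ge0 (a 1%N))) ?aC.
pose f (i : 'I_N.+1) := `|ortho_op a b i x|.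
case: (@arg_maxP _ _ _ (@ord0 N) xpredT f isT) => i _ imax.
have fi0 : 0 < f i.
  have := imax ord0 isT; rewrite /f /= ortho_op0 normr1.
  exact: lt_le_trans.
have step : (x - b i.+1) * ortho_op a b i x =
   a i.+1 * ortho_op a b i.+1 x + (if nat_of_ord i is m.+1 then a i * ortho_op a b m x else 0).
  have E := ortho_opS b a_neq0 i x.
  by rewrite E; case: (nat_of_ord i) => [|m]; rewrite ?subrK ?addr0 ?subr0.
rewrite -(ler_pM2r fi0) /f -normrM.
have -> : x * ortho_op a b i x = b i.+1 * ortho_op a b i x + (a i.+1 * ortho_op a b i.+1 x
  + (if nat_of_ord i is m.+1 then a i * ortho_op a b m x else 0)).
  by rewrite -step; ring.
have b1 : `|b i.+1 * ortho_op a b i x| <= C * f i.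
  by rewrite normrM ler_wpM2r ?normr_ge0 ?bC.
have b2 : `|a i.+1 * ortho_op a b i.+1 x| <= C * f i.
  rewrite normrM ler_pM// ?aC//.
  have [iN|] := ltnP i.+1 N.+1; first exact: (imax (Ordinal iN)).
  rewrite ltnS => Ni; have -> : nat_of_ord i = N.
    by apply/eqP; rewrite eqn_leq Ni -ltnS ltn_ord.
  by rewrite /x ortho_op_eigenvalue normr0 ltW.
have b3 : `|if nat_of_ord i is m.+1 then a i * ortho_op a b m x else 0| <= C * f i.
  case Ei : (nat_of_ord i) => [|m]; first by rewrite normr0 mulr_ge0// ltW.
  rewrite normrM ler_pM// ?aC//.
  have mN : (m < N.+1)%N by rewrite ltnW// -Ei.
  exact: (imax (Ordinal mN)).
apply: le_trans (ler_normD _ _) _.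
apply: le_trans (lerD b1 (le_trans (ler_normD _ _) (lerD b2 b3))) _.
by rewrite -/(f i); lra.
Qed.

(* Summation by parts against an eigenvector; the boundary term is a Wronskian. *)
Lemma green_formula (psi : nat -> R[i]) (z : R[i]) (x : R) N : psi 0%N = 0 ->
  \sum_(n < N.+1) (ortho_op a b n x)%:C%C * (jacobi a b psi n.+1 - z * psi n.+1) =
  \sum_(n < N.+1) (x%:C%C - z) * ((ortho_op a b n x)%:C%C * psi n.+1) +
  (a N.+1)%:C%C * ((ortho_op a b N x)%:C%C * psi N.+2
                   - (ortho_op a b N.+1 x)%:C%C * psi N.+1).
Proof.
move=> psi0; elim: N => [|N IH].
  rewrite !big_ord1 /= psi0 ortho_op0.
  have := ortho_opS b a_neq0 0%N x; rewrite subr0 ortho_op0 mulr1.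
  move: (ortho_op a b 1 x) => o /(congr1 (real_complex R)).
  rewrite rmorphM rmorphB => ho.
  rewrite rmorph1; apply/eqP; rewrite -subr_eq0; apply/eqP.
  transitivity (((a 1%N)%:C%C * o%:C%C - (x%:C%C - (b 1%N)%:C%C)) * psi 1%N); first by ring.
  by rewrite ho subrr mul0r.
rewrite big_ord_recr IH [in RHS]big_ord_recr /=.
have := ortho_opS b a_neq0 N.+1 x.
move: (ortho_op a b N x) (ortho_op a b N.+1 x) (ortho_op a b N.+2 x) => o0 o1 o2.
move=> /(congr1 (real_complex R)); rewrite rmorphM rmorphB !rmorphM rmorphB => ho.
apply/eqP; rewrite -subr_eq0; apply/eqP.
transitivity (((a N.+2)%:C%C * o2%:C%C -
  ((x%:C%C - (b N.+2)%:C%C) * o1%:C%C - (a N.+1)%:C%C * o0%:C%C)) * psi N.+2); first by ring.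
by rewrite ho subrr mul0r.
Qed.

(** Imaginary part at E + i e of the Green function of the truncation, which is the sum of the
    [w N j / (d N j - z)]. *)
Definition poisson_sum N (E e : R) : R :=
  \sum_(j < N.+1) w N j * (e / ((d N j - E) ^+ 2 + e ^+ 2)).

Hypothesis a_bounded : exists C, forall n, (1 <= n)%N -> `|a n| <= C.

(** The Green formula against the eigenvectors of the truncation expresses [psi 1] as the truncated
    Green function plus a boundary term in [psi N.+2], which tends to 0 because [psi] is square
    summable. *)
Lemma poisson_sum_cvg (E e : R) (psi : nat -> R[i]) : 0 < e -> l2 psi ->
  (forall n, jacobi a b psi n - (E +i* e)%C * psi n = l2_delta R 1 n) ->
  poisson_sum N E e @[N --> \oo] --> complex.Im (psi 1%N).
Proof.
move=> e0 [psi0 psiS] Jpsi.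
have [C aC] := a_bounded.
have den_gt0 x : 0 < (x - E) ^+ 2 + e ^+ 2.
  by rewrite ltr_wpDl ?sqr_ge0 ?exprn_gt0.
pose S N := \sum_(j < N.+1) `|w N j * ortho_op a b N (d N j)|.
(* Uses |p| <= (1 + p^2) / 2 for weights of total mass 1 and p of norm 1. *)
have S1 N : S N <= 1.
  have [w0 o _ _] := dw N.
  have h1 := sum_weights N; have := o N N (leqnn _) (leqnn _).
  rewrite eqxx => h2; apply: (@le_trans _ _ ((\sum_(j < N.+1) w N j +
    \sum_(j < N.+1) w N j * (ortho_op a b N (d N j) * ortho_op a b N (d N j))) / 2));
    last by rewrite h1 h2 mulr1n; lra.
  rewrite -big_split/= mulr_suml; apply: ler_sum => j _.
  rewrite normrM ger0_norm// -{2}(mulr1 (w N j)) -mulrDr -mulrA ler_wpM2l//.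
  have := sqr_ge0 (`|ortho_op a b N (d N j)| - 1).
  have := real_normK (num_real (ortho_op a b N (d N j))).
  by rewrite !expr2; nra.
have key N : `|complex.Im (psi 1%N) - poisson_sum N E e| <=
    C / e * (`|complex.Re (psi N.+2)| + `|complex.Im (psi N.+2)|).
  have [w0 o _ _] := dw N.
  (* At an eigenvalue [ortho_op N.+1] vanishes, so half of the Wronskian drops out. The 1 is the
     source [l2_delta 1] paired with [ortho_op 0]. *)
  have rep j : (j < N.+1)%N ->
    1 - (a N.+1)%:C%C * ((ortho_op a b N (d N j))%:C%C * psi N.+2) =
    ((d N j)%:C%C - (E +i* e)%C) *
      \sum_(n < N.+1) (ortho_op a b n (d N j))%:C%C * psi n.+1.
    move=> jN; have := @green_formula psi (E +i* e)%C (d N j) N psi0.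
    rewrite (ortho_op_eigenvalue (Ordinal jN)) rmorph0 mul0r subr0 mulr_sumr => H.
    rewrite -[RHS](addrK ((a N.+1)%:C%C * ((ortho_op a b N (d N j))%:C%C * psi N.+2))) -H.
    congr (_ - _); rewrite big_ord_recl big1 => [|n _].
      by rewrite Jpsi ortho_op0 rmorph1 mul1r addr0.
    by rewrite Jpsi /l2_delta /= mulr0.
  have res j : (E +i* e)%C - (d N j)%:C%C != 0.
    rewrite eq_complex /= negb_and orbC; simpc => /=.
    by rewrite gt_eqF.
  (* Orthogonality of [ortho_op 0], which is 1, to the later polynomials isolates [psi 1]. *)
  have psi1 : psi 1%N = \sum_(j < N.+1) (w N j)%:C%C *
      ((1 - (a N.+1)%:C%C * ((ortho_op a b N (d N j))%:C%C * psi N.+2)) /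
        ((d N j)%:C%C - (E +i* e)%C)).
    transitivity (\sum_(j < N.+1) (w N j)%:C%C *
        \sum_(n < N.+1) (ortho_op a b n (d N j))%:C%C * psi n.+1).
      under eq_bigr do rewrite mulr_sumr.
      rewrite exchange_big /= big_ord_recl /= [X in _ + X]big1 => [|n _].
        rewrite addr0; under eq_bigr do rewrite ortho_op0 rmorph1 mul1r.
        by rewrite -mulr_suml -rmorph_sum sum_weights rmorph1 mul1r.
      under eq_bigr do rewrite mulrA.
      rewrite -mulr_suml; under eq_bigr do rewrite -rmorphM.
      rewrite -rmorph_sum /=.
      have -> : \sum_(j < N.+1) w N j * ortho_op a b (bump 0 n) (d N j) = 0.
        rewrite -[RHS]/((0%N == n.+1)%:R) -(o 0%N n.+1 (leq0n _) (ltn_ord n)).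
        by apply: eq_bigr => j _; rewrite ortho_op0 mul1r.
      by rewrite mul0r.
    apply: eq_bigr => j _; congr (_ * _); rewrite rep//.
    by rewrite mulrAC mulfV ?mul1r// -opprB oppr_eq0.
  have invE j : ((d N j)%:C%C - (E +i* e)%C)^-1 =
     (((d N j - E) / ((d N j - E) ^+ 2 + e ^+ 2)) +i*
      (e / ((d N j - E) ^+ 2 + e ^+ 2)))%C.
    apply: (mulfI (_ : ((d N j)%:C%C - (E +i* e)%C) != 0)).
      by rewrite -opprB oppr_eq0.
    rewrite mulfV; last by rewrite -opprB oppr_eq0.
    have := den_gt0 (d N j) => /lt0r_neq0 ne.
    by apply/eqP; rewrite eq_complex; simpc => /=; apply/andP; split; apply/eqP; field.
  pose Sr := \sum_(j < N.+1) w N j * ortho_op a b N (d N j) *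
     ((d N j - E) / ((d N j - E) ^+ 2 + e ^+ 2)).
  pose Si := \sum_(j < N.+1) w N j * ortho_op a b N (d N j) *
     (e / ((d N j - E) ^+ 2 + e ^+ 2)).
  have ImE : complex.Im (psi 1%N) = poisson_sum N E e
     - a N.+1 * (complex.Re (psi N.+2) * Si + complex.Im (psi N.+2) * Sr).
    rewrite {1}psi1 raddf_sum /= /poisson_sum /Si /Sr !mulr_sumr -big_split/= mulr_sumr -sumrB.
    apply: eq_bigr => j _; rewrite invE.
    by case: (psi N.+2) => x y; simpc => /=; ring.
  have bnd (t : R) : `|t| <= (t ^+ 2 + e ^+ 2) / e.
    rewrite ler_pdivlMr//; have := sqr_ge0 (`|t| - e).
    have := real_normK (num_real t); have := normr_ge0 t; rewrite !expr2; nra.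
  have Srb : `|Sr| <= e^-1.
    apply: le_trans (ler_norm_sum _ _ _) _; rewrite -[leRHS]mul1r.
    apply: le_trans (ler_wpM2r _ (S1 N)); last by rewrite invr_ge0 ltW.
    rewrite /S mulr_suml; apply: ler_sum => j _; rewrite normrM ler_wpM2l//.
    rewrite normrM normfV (gtr0_norm (den_gt0 _)) ler_pdivrMr// mulrC.
    exact: bnd.
  have Sib : `|Si| <= e^-1.
    apply: le_trans (ler_norm_sum _ _ _) _; rewrite -[leRHS]mul1r.
    apply: le_trans (ler_wpM2r _ (S1 N)); last by rewrite invr_ge0 ltW.
    rewrite /S mulr_suml; apply: ler_sum => j _; rewrite normrM ler_wpM2l//.
    rewrite normrM normfV (gtr0_norm (den_gt0 _)) ler_pdivrMr// gtr0_norm//.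
    rewrite mulrC ler_pdivlMr// -expr2 lerDr sqr_ge0//.
  rewrite ImE addrAC subrr add0r normrN normrM -mulrA.
  rewrite ler_pM// ?aC// mulrDr; apply: le_trans (ler_normD _ _) _.
  by rewrite !normrM lerD// mulrC ler_wpM2r.
have cpsi : Normc.normc (psi n) ^+ 2 @[n --> \oo] --> 0 := cvg_series_cvg_0 psiS.
have cRe : complex.Re (psi n) ^+ 2 + complex.Im (psi n) ^+ 2 @[n --> \oo] --> 0.
  apply: cvg_trans cpsi; apply: near_eq_cvg; near=> n.
  by case: (psi n) => x y /=; rewrite sqr_sqrtr// addr_ge0// sqr_ge0.
have sq_to0 (u v : nat -> R) : u n ^+ 2 + v n ^+ 2 @[n --> \oo] --> 0 ->
    u n @[n --> \oo] --> 0.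
  move=> /cvgrPdist_le uv; apply/cvgrPdist_le => t t0.
  have := uv (t ^+ 2) (exprn_gt0 2 t0); apply: filterS => n.
  rewrite !sub0r !normrN => h.
  have : u n ^+ 2 <= t ^+ 2.
    by rewrite (le_trans _ h)// ger0_norm ?addr_ge0 ?sqr_ge0// lerDl sqr_ge0.
  by rewrite ler_norml !expr2 => ht; apply/andP; split; nra.
have cR := sq_to0 _ _ cRe.
have cI : complex.Im (psi n) @[n --> \oo] --> 0.
  by apply: (sq_to0 _ (fun n => complex.Re (psi n))); under eq_fun do rewrite addrC.
have cB : C / e * (`|complex.Re (psi N.+2)| + `|complex.Im (psi N.+2)|) @[N --> \oo] --> 0.
  rewrite -[X in _ --> X](mulr0 (C / e)); apply: cvgMl_tmp.
  have shift2 (f : nat -> R) : f n @[n --> \oo] --> 0 -> f n.+2 @[n --> \oo] --> 0.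
    by rewrite -(cvg_shiftn 2); under eq_fun do rewrite addn2.
  have := cvgD (cvg_norm (shift2 _ cR)) (cvg_norm (shift2 _ cI)).
  by rewrite normr0 addr0; apply.
apply/cvgrPdist_le => t t0.
move/cvgrPdist_le : cB => /(_ _ t0); apply: filterS => N.
rewrite sub0r normrN => h; apply: le_trans (key N) (le_trans (ler_norm _) h).
Unshelve. all: by end_near. Qed.

(** A nonzero value rules out the default of [jacobi_resolvent], so a resolvent vector in l2 exists.
    On [Sigma_ac] the nonzero limit supplies this hypothesis for small e. *)
Lemma poisson_sum_cvg_green (E e : R) : 0 < e ->
  complex.Im (green11 a b (E +i* e)%C) != 0 ->
  poisson_sum N E e @[N --> \oo] --> complex.Im (green11 a b (E +i* e)%C).
Proof.
move=> e0.
have dotE psi : l2_dot (l2_delta R 1) psi = psi 1%N.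
  rewrite /l2_dot; apply: (@lim_near_cst (R[i] : numFieldType)); first exact: norm_hausdorff.
  near=> n; have n2 : (2 <= n)%N by near: n; exact: nbhs_infty_ge.
  rewrite /series /= -(subnKC n2) /index_iota subn0 iotaD big_cat /=.
  rewrite !big_cons big_nil big1_seq.
    case: (psi 1%N) (psi 0%N) => [x y] [s t]; apply/eqP; rewrite eq_complex /=.
    by apply/andP; split; apply/eqP; ring.
  move=> i /andP[_]; rewrite mem_iota => /andP[i2 _].
  by rewrite /l2_delta gtn_eqF//= oppr0 mul0r.
rewrite /green11 dotE /jacobi_resolvent.
case: xgetP => [psi _ [l2psi Jpsi] _|_]; first exact: poisson_sum_cvg.
by rewrite /= eqxx.
Unshelve. all: by end_near. Qed.

End SpectralData.

(** * Logarithmic potentials and phases *)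

Section Calculus.
Variable R : realType.
Local Notation mu := (@lebesgue_measure R).

Lemma FTC2_is_derive (f F : R -> R) (l u : R) : l < u ->
  (forall x : R, is_derive x (1 : R) F (f x)) -> continuous f ->
  (\int[mu]_(x in `[l, u]) (f x)%:E = (F u - F l)%:E)%E.
Proof.
move=> lu dF cf.
have cF x : {for x, continuous F}.
  by apply: differentiable_continuous; apply/derivable1_diffP; exact: ex_derive.
rewrite (@continuous_FTC2 _ f F)//.
- exact: continuous_subspaceT.
- split.
  + by move=> x _; exact: ex_derive.
  + by apply: cvg_at_right_filter; exact: cF.
  + by apply: cvg_at_left_filter; exact: cF.
- by move=> x _; rewrite derive1E derive_val.
Qed.

Lemma is_derive_bigsum n (h : nat -> R -> R) (dh : nat -> R) (x : R) :
  (forall i, (i < n)%N -> is_derive x 1 (h i) (dh i)) ->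
  is_derive x 1 (fun y => \sum_(i < n) h i y) (\sum_(i < n) dh i).
Proof.
move=> H; have -> : (fun y => \sum_(i < n) h i y) = \sum_(i < n) h i.
  by apply/funext => y; rewrite fct_sumE.
by apply: is_derive_sum => i; exact: H.
Qed.

Lemma sqr_dist_gt0 (x E e : R) : 0 < e -> 0 < (x - E) ^+ 2 + e ^+ 2.
Proof. by move=> e0; rewrite ltr_wpDl ?sqr_ge0 ?exprn_gt0. Qed.

Lemma is_derive_affine (x E e : R) :
  is_derive x 1 (fun y : R => (y - E) / e) e^-1.
Proof.
have -> : (fun y : R => (y - E) / e) = (e^-1 \*: (id \- cst E)).
  by apply/funext => y /=; rewrite mulrC.
by apply: is_derive_eq; rewrite subr0 /GRing.scale/= mulr1.
Qed.

Lemma is_derive_atan_affine (x E e : R) : 0 < e ->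
  is_derive x 1 (fun y : R => atan ((y - E) / e)) (e / ((x - E) ^+ 2 + e ^+ 2)).
Proof.
move=> e0; have := @is_derive1_comp _ atan (fun y => (y - E) / e) x _ _
  (is_derive1_atan ((x - E) / e)) (is_derive_affine x E e).
have -> : (1 + ((x - E) / e) ^+ 2)^-1 * e^-1 = e / ((x - E) ^+ 2 + e ^+ 2).
  have ne := lt0r_neq0 (sqr_dist_gt0 x E e0); have e1 := lt0r_neq0 e0.
  have n2 : 1 + ((x - E) / e) ^+ 2 != 0 by rewrite gt_eqF// ltr_pwDl// sqr_ge0.
  by field; rewrite ne e1.
exact.
Qed.

Lemma is_derive_sqr_dist (x E e : R) :
  is_derive x 1 (fun y : R => (y - E) ^+ 2 + e ^+ 2) (2 * (x - E)).
Proof.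
have -> : (fun y : R => (y - E) ^+ 2 + e ^+ 2) = ((id \- cst E) ^+ 2 \+ cst (e ^+ 2)).
  by apply/funext => y /=.
apply: is_derive_eq; rewrite addr0 subr0 /GRing.scale/= mulr1 expr1 -mulr_natl//.
Qed.

Definition log_dist (E e x : R) : R := ln ((x - E) ^+ 2 + e ^+ 2) / 2.

Lemma is_derive_log_dist (x E e : R) : 0 < e ->
  is_derive x 1 (log_dist E e) ((x - E) / ((x - E) ^+ 2 + e ^+ 2)).
Proof.
move=> e0; have p := sqr_dist_gt0 x E e0.
have H := @is_derive1_comp _ (@ln R) (fun y => (y - E) ^+ 2 + e ^+ 2) x _ _
  (is_derive1_ln p) (is_derive_sqr_dist x E e).
have -> : log_dist E e = 2^-1 \*: (@ln R \o (fun y : R => (y - E) ^+ 2 + e ^+ 2)).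
  by apply/funext => y /=; rewrite /log_dist mulrC.
apply: is_derive_eq; rewrite /GRing.scale/=; have := lt0r_neq0 p => ne.
by field.
Qed.

Lemma continuous_sqr_dist (E e : R) : continuous (fun x : R => (x - E) ^+ 2 + e ^+ 2).
Proof.
move=> x; apply: differentiable_continuous; apply/derivable1_diffP.
by have [] := is_derive_sqr_dist x E e.
Qed.

Lemma continuous_kernel (E e : R) (p : R -> R) : 0 < e -> continuous p ->
  continuous (fun x : R => p x / ((x - E) ^+ 2 + e ^+ 2)).
Proof.
move=> e0 cp x; apply: cvgM; first exact: cp.
by apply: cvgV; [rewrite gt_eqF// sqr_dist_gt0|exact: continuous_sqr_dist].
Qed.

Lemma continuous_poisson (E e : R) : 0 < e ->
  continuous (fun x : R => e / ((x - E) ^+ 2 + e ^+ 2)).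
Proof. by move=> e0; apply: continuous_kernel => // x; exact: cvg_cst. Qed.

Lemma continuous_conj_poisson (E e : R) : 0 < e ->
  continuous (fun x : R => (x - E) / ((x - E) ^+ 2 + e ^+ 2)).
Proof.
move=> e0; apply: continuous_kernel => // x.
by apply: cvgB; [exact: cvg_id|exact: cvg_cst].
Qed.

Lemma ex_lt_of_limn_einf (u : (\bar R)^nat) (M : \bar R) n0 :
  (limn_einf u < M)%E -> exists2 n, (n0 <= n)%N & (u n < M)%E.
Proof.
move=> uM; apply: contrapT => H.
have Mu n : (n0 <= n)%N -> (M <= u n)%E.
  by move=> nn; rewrite leNgt; apply/negP => uMn; apply: H; exists n.
have : (M <= einfs u n0)%E.
  by apply: le_ereal_inf_tmp => _ [n /= nn <-]; exact: Mu.
rewrite leNgt => /negP; apply; apply: le_lt_trans uM; rewrite limn_einf_lim.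
have /cvg_lim -> // := ereal_nondecreasing_cvgn (@nondecreasing_einfs R u).
by apply: ereal_sup_ubound; exists n0.
Qed.

(** Measurability and nonnegativity are returned with the bound so that the lemma can be iterated
    over nested lower limits. *)
Lemma fatou_bound (D : set R) (f : nat -> R -> \bar R) (B : nat -> \bar R) :
  measurable D -> (forall n, measurable_fun D (f n)) ->
  (forall n x, D x -> (0 <= f n x)%E) ->
  (forall n, (\int[mu]_(x in D) f n x <= B n)%E) ->
  [/\ measurable_fun D (fun x => limn_einf (f ^~ x)),
      forall x, D x -> (0 <= limn_einf (f ^~ x))%E &
      (\int[mu]_(x in D) limn_einf (f ^~ x) <= limn_einf B)%E].
Proof.
move=> mD mf f0 fB; split.
- apply: (@emeasurable_fun_cvg _ _ _ _ (fun n x => einfs (f ^~ x) n)).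
    exact: measurable_fun_einfs.
  by move=> x Dx; rewrite limn_einf_lim; exact: is_cvg_einfs.
- move=> x Dx; rewrite limn_einf_lim; apply: lime_ge; first exact: is_cvg_einfs.
  by apply: nearW => n; apply: le_ereal_inf_tmp => _ [m _ <-]; exact: f0.
- apply: le_trans (fatou _ _ _ _) _ => //.
  rewrite !limn_einf_lim; apply: lee_lim; try exact: is_cvg_einfs.
  apply: nearW => n; apply: le_ereal_inf_tmp => _ [m /= nm <-].
  by apply: le_trans (fB m); apply: ereal_inf_lbound; exists m.
Qed.

Lemma limn_einf_cst (B : \bar R) : limn_einf (fun=> B) = B.
Proof. by have [] := cvg_limn_einf_sup (cvg_cst B : (fun _ : nat => B) @ \oo --> B). Qed.

(* The mean of H over the points d i j equals, by the fundamental theorem of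
   calculus, an integral against their counting function. *)
Lemma mean_cvg (d : nat -> nat -> R) (m : nat -> nat) (k : R -> R) (l u : R)
    (H h : R -> R) :
  l < u -> (forall i, (0 < m i)%N) ->
  (forall i j, (j < m i)%N -> l < d i j < u) ->
  (forall x : R, is_derive x (1 : R) H (h x)) -> continuous h ->
  {homo k : x y / x <= y} ->
  {ae mu, forall x, (\sum_(j < m i) (d i j <= x)%R%:R) / (m i)%:R @[i --> \oo] --> k x} ->
  mu.-integrable `[l, u] (fun x => (h x * k x)%:E) /\
  (\sum_(j < m i) H (d i j)) / (m i)%:R @[i --> \oo] -->
    H u - \int[mu]_(x in `[l, u]) (h x * k x).
Proof.
move=> lu m0 dlu dH ch k_mono kk.
pose ki i x := (\sum_(j < m i) (d i j <= x)%R%:R) / (m i)%:R : R.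
set I := `[l, u]%classic.
have mI : measurable I by exact: measurable_itv.
have m0R i : 0 < (m i)%:R :> R by rewrite ltr0n.
have mh : measurable_fun I h.
  by apply: measurable_funTS; exact: continuous_measurable_fun.
have mstep x0 : measurable_fun I (fun x => (x0 <= x)%R%:R : R).
  apply: nondecreasing_measurable => // x y xy.
  case: (leP x0 x) => [x0x|_]; last by rewrite ler0n.
  by rewrite (le_trans x0x xy).
have mki i : measurable_fun I (ki i).
  by apply: measurable_funM => //; apply: measurable_sum => j; exact: mstep.
have ki01 i x : 0 <= ki i x <= 1.
  rewrite /ki divr_ge0 ?sumr_ge0//= ler_pdivrMr// mul1r.
  rewrite -[X in _ <= X%:R](card_ord (m i)) -sumr_const ler_sum// => j _.
  by case: (d i j <= x).
have hint : mu.-integrable I (EFin \o h).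
  apply: continuous_compact_integrable; first exact: segment_compact.
  exact: continuous_subspaceT.
have ahint : mu.-integrable I (fun x => `|h x|%:E).
  by have := integrable_abse hint.
have dom (f : R -> R) : measurable_fun I f -> (forall x, 0 <= f x <= 1) ->
    mu.-integrable I (fun x => (h x * f x)%:E).
  move=> mf f01; apply: (@le_integrable _ _ _ mu I mI _ (EFin \o h)) => //.
    by apply/measurable_EFinP; exact: measurable_funM.
  move=> x _ /=; rewrite lee_fin normrM ler_piMr// ger0_norm.
    by have /andP[] := f01 x.
  by have /andP[] := f01 x.
have step01 (x0 x : R) : 0 <= ((x0 <= x)%R%:R : R) <= 1 by case: (x0 <= x); rewrite lexx ler01.
have mk : measurable_fun I (fun x => (h x * k x)%:E).
  apply/measurable_EFinP; apply: measurable_funM => //.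
  by apply: nondecreasing_measurable.
have stepE i j : (j < m i)%N ->
    (\int[mu]_(x in I) (h x * (d i j <= x)%R%:R)%:E = (H u - H (d i j))%:E)%E.
  move=> jm; have /andP[ld du] := dlu i j jm.
  rewrite -(FTC2_is_derive du dH ch).
  have -> : `[d i j, u]%classic = I `&` `[d i j, +oo[%classic.
    apply/seteqP; split => x; rewrite /I /setI /= !in_itv/= andbT.
      by move=> /andP[dx xu]; rewrite xu dx andbT (le_trans (ltW ld)).
    by move=> [/andP[_ ->] ->].
  rewrite integral_mkcondr; apply: eq_integral => x _.
  rewrite patchE; case: ifPn => [/set_mem|/negP xd].
    by rewrite /= in_itv/= andbT => ->; rewrite mulr1.
  have -> : (d i j <= x) = false; last by rewrite mulr0.
  by apply/negbTE/negP => dx; apply: xd; apply/mem_set; rewrite /= in_itv/= dx.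
have kiE i : (\int[mu]_(x in I) (h x * ki i x)%:E =
    (H u - (\sum_(j < m i) H (d i j)) / (m i)%:R)%:E)%E.
  transitivity (\int[mu]_(x in I) ((m i)%:R^-1%:E *
      \sum_(j < m i) (h x * (d i j <= x)%R%:R)%:E))%E.
    apply: eq_integral => x _; rewrite sumEFin -EFinM; congr (_%:E).
    by rewrite -mulr_sumr /ki [RHS]mulrC mulrA.
  rewrite integralZl//; last first.
    by apply: integrable_sum => // j _; exact: (dom _ (mstep (d i j)) (step01 (d i j))).
  rewrite integral_sum//; last by move=> j; exact: (dom _ (mstep (d i j)) (step01 (d i j))).
  under eq_bigr => j _ do rewrite (stepE i j)//.
  rewrite sumEFin -EFinM sumrB sumr_const card_ord -mulr_natr; congr (_%:E).
  by have := lt0r_neq0 (m0R i) => ?; field.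
have kk' : {ae mu, forall x, I x ->
    (fun i => (h x * ki i x)%:E) @ \oo --> (h x * k x)%:E}.
  apply: (@filterS _ _ (ae_filter_ringOfSetsType mu) _ _ _ kk) => x kx _.
  apply: cvg_EFin; first exact: nearW.
  by apply: cvgM; [exact: cvg_cst|exact: kx].
have domn : {ae mu, forall x (n : nat), I x -> (`|(h x * ki n x)%:E| <= `|h x|%:E)%E}.
  apply: aeW => x n _ /=; have /andP[k0 k1] := ki01 n x.
  by rewrite lee_fin normrM ler_piMr// ger0_norm.
have mhk i : measurable_fun I (fun x => (h x * ki i x)%:E).
  by apply/measurable_EFinP; exact: measurable_funM.
have [ihk _ cvg1] := @dominated_convergence _ _ _ mu I mI
  (fun i x => (h x * ki i x)%:E) (fun x => (h x * k x)%:E) (fun x => `|h x|%:E)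
  mhk mk kk' ahint domn.
split=> //.
have ifin : (\int[mu]_(x in I) (h x * k x)%:E)%E \is a fin_num by exact: integrable_fin_num.
move: cvg1; rewrite -(fineK ifin) => /fine_cvgP[_].
have -> : fine \o (fun n => \int[mu]_(x in I) (h x * ki n x)%:E)%E =
    (fun i => H u - (\sum_(j < m i) H (d i j)) / (m i)%:R).
  by apply/funext => i /=; rewrite kiE.
move=> c1.
have c2 : (fun i => H u - (H u - (\sum_(j < m i) H (d i j)) / (m i)%:R)) @ \oo -->
    H u - fine (\int[mu]_(x in I) (h x * k x)%:E)%E.
  by apply: cvgB; [exact: cvg_cst|exact: c1].
apply: cvg_trans c2; apply: near_eq_cvg; apply: nearW => i /=.
by rewrite opprB addrC subrK.
Qed.

(* [log_potential] and [phase] are the integrals of log |x - z| and arg (z - x),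
   z = E + i s, with respect to the measure dk carried by [E - T, E + T]; an
   integration by parts leaves only values of k. *)
Definition log_potential (k : R -> R) (E T s : R) : R := log_dist E s (E + T)
  - \int[mu]_(x in `[E - T, E + T]) ((x - E) / ((x - E) ^+ 2 + s ^+ 2) * k x).

(** The difference q of the two kernels is odd in t = x - E, so the constant [k E] integrates to 0.
    Near E the Lipschitz bound leaves |q| |t|, at most e times the Poisson kernel, whose integral is
    at most pi. The bound is uniform in the lower height n. *)
Lemma log_increment_bound (k : R -> R) (E T al tau e n : R) :
  0 < n -> n < e -> 0 < T -> 0 < tau -> 0 <= al ->
  (forall x, 0 <= k x <= 1) -> {homo k : x y / x <= y} ->
  (forall x, `|x - E| <= tau -> `|k x - k E| <= al * `|x - E|) ->
  log_potential k E T e - log_potential k E T n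
    <= al * pi * e + (2 * T / tau ^+ 3 + (2 * T ^+ 2)^-1) * e ^+ 2.
Proof.
move=> n0 ne T0 tau0 al0 k01 kmono klip.
have e0 : 0 < e by exact: lt_trans ne.
set I := `[E - T, E + T]%classic.
have mI : measurable I by exact: measurable_itv.
have lu : E - T < E + T by lra.
have ici (f : R -> R) : continuous f -> mu.-integrable I (EFin \o f).
  move=> cf; apply: continuous_compact_integrable; first exact: segment_compact.
  exact: continuous_subspaceT.
have iq (s : R) : 0 < s -> mu.-integrable I
    (EFin \o (fun x => (x - E) / ((x - E) ^+ 2 + s ^+ 2) * k x)).
  move=> s0; have cs := @continuous_conj_poisson E _ s0.
  apply: (@le_integrable _ _ _ mu I mI _
    (EFin \o (fun x => (x - E) / ((x - E) ^+ 2 + s ^+ 2)))) => //; last exact: ici.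
    apply/measurable_EFinP; apply: measurable_funM.
      by apply: measurable_funTS; exact: continuous_measurable_fun.
    exact: nondecreasing_measurable.
  move=> x _ /=; rewrite lee_fin normrM ler_piMr//; have /andP[k0 k1] := k01 x.
  by rewrite ger0_norm.
pose beta := (tau ^+ 3)^-1.
have beta0 : 0 < beta by rewrite invr_gt0 exprn_gt0.
(* Beyond tau the oscillation of [k], at most 1, is below (|t| / tau)^3; the cube is the power for
   which |q| |t|^3 <= e^2. Integrated over length 2 T, this is the first part of the coefficient of
   e^2. *)
have klip' x : `|k x - k E| <= al * `|x - E| + beta * `|x - E| ^+ 3.
  have [xt|xt] := leP `|x - E| tau.
    by apply: le_trans (klip _ xt) _; rewrite lerDl mulr_ge0 ?exprn_ge0 // ltW.
  apply: (@le_trans _ _ 1).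
    rewrite ler_norml; have /andP[? ?] := k01 x; have /andP[? ?] := k01 E.
    by apply/andP; split; lra.
  rewrite ler_wpDl ?mulr_ge0//.
  by rewrite /beta mulrC ler_pdivlMr ?exprn_gt0// mul1r lerXn2r ?nnegrE ?(ltW tau0) ?(ltW xt).
pose g x := ((x - E) / ((x - E) ^+ 2 + n ^+ 2) - (x - E) / ((x - E) ^+ 2 + e ^+ 2)) * k E
   + al * e * (e / ((x - E) ^+ 2 + e ^+ 2)) + beta * e ^+ 2.
pose G x := (log_dist E n x - log_dist E e x) * k E
   + al * e * atan ((x - E) / e) + beta * e ^+ 2 * x.
have dG (x : R) : is_derive x (1 : R) G (g x).
  have h1 := is_derive_log_dist x E n0; have h2 := is_derive_log_dist x E e0.
  have h3 := is_derive_atan_affine x E e0.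
  have -> : G = (k E \*: (log_dist E n \- log_dist E e)
     \+ (al * e) \*: (fun y : R => atan ((y - E) / e)) \+ (beta * e ^+ 2) \*: id).
    by apply/funext => y /=; rewrite /G mulrC.
  by apply: is_derive_eq; rewrite /g /GRing.scale/= mulr1 [_ * k E]mulrC.
have cg : continuous g.
  move=> x; apply: cvgD; last exact: cvg_cst.
  apply: cvgD.
    apply: cvgM; last exact: cvg_cst.
    by apply: cvgB; exact: continuous_conj_poisson.
  by apply: cvgM; [exact: cvg_cst|exact: continuous_poisson].
have gI : \int[mu]_(x in I) g x = G (E + T) - G (E - T).
  by rewrite /Rintegral (FTC2_is_derive lu dG cg).
have point x : (x - E) / ((x - E) ^+ 2 + n ^+ 2) * k x
    - (x - E) / ((x - E) ^+ 2 + e ^+ 2) * k x <= g x.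
  rewrite /g; set t := x - E; have kx := klip' x; rewrite -/t in kx.
  set A := t ^+ 2 + e ^+ 2; set B := t ^+ 2 + n ^+ 2.
  have A0 : 0 < A by rewrite ltr_wpDl ?sqr_ge0 ?exprn_gt0.
  have B0 : 0 < B by rewrite ltr_wpDl ?sqr_ge0 ?exprn_gt0.
  set q := t / B - t / A.
  have qE : q = t * ((e ^+ 2 - n ^+ 2) / (A * B)).
    rewrite /q; have := lt0r_neq0 A0; have := lt0r_neq0 B0 => b1 a1.
    have : e ^+ 2 - n ^+ 2 = A - B by rewrite /A /B; ring.
    by move=> ->; field; rewrite a1 b1.
  have en : 0 <= e ^+ 2 - n ^+ 2 by rewrite subr_ge0 lerXn2r ?nnegrE ?(ltW n0) ?(ltW e0) ?(ltW ne)//.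
  have r0 : 0 <= (e ^+ 2 - n ^+ 2) / (A * B) by rewrite divr_ge0// mulr_ge0 ?(ltW A0) ?(ltW B0).
  have qn : `|q| = `|t| * ((e ^+ 2 - n ^+ 2) / (A * B)) by rewrite qE normrM (ger0_norm r0).
  have qt : `|q| * `|t| <= e ^+ 2 / A.
    rewrite qn mulrAC -expr2 real_normK ?num_real// ler_pdivlMr// mulrA mulrAC.
    have -> : t ^+ 2 / (A * B) * (e ^+ 2 - n ^+ 2) * A = t ^+ 2 / B * (e ^+ 2 - n ^+ 2).
      by field; rewrite (lt0r_neq0 A0) (lt0r_neq0 B0).
    rewrite -[leRHS]mul1r ler_pM ?divr_ge0 ?sqr_ge0 ?(ltW B0)//.
      by rewrite ler_pdivrMr// mul1r /B lerDl sqr_ge0.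
    by rewrite lerBlDr lerDl sqr_ge0.
  have qt3 : `|q| * `|t| ^+ 3 <= e ^+ 2.
    rewrite exprS mulrA; apply: (@le_trans _ _ (e ^+ 2 / A * `|t| ^+ 2)).
      by rewrite ler_wpM2r// exprn_ge0.
    rewrite real_normK ?num_real// mulrAC ler_pdivrMr// ler_wpM2l ?sqr_ge0//.
    by rewrite /A lerDl sqr_ge0.
  have : q * (k x - k E) <= al * e * (e / A) + beta * e ^+ 2.
    apply: le_trans (ler_norm _) _; rewrite normrM.
    apply: le_trans (ler_wpM2l (normr_ge0 _) kx) _.
    rewrite mulrDr mulrCA [_ * (beta * _)]mulrCA lerD//.
      by rewrite -[leRHS]mulrA; apply: ler_wpM2l => //; rewrite mulrA -expr2.
    by apply: ler_wpM2l => //; exact: ltW.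
  rewrite -addrA -mulrBl -/q; lra.
have main : \int[mu]_(x in I) ((x - E) / ((x - E) ^+ 2 + n ^+ 2) * k x)
    - \int[mu]_(x in I) ((x - E) / ((x - E) ^+ 2 + e ^+ 2) * k x) <= G (E + T) - G (E - T).
  rewrite -RintegralB//; try exact: iq.
  rewrite -gI; apply: le_Rintegral => //; last exact: ici.
  set f1 := fun x => (x - E) / ((x - E) ^+ 2 + n ^+ 2) * k x.
  set f2 := fun x => (x - E) / ((x - E) ^+ 2 + e ^+ 2) * k x.
  rewrite (_ : EFin \o _ = ((EFin \o f1) \- (EFin \o f2))%E); last first.
    by apply/funext => x; rewrite /= EFinB.
  by apply: integrableB => //; exact: iq.
have Lsym s : log_dist E s (E - T) = log_dist E s (E + T).
  by rewrite /log_dist; congr (ln _ / 2); ring.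
(* The second part of the coefficient of e^2, from the endpoint values of the logarithm. *)
have logT : log_dist E e (E + T) - log_dist E n (E + T) <= (2 * T ^+ 2)^-1 * e ^+ 2.
  have p1 := sqr_dist_gt0 (E + T) E e0; have p2 := sqr_dist_gt0 (E + T) E n0.
  rewrite /log_dist -mulrBl -ln_div ?posrE//.
  move: p1 p2; have -> : (E + T - E) = T by ring.
  move=> p1 p2; have T2 : 0 < T ^+ 2 by rewrite exprn_gt0.
  have r0 : 0 <= (e ^+ 2 - n ^+ 2) / (T ^+ 2 + n ^+ 2).
    rewrite divr_ge0 ?(ltW p2)// subr_ge0 lerXn2r ?nnegrE ?(ltW n0) ?(ltW e0) ?(ltW ne)//.
  have r1 : ln ((T ^+ 2 + e ^+ 2) / (T ^+ 2 + n ^+ 2)) <= (e ^+ 2 - n ^+ 2) / (T ^+ 2 + n ^+ 2).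
    have -> : (T ^+ 2 + e ^+ 2) / (T ^+ 2 + n ^+ 2) = 1 + (e ^+ 2 - n ^+ 2) / (T ^+ 2 + n ^+ 2).
      by field; exact: lt0r_neq0.
    by apply: le_ln1Dx; exact: lt_le_trans r0.
  rewrite ler_pdivrMr//; apply: le_trans r1 _.
  have -> : (2 * T ^+ 2)^-1 * e ^+ 2 * 2 = e ^+ 2 / T ^+ 2 by field; exact: lt0r_neq0.
  rewrite ler_pdivrMr// mulrAC ler_pdivlMr//.
  have n20 : 0 <= n ^+ 2 by exact: sqr_ge0.
  have e20 : 0 <= e ^+ 2 by exact: sqr_ge0.
  by nra.
have atT : atan ((E + T - E) / e) - atan ((E - T - E) / e) <= pi.
  have := atan_ltpi2 ((E + T - E) / e); have := atan_gtNpi2 ((E - T - E) / e); lra.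
have h := ler_wpM2l (mulr_ge0 al0 (ltW e0)) atT.
have num (kE l1 l2 A1 A2 I1 I2 be M : R) : I2 - I1 <=
    (l2 - l1) * kE + al * e * A1 + be * e ^+ 2 * (E + T)
    - ((l2 - l1) * kE + al * e * A2 + be * e ^+ 2 * (E - T)) ->
    al * e * (A1 - A2) <= al * e * pi -> l1 - l2 <= M * e ^+ 2 ->
    (l1 - I1) - (l2 - I2) <= al * pi * e + (2 * T * be + M) * e ^+ 2.
  clear; lra.
by move: main; rewrite /G !Lsym => main; exact: num main h logT.
Qed.

Definition phase (k : R -> R) (E T s : R) : R := pi / 2 + atan ((E + T - E) / s)
  - \int[mu]_(x in `[E - T, E + T]) (s / ((x - E) ^+ 2 + s ^+ 2) * k x).

(** For constant [k] the integral is explicit and gives the subtracted term. The first error is the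
    oscillation near E against the Poisson kernel; beyond tau the oscillation is at most (x - E)^2 /
    tau^2, and (x - E)^2 times the kernel is at most s. *)
Lemma phase_bound (k : R -> R) (E T del tau s : R) :
  0 < s -> 0 < T -> 0 < tau -> 0 <= del ->
  (forall x, 0 <= k x <= 1) -> {homo k : x y / x <= y} ->
  (forall x, `|x - E| <= tau -> `|k x - k E| <= del) ->
  `|phase k E T s - (pi / 2 + (1 - 2 * k E) * atan (T / s))|
    <= del * pi + 2 * T * s / tau ^+ 2.
Proof.
move=> s0 T0 tau0 del0 k01 kmono klip.
set I := `[E - T, E + T]%classic.
have mI : measurable I by exact: measurable_itv.
have lu : E - T < E + T by lra.
have ici (f : R -> R) : continuous f -> mu.-integrable I (EFin \o f).
  move=> cf; apply: continuous_compact_integrable; first exact: segment_compact.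
  exact: continuous_subspaceT.
have cs := @continuous_poisson E _ s0.
have iq : mu.-integrable I (EFin \o (fun x => s / ((x - E) ^+ 2 + s ^+ 2) * k x)).
  apply: (@le_integrable _ _ _ mu I mI _
    (EFin \o (fun x => s / ((x - E) ^+ 2 + s ^+ 2)))) => //; last exact: ici.
    apply/measurable_EFinP; apply: measurable_funM.
      by apply: measurable_funTS; exact: continuous_measurable_fun.
    exact: nondecreasing_measurable.
  move=> x _ /=; rewrite lee_fin normrM ler_piMr//; have /andP[k0 k1] := k01 x.
  by rewrite ger0_norm.
have klip' x : `|k x - k E| <= del + (x - E) ^+ 2 / tau ^+ 2.
  have [xt|xt] := leP `|x - E| tau.
    by apply: le_trans (klip _ xt) _; rewrite lerDl divr_ge0 ?sqr_ge0.
  apply: (@le_trans _ _ 1).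
    rewrite ler_norml; have /andP[? ?] := k01 x; have /andP[? ?] := k01 E.
    by apply/andP; split; lra.
  rewrite ler_wpDl// ler_pdivlMr ?exprn_gt0// mul1r -[leRHS]real_normK ?num_real//.
  by rewrite lerXn2r ?nnegrE ?(ltW tau0) ?(ltW xt).
pose g (c e x : R) := c * (s / ((x - E) ^+ 2 + s ^+ 2)) + e.
pose G (c e x : R) := c * atan ((x - E) / s) + e * x.
have dG c e (x : R) : is_derive x (1 : R) (G c e) (g c e x).
  have h3 := is_derive_atan_affine x E s0.
  have -> : G c e = (c \*: (fun y : R => atan ((y - E) / s)) \+ e \*: id).
    by apply/funext => y /=.
  by apply: is_derive_eq; rewrite /g /GRing.scale/= mulr1.
have cg c e : continuous (g c e).
  move=> x; apply: cvgD; last exact: cvg_cst.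
  by apply: cvgM; [exact: cvg_cst|exact: cs].
have gI c e : \int[mu]_(x in I) g c e x = G c e (E + T) - G c e (E - T).
  by rewrite /Rintegral (FTC2_is_derive lu (dG c e) (cg c e)).
have point x : `|s / ((x - E) ^+ 2 + s ^+ 2) * k x - s / ((x - E) ^+ 2 + s ^+ 2) * k E|
    <= del * (s / ((x - E) ^+ 2 + s ^+ 2)) + s / tau ^+ 2.
  have A0 := sqr_dist_gt0 x E s0; have t0 : 0 < tau ^+ 2 by rewrite exprn_gt0.
  have q0 : 0 <= s / ((x - E) ^+ 2 + s ^+ 2) by rewrite divr_ge0 ?(ltW s0) ?(ltW A0).
  rewrite -mulrBr normrM (ger0_norm q0).
  apply: le_trans (ler_wpM2l q0 (klip' x)) _; rewrite mulrDr [_ * del]mulrC lerD2l.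
  rewrite mulrA ler_pM2r ?invr_gt0// mulrAC ler_pdivrMr// ler_pM2l// lerDl sqr_ge0//.
set q := \int[mu]_(x in I) (s / ((x - E) ^+ 2 + s ^+ 2) * k x).
have up : q <= G (k E + del) (s / tau ^+ 2) (E + T) - G (k E + del) (s / tau ^+ 2) (E - T).
  rewrite -gI; apply: le_Rintegral => //; first exact: ici.
  by move=> x _; have := point x; rewrite ler_norml /g => /andP[_]; lra.
have lo : G (k E - del) (- (s / tau ^+ 2)) (E + T)
    - G (k E - del) (- (s / tau ^+ 2)) (E - T) <= q.
  rewrite -gI; apply: le_Rintegral => //; first exact: ici.
  by move=> x _; have := point x; rewrite ler_norml /g => /andP[+ _]; lra.
have e1 : E + T - E = T by ring.
have e2 : (E - T - E) / s = - (T / s) by field; exact: lt0r_neq0.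
have at1 := atan_ltpi2 (T / s); have at0 := atan_gtNpi2 (T / s).
move: up lo; rewrite /phase -/I -/q /G e2 e1 atanN.
set st := s / tau ^+ 2; have -> : 2 * T * s / tau ^+ 2 = 2 * T * st by rewrite /st mulrA.
set A := atan _ in at1 at0 *.
have := ler_wpM2l del0 (ltW at1); have := ler_wpM2l del0 (ltW at0).
by move=> d1 d2 up lo; rewrite ler_norml; apply/andP; split; nra.
Qed.

(** In the limit the argument of E + i s - x is pi for x > E and 0 for x < E, so the phase becomes
    pi times the mass to the right of E. *)
Lemma phase_cvg (k : R -> R) (E T : R) : 0 < T ->
  (forall x, 0 <= k x <= 1) -> {homo k : x y / x <= y} ->
  {for E, continuous k} ->
  phase k E T s @[s --> 0^'+] --> pi * (1 - k E).
Proof.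
move=> T0 k01 kmono kc.
have Ts : T / s @[s --> 0^'+] --> +oo.
  apply/cvgryPge => M; near=> s.
  have s0 : 0 < s by near: s; exact: nbhs_right_gt.
  have sT : s <= T / (`|M| + 1).
    by near: s; apply: nbhs_right_le; rewrite divr_gt0// ltr_wpDl.
  rewrite ler_pdivlMr//; apply: (@le_trans _ _ ((`|M| + 1) * s)).
    by rewrite ler_wpM2r ?(ltW s0)// (le_trans (ler_norm _))// lerDl.
  by rewrite mulrC -ler_pdivlMr// ltr_wpDl.
have at_cvg : atan (T / s) @[s --> 0^'+] --> pi / 2 := cvg_comp _ _ Ts (@cvgy_atan R).
apply/cvgrPdist_le => eps eps0.
have pi0 : 0 < pi :> R := pi_gt0 R.
pose del := eps / (3 * pi).
have del0 : 0 < del by rewrite divr_gt0// mulr_gt0.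
have [tau tau0 klip] : exists2 tau, 0 < tau & forall x, `|x - E| <= tau -> `|k x - k E| <= del.
  move/cvgrPdist_le: kc => /(_ _ del0)[r /= r0 kr].
  exists (r / 2); first by rewrite divr_gt0.
  move=> x xr; rewrite distrC; apply: kr => /=; rewrite distrC; lra.
move/cvgrPdist_le: at_cvg => /(_ (eps / 3)) at_cvg.
near=> s.
have s0 : 0 < s by near: s; exact: nbhs_right_gt.
have as3 : `|pi / 2 - atan (T / s)| <= eps / 3.
  by near: s; apply: at_cvg; rewrite divr_gt0.
have st : s <= eps / 3 / (2 * T / tau ^+ 2).
  by near: s; apply: nbhs_right_le; rewrite !divr_gt0// ?mulr_gt0// exprn_gt0.
have b1 := phase_bound s0 T0 tau0 (ltW del0) k01 kmono klip.
have dp : del * pi = eps / 3 by rewrite /del invfM mulrA divfK ?gt_eqF.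
have st2 : 2 * T * s / tau ^+ 2 <= eps / 3.
  by rewrite mulrAC mulrC -ler_pdivlMr// divr_gt0 ?mulr_gt0// exprn_gt0.
have b2 : `|(1 - 2 * k E) * (pi / 2 - atan (T / s))| <= eps / 3.
  rewrite normrM -[leRHS]mul1r ler_pM//.
  by have /andP[? ?] := k01 E; rewrite ler_norml; apply/andP; split; lra.
move: b1 b2; rewrite !ler_norml dp => /andP[p1 p2] /andP[q1 q2].
apply/andP; split; nra.
Unshelve. all: by end_near. Qed.

End Calculus.

(** * Arguments of complex products and convexity inequalities for means *)

Section PhaseFormula.
Variables (R : realType).

(** The argument of x + i y for y > 0; the quotient x / y avoids a case distinction on the sign of
    x. *)
Definition arg_upper (x y : R) : R := pi / 2 - atan (x / y).

Lemma arg_upper_gt0 x y : 0 < arg_upper x y.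
Proof. by rewrite /arg_upper subr_gt0 atan_ltpi2. Qed.

Lemma arg_upper_lt_pi x y : arg_upper x y < pi.
Proof. by have := atan_gtNpi2 (x / y); rewrite /arg_upper; lra. Qed.

Lemma sqrt_polar (x y : R) : 0 < y ->
  Num.sqrt (1 + (x / y) ^+ 2) = Num.sqrt (x ^+ 2 + y ^+ 2) / y.
Proof.
move=> y0; have -> : 1 + (x / y) ^+ 2 = (x ^+ 2 + y ^+ 2) / y ^+ 2.
  by field; rewrite gt_eqF.
by rewrite sqrtrM ?addr_ge0 ?sqr_ge0// sqrtrV ?sqr_ge0// sqrtr_sqr gtr0_norm.
Qed.

Lemma sin_arg_upper x y : 0 < y ->
  sin (arg_upper x y) = y / Num.sqrt (x ^+ 2 + y ^+ 2).
Proof.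
move=> y0; rewrite /arg_upper sinB sin_pihalf cos_pihalf mul0r subr0 mul1r.
by rewrite cos_atan sqrt_polar// invf_div.
Qed.

Lemma cos_arg_upper x y : 0 < y ->
  cos (arg_upper x y) = x / Num.sqrt (x ^+ 2 + y ^+ 2).
Proof.
move=> y0; rewrite /arg_upper cosB sin_pihalf cos_pihalf mul0r add0r mul1r.
have cn : cos (atan (x / y)) != 0 by rewrite gt_eqF// cos_gt0_pihalf// atan_gtNpi2 atan_ltpi2.
have : sin (atan (x / y)) = tan (atan (x / y)) * cos (atan (x / y)).
  by rewrite /tan divfK.
move=> ->; rewrite atanK cos_atan sqrt_polar// invf_div.
have s0 : Num.sqrt (x ^+ 2 + y ^+ 2) != 0.
  by rewrite gt_eqF// sqrtr_gt0 ltr_wpDl ?sqr_ge0 ?exprn_gt0.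
by field; rewrite s0 gt_eqF.
Qed.

Lemma prod_polar n (x y : nat -> R) : (forall j, 0 < y j) ->
  \prod_(j < n) (x j +i* y j)%C =
  (\prod_(j < n) Num.sqrt (x j ^+ 2 + y j ^+ 2))%:C%C *
  (cos (\sum_(j < n) arg_upper (x j) (y j)) +i*
   sin (\sum_(j < n) arg_upper (x j) (y j)))%C.
Proof.
move=> y0; elim: n => [|n IH].
  by rewrite !big_ord0 cos0 sin0 mul1r.
rewrite !big_ord_recr /= IH (cosD (\sum_(j < n) _)) (sinD (\sum_(j < n) _)).
rewrite (@sin_arg_upper (x n) _ (y0 n)) (@cos_arg_upper (x n) _ (y0 n)).
have s0 : Num.sqrt (x n ^+ 2 + y n ^+ 2) != 0.
  by rewrite gt_eqF// sqrtr_gt0 ltr_wpDl ?sqr_ge0 ?exprn_gt0.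
by apply/eqP; rewrite eq_complex /=; apply/andP; split; apply/eqP; field.
Qed.

Lemma normc2_prod n (x y : nat -> R) :
  complex.Re (\prod_(j < n) (x j +i* y j)%C) ^+ 2
  + complex.Im (\prod_(j < n) (x j +i* y j)%C) ^+ 2
  = \prod_(j < n) (x j ^+ 2 + y j ^+ 2).
Proof.
elim: n => [|n IH]; first by rewrite !big_ord0 /=; ring.
rewrite !big_ord_recr/= -IH; case: (\prod_(i < n) _) => u v /=; ring.
Qed.

Lemma ln_prod n (x : nat -> R) : (forall j, 0 < x j) ->
  ln (\prod_(j < n) x j) = \sum_(j < n) ln (x j).
Proof.
move=> x0; elim: n => [|n IH]; first by rewrite !big_ord0 ln1.
by rewrite !big_ord_recr/= lnM ?IH ?posrE//; exact: prodr_gt0.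
Qed.

Lemma cos_eq1_lt_pi (t : R) : `|t| < pi -> cos t = 1 -> t = 0.
Proof.
move=> tpi ct; have : cos `|t| = cos 0.
  by rewrite cos0 -ct; case: (ger0P t) => _ //; rewrite cosN.
by move=> /cos_inj/eqP; rewrite ?in_itv/= ?lexx ?pi_ge0 ?normr_ge0 ?ltW//
  => /(_ isT isT); rewrite normr_eq0 => /eqP.
Qed.

(* [D] is continuous with values in 2 pi Z. *)
Lemma phase_rigidity (D : R -> R) :
  (forall e, 0 < e -> {for e, continuous D}) ->
  D e @[e --> +oo] --> 0 -> (forall e, 0 < e -> cos (D e) = 1) ->
  forall e, 0 < e -> D e = 0.
Proof.
move=> cD D0 cosD e e0.
apply: cos_eq1_lt_pi; last exact: cosD.
rewrite ltNge; apply/negP => Dpi.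
have pi0 : 0 < pi :> R := pi_gt0 R.
have [e1 [ee1 De1]] : exists e1, e <= e1 /\ `|D e1| < pi.
  have /cvgrPdist_lt/(_ _ pi0)[M [_ HM]] := D0.
  exists (Num.max e (M + 1)); rewrite le_max lexx; split => //.
  have := HM (Num.max e (M + 1)); rewrite sub0r normrN; apply.
  by rewrite lt_max ltrDl ltr01 orbT.
have [c /andP[ec ce] Dc] : exists2 c, e <= c <= e1 & `|D c| = pi.
  have [||c] := @IVT R (fun x => `|D x|) e e1 pi ee1.
  - apply: continuous_in_subspaceT => x; rewrite inE /= in_itv/= => /andP[ex _].
    by apply: cvg_norm; apply: cD; exact: lt_le_trans ex.
  - by rewrite ge_min le_max (ltW De1) Dpi orbT.
  - by rewrite in_itv/= => ec Dc; exists c.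
have := cosD c (lt_le_trans e0 ec).
have -> : cos (D c) = cos `|D c| by case: (ger0P (D c)) => _ //; rewrite cosN.
by rewrite Dc cospi; lra.
Qed.

Lemma cvg_sum_ord (T : Type) (F : set_system T) (FF : Filter F) n
    (f : nat -> T -> R) (l : nat -> R) : (forall j, f j t @[t --> F] --> l j) ->
  \sum_(j < n) f j t @[t --> F] --> \sum_(j < n) l j.
Proof.
move=> fl; elim: n => [|n IH].
  by rewrite big_ord0; under eq_fun do rewrite big_ord0; exact: cvg_cst.
rewrite big_ord_recr; under eq_fun do rewrite big_ord_recr.
by apply: cvgD; [exact: IH|exact: fl].
Qed.

(** Each term is bounded below by the tangent of [expR] at the mean, and the linear parts sum to 0.
    [mean_sin_le] is the same argument for the concave sine. *)
Lemma amgm_exp n (u : nat -> R) : (0 < n)%N ->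
  expR ((\sum_(j < n) u j) / n%:R) <= (\sum_(j < n) expR (u j)) / n%:R.
Proof.
move=> n0; have nR : 0 < n%:R :> R by rewrite ltr0n.
set m := (\sum_(j < n) u j) / n%:R.
rewrite ler_pdivlMr//.
have : \sum_(j < n) expR m * (1 + (u j - m)) <= \sum_(j < n) expR (u j).
  apply: ler_sum => j _; rewrite -{2}(subrK m (u j)) expRD mulrC.
  by apply: ler_wpM2r; [exact: expR_ge0|exact: expR_ge1Dx].
apply: le_trans; rewrite -mulr_sumr ler_wpM2l ?expR_ge0//.
rewrite big_split/= sumrB !sumr_const card_ord -[m *+ n]mulr_natr /m divfK ?gt_eqF//.
by rewrite subrr addr0.
Qed.

Lemma sin_tangent (x y : R) : 0 <= x <= pi -> 0 <= y <= pi ->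
  sin x <= sin y + cos y * (x - y).
Proof.
move=> /andP[x0 xp] /andP[y0 yp].
have dsin (z : R) : is_derive z 1 (@sin R) (cos z) by exact: is_derive_sin.
have csin u v : {within `[u, v], continuous (@sin R)}.
  by apply: continuous_subspaceT; exact: continuous_sin.
have [xy|yx] := leP x y.
  have [c] := @MVT_segment R sin cos x y xy (fun z _ => dsin z) (csin _ _).
  rewrite in_itv/= => /andP[xc cy] E.
  have : cos y <= cos c.
    by rewrite leNgt ltr_cos -?leNgt// in_itv/= ?y0 ?yp ?(le_trans x0 xc) ?(le_trans cy yp).
  move=> h; have : (cos c - cos y) * (y - x) >= 0 by rewrite mulr_ge0// subr_ge0.
  by nra.
have [c] := @MVT_segment R sin cos y x (ltW yx) (fun z _ => dsin z) (csin _ _).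
rewrite in_itv/= => /andP[yc cx] E.
have : cos c <= cos y.
  by rewrite leNgt ltr_cos -?leNgt// in_itv/= ?y0 ?yp ?(le_trans y0 yc) ?(le_trans cx xp).
move=> h; have : (cos y - cos c) * (x - y) >= 0 by rewrite mulr_ge0// subr_ge0// ltW.
by nra.
Qed.

Lemma mean_sin_le n (phi : nat -> R) : (0 < n)%N -> (forall j, 0 < phi j < pi) ->
  (\sum_(j < n) sin (phi j)) / n%:R <= sin ((\sum_(j < n) phi j) / n%:R).
Proof.
move=> n0 p; have nR : 0 < n%:R :> R by rewrite ltr0n.
set m := (\sum_(j < n) phi j) / n%:R.
have m01 : 0 <= m <= pi.
  rewrite /m divr_ge0 ?ler0n ?sumr_ge0//=; last by move=> j _; have /andP[/ltW] := p j.
  rewrite ler_pdivrMr// mulr_natr -[X in _ *+ X](card_ord n) -sumr_const.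
  by apply: ler_sum => j _; have /andP[_ /ltW] := p j.
rewrite ler_pdivrMr//.
apply: (@le_trans _ _ (\sum_(j < n) (sin m + cos m * (phi j - m)))).
  apply: ler_sum => j _; apply: sin_tangent => //.
  by have /andP[/ltW -> /ltW ->] := p j.
rewrite big_split/= -mulr_sumr sumrB !sumr_const card_ord.
by rewrite -[m *+ n]mulr_natr {4}/m divfK ?gt_eqF// subrr mulr0 addr0 mulr_natr.
Qed.

End PhaseFormula.

(** * The Riccati recursion *)

Section Riccati.
Variables (R : realType) (a b : nat -> R) (E : R).

(* Real and imaginary parts of P_(n+1)(z) / P_n(z) at z = E + i e, where P_n is
   [monic_op n]. *)
Fixpoint riccati (e : R) (n : nat) : R * R :=
  if n is m.+1 then
    let p := riccati e m in
    (E - b n.+1 - a n ^+ 2 * (p.1 / (p.1 ^+ 2 + p.2 ^+ 2)),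
     e + a n ^+ 2 * (p.2 / (p.1 ^+ 2 + p.2 ^+ 2)))
  else (E - b 1%N, e).

Let X e n := (riccati e n).1.
Let Y e n := (riccati e n).2.

Lemma riccati_im_ge e n : 0 < e -> e <= Y e n.
Proof.
move=> e0; elim: n => [|n IH]; first by rewrite /Y.
rewrite /Y /= lerDl mulr_ge0 ?sqr_ge0// divr_ge0 ?addr_ge0 ?sqr_ge0//.
exact: le_trans (ltW e0) IH.
Qed.

Let Y_gt0 e n : 0 < e -> 0 < Y e n.
Proof. by move=> e0; apply: lt_le_trans (riccati_im_ge n e0). Qed.

Let rho e n := X e n ^+ 2 + Y e n ^+ 2.

Let rho_gt0 e n : 0 < e -> 0 < rho e n.
Proof. by move=> e0; rewrite /rho ltr_wpDl ?sqr_ge0 ?exprn_gt0 ?Y_gt0. Qed.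

(** The product of ratios telescopes. The induction also carries the next ratio, since the recursion
    for the polynomials has order two. *)
Lemma horner_monic_op_riccati e n : 0 < e ->
  (map_poly (real_complex R) (monic_op a b n)).[(E +i* e)%C] =
  \prod_(j < n) (X e j +i* Y e j)%C.
Proof.
move=> e0.
suff H : (map_poly (real_complex R) (monic_op a b n.+1)).[(E +i* e)%C] =
    (X e n +i* Y e n)%C * (map_poly (real_complex R) (monic_op a b n)).[(E +i* e)%C]
  /\ (map_poly (real_complex R) (monic_op a b n)).[(E +i* e)%C] =
     \prod_(j < n) (X e j +i* Y e j)%C by have [] := H.
elim: n => [|n [IH1 IH2]].
  split; last by rewrite big_ord0 rmorph1 hornerC.
  rewrite [monic_op a b 1]/= subr0 mulr1 rmorphB /= map_polyX map_polyC hornerXsubC.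
  rewrite rmorph1 hornerC mulr1 /X /Y /=.
  by apply/eqP; rewrite eq_complex /= subr0 !eqxx.
split; last by rewrite big_ord_recr -IH2 IH1 mulrC.
rewrite monic_opSS rmorphB !rmorphM /= rmorphB /= map_polyX !map_polyC hornerD hornerN.
rewrite !hornerM hornerXsubC hornerC IH1 mulrA mulrA -mulrBl; congr (_ * _).
have := rho_gt0 n e0; rewrite /rho /X /Y /=; case: (riccati e n) => x y /= /lt0r_neq0 ne.
by apply/eqP; rewrite eq_complex /=; apply/andP; split; apply/eqP; field.
Qed.

Variables (n : nat) (d : nat -> R).
Hypothesis monicE : monic_op a b n = \prod_(j < n) ('X - (d j)%:P).

Lemma prod_riccati e : 0 < e ->
  \prod_(j < n) (X e j +i* Y e j)%C = \prod_(j < n) ((E - d j) +i* e)%C.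
Proof.
move=> e0; rewrite -horner_monic_op_riccati// monicE rmorph_prod /= horner_prod.
apply: eq_bigr => j _; rewrite rmorphB /= map_polyX map_polyC hornerXsubC.
by apply/eqP; rewrite eq_complex /= subr0 !eqxx.
Qed.

Lemma sum_ln_riccati e : 0 < e ->
  \sum_(j < n) ln (rho e j) = \sum_(j < n) ln ((d j - E) ^+ 2 + e ^+ 2).
Proof.
move=> e0; have := normc2_prod n (X e) (Y e); rewrite prod_riccati//.
rewrite (normc2_prod n (fun j => E - d j) (fun=> e)) => /(congr1 (@ln R)).
rewrite (@ln_prod _ n (fun j => (E - d j) ^+ 2 + e ^+ 2)); last first.
  by move=> j; exact: sqr_dist_gt0.
rewrite (@ln_prod _ n (rho e)); last by move=> j; exact: rho_gt0.
move=> <-; apply: eq_bigr => j _; congr (ln _); ring.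
Qed.

Let riccati_cont e i : 0 < e -> {for e, continuous (X ^~ i)} /\ {for e, continuous (Y ^~ i)}.
Proof.
move=> e0; elim: i => [|i [cX cY]].
  by split; [exact: cvg_cst|exact: cvg_id].
have cr : {for e, continuous (rho ^~ i)}.
  by apply: cvgD; rewrite ?expr2; apply: cvgM; [exact: cX|exact: cX|exact: cY|exact: cY].
have r0 : rho e i != 0 by rewrite gt_eqF// rho_gt0.
split.
  apply: cvgB; first exact: cvg_cst.
  apply: cvgM; first exact: cvg_cst.
  by apply: cvgM; [exact: cX|apply: cvgV].
apply: cvgD; first exact: cvg_id.
apply: cvgM; first exact: cvg_cst.
by apply: cvgM; [exact: cY|apply: cvgV].
Qed.

Let arg_cvg_pinfty (f g : R -> R) (M : R) :
  (forall e, 1 <= e -> `|f e| <= M) -> (forall e, 1 <= e -> e <= g e) ->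
  arg_upper (f e) (g e) @[e --> +oo] --> pi / 2.
Proof.
move=> fM ge; rewrite -[X in _ --> X]subr0 -(atan0 R).
apply: cvgB; first exact: cvg_cst.
apply: continuous_cvg; first exact: continuous_atan.
have M0 : 0 <= M by rewrite (le_trans _ (fM 1 (lexx _))).
apply/cvgrPdist_le => eps eps0; near=> e.
have e1 : 1 <= e by near: e; exact: nbhs_pinfty_ge.
have eM : M / eps <= e by near: e; apply: nbhs_pinfty_ge; exact: num_real.
have g0 : 0 < g e by rewrite (lt_le_trans _ (ge _ e1))// (lt_le_trans ltr01).
rewrite sub0r normrN normrM normfV (gtr0_norm g0) ler_pdivrMr//.
apply: le_trans (fM _ e1) _; rewrite mulrC -ler_pdivrMr//.
by apply: le_trans eM (ge _ e1).
Unshelve. all: by end_near. Qed.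

Let X_bound i : exists M, forall e, 1 <= e -> `|X e i| <= M.
Proof.
case: i => [|i]; first by exists `|E - b 1%N| => e _.
exists (`|E - b i.+2| + a i.+1 ^+ 2) => e e1.
have e0 : 0 < e by exact: lt_le_trans e1.
rewrite /X /=; apply: le_trans (ler_normB _ _) _; rewrite lerD2l normrM ger0_norm ?sqr_ge0//.
rewrite -[leRHS]mulr1 ler_wpM2l ?sqr_ge0// normrM normfV.
have r0 := rho_gt0 i e0; rewrite (gtr0_norm r0) ler_pdivrMr// mul1r.
have y1 : 1 <= Y e i := le_trans e1 (riccati_im_ge i e0).
have := sqr_ge0 (`|X e i| - 1); have := real_normK (num_real (X e i)).
rewrite /X /Y in y1 * => xx; rewrite sqrrB1 xx => h.
have y2 : 1 <= (riccati e i).2 ^+ 2 by rewrite expr_ge1// (le_trans ler01).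
have := normr_ge0 (riccati e i).1; move: h; rewrite -mulr_natl /rho /X /Y; nra.
Qed.

(** Both products are the same complex number, so the two sums agree modulo 2 pi. They are
    continuous in e, and all arguments tend to pi / 2 as e grows, so the difference is 0 at every
    e. *)
Lemma sum_arg_riccati e : 0 < e ->
  \sum_(j < n) arg_upper (X e j) (Y e j) = \sum_(j < n) arg_upper (E - d j) e.
Proof.
move: e.
pose D e := \sum_(j < n) arg_upper (X e j) (Y e j) - \sum_(j < n) arg_upper (E - d j) e.
have cD e : 0 < e -> {for e, continuous D}.
  move=> e0; apply: cvgB.
    apply: (@cvg_sum_ord R R _ _ n (fun j t => arg_upper (X t j) (Y t j))
      (fun j => arg_upper (X e j) (Y e j))) => j.
    apply: cvgB; first exact: cvg_cst.
    apply: continuous_cvg; first exact: continuous_atan.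
    have [cX cY] := riccati_cont j e0.
    by apply: cvgM; [exact: cX|apply: cvgV; [rewrite gt_eqF// Y_gt0|exact: cY]].
  apply: (@cvg_sum_ord R R _ _ n (fun j t => arg_upper (E - d j) t)
    (fun j => arg_upper (E - d j) e)) => j.
  apply: cvgB; first exact: cvg_cst.
  apply: continuous_cvg; first exact: continuous_atan.
  by apply: cvgM; [exact: cvg_cst|apply: cvgV; [rewrite gt_eqF|exact: cvg_id]].
have D0 : D e @[e --> +oo] --> 0.
  rewrite -(subrr (\sum_(j < n) (pi / 2 : R))).
  apply: cvgB.
    apply: (@cvg_sum_ord R R _ _ n (fun j t => arg_upper (X t j) (Y t j))
      (fun=> pi / 2)) => j.
    have [M XM] := X_bound j; apply: (arg_cvg_pinfty XM) => e e1.
    by apply: riccati_im_ge; exact: lt_le_trans e1.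
  apply: (@cvg_sum_ord R R _ _ n (fun j t => arg_upper (E - d j) t) (fun=> pi / 2)) => j.
  by apply: (@arg_cvg_pinfty _ id `|E - d j|) => e.
have cosD e : 0 < e -> cos (D e) = 1.
  move=> e0; rewrite /D cosB.
  have := prod_polar n (X e) (fun j => Y_gt0 j e0).
  rewrite prod_riccati// (prod_polar n (fun j => E - d j) (fun=> e0)).
  set A := \sum_(j < n) arg_upper (X e j) (Y e j).
  set B := \sum_(j < n) arg_upper (E - d j) e.
  set r := \prod_(j < n) _; set r' := \prod_(j < n) _ => /eqP.
  rewrite eq_complex /= !mul0r !subr0 !addr0 => /andP[/eqP h1 /eqP h2].
  have r0 : 0 < r by apply: prodr_gt0 => j _; rewrite sqrtr_gt0 ltr_wpDl ?sqr_ge0 ?exprn_gt0.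
  have r'0 : 0 < r' by apply: prodr_gt0 => j _; rewrite sqrtr_gt0 rho_gt0.
  have cA := cos2Dsin2 A; have cB := cos2Dsin2 B.
  have rr : r ^+ 2 = r' ^+ 2.
    rewrite -[LHS]mulr1 -[RHS]mulr1 -{1}cB -cA !mulrDr -!exprMn h1 h2//.
  have {}rr : r = r' by apply/eqP; rewrite -(@eqrXn2 _ 2) ?ltW// rr.
  move: h1 h2; rewrite -rr => /(mulfI (lt0r_neq0 r0)) <- /(mulfI (lt0r_neq0 r0)) <-.
  by rewrite -!expr2.
by move=> e e0; apply/eqP; rewrite -subr_eq0; apply/eqP; exact: (phase_rigidity cD D0 cosD).
Qed.

End Riccati.

Section RiccatiMean.
Variables (R : realType) (a b : nat -> R) (E e C : R).
Hypothesis e0 : 0 < e.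
Hypothesis a_gt0 : forall n, (1 <= n)%N -> 0 < a n.
Hypothesis a_le : forall n, (1 <= n)%N -> a n <= C.

Let x j := (riccati a b E e j).1.
Let y j := (riccati a b E e j).2.
Let rho j := x j ^+ 2 + y j ^+ 2.
Let s j := sin (arg_upper (x j) (y j)).

(* Both summands of 1 = e / Y_(j+1) + a_(j+1)^2 Y_j / (rho_j Y_(j+1)) are averaged
   with the AM-GM inequality; the sum of the logarithms of the second ones
   telescopes once it is made cyclic, which costs the term C^2 / (n e^2). *)
Lemma riccati_mean_ineq n (r A sn : R) : (0 < n)%N ->
  r = expR ((\sum_(j < n) ln (rho j) / 2) / n%:R) ->
  A = expR ((\sum_(j < n) ln (a j.+1)) / n%:R) ->
  sn = sin ((\sum_(j < n) arg_upper (x j) (y j)) / n%:R) ->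
  e * r + A ^+ 2 * sn <= (1 + (C / e) ^+ 2 / n%:R) * r ^+ 2 * sn.
Proof.
case: n => // m _ rE AE snE.
have nR : 0 < m.+1%:R :> R by rewrite ltr0n.
have y_ge j : e <= y j := riccati_im_ge a b E j e0.
have y_gt0 j : 0 < y j := lt_le_trans e0 (y_ge j).
have rho_gt0 j : 0 < rho j by rewrite /rho ltr_wpDl ?sqr_ge0 ?exprn_gt0.
pose t j := a j.+1 ^+ 2 * (y j / rho j).
have t_gt0 j : 0 < t j by rewrite mulr_gt0 ?divr_gt0// exprn_gt0// a_gt0.
have yS j : y j.+1 = e + t j by [].
have s_gt0 j : 0 < s j by rewrite /s sin_arg_upper// divr_gt0// sqrtr_gt0 rho_gt0.
have ln_y j : ln (y j) = ln (rho j) / 2 + ln (s j).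
  rewrite /s sin_arg_upper// ln_div ?posrE ?sqrtr_gt0 ?rho_gt0//.
  have : ln (Num.sqrt (rho j)) *+ 2 = ln (rho j).
    by rewrite -lnXn ?sqrtr_gt0 ?rho_gt0// sqr_sqrtr// ltW.
  by rewrite /rho -mulr_natr => <-; field.
pose u1 j := ln e - ln (y j).
pose u2 j := (if j is i.+1 then ln (t i) else ln (t m)) - ln (y j).
(* The geometric mean of the sines, which enters because y_j is sqrt(rho_j) times the sine of the
   argument. *)
pose S := expR ((\sum_(j < m.+1) ln (s j)) / m.+1%:R).
have S_le : S <= sn.
  apply: le_trans (amgm_exp (fun j => ln (s j)) (ltn0Sn m)) _.
  rewrite snE; apply: le_trans
    (@mean_sin_le R m.+1 (fun j => arg_upper (x j) (y j)) (ltn0Sn m) _); last first.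
    by move=> j; rewrite arg_upper_gt0 arg_upper_lt_pi.
  by rewrite ler_pM2r ?invr_gt0//; apply: ler_sum => j _; rewrite lnK// posrE.
have h1 : e / (r * S) <= (\sum_(j < m.+1) expR (u1 j)) / m.+1%:R.
  apply: le_trans (amgm_exp u1 (ltn0Sn m)).
  rewrite -[e in leLHS]lnK ?posrE// rE /S -expRD -expRN -expRD ler_expR.
  have -> : \sum_(j < m.+1) u1 j = m.+1%:R * ln e -
      (\sum_(j < m.+1) ln (rho j) / 2 + \sum_(j < m.+1) ln (s j)).
    rewrite -big_split/= /u1 sumrB sumr_const card_ord mulr_natl; congr (_ - _).
    by apply: eq_bigr => j _; rewrite ln_y.
  by rewrite le_eqVlt; apply/orP; left; apply/eqP; field; rewrite gt_eqF.
have h2 : A ^+ 2 / r ^+ 2 <= (\sum_(j < m.+1) expR (u2 j)) / m.+1%:R.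
  apply: le_trans (amgm_exp u2 (ltn0Sn m)).
  rewrite AE rE -!expRM_natl -expRN -expRD ler_expR.
  have -> : \sum_(j < m.+1) u2 j = \sum_(j < m.+1) (ln (t j) - ln (y j)).
    rewrite /u2 !sumrB; congr (_ - _).
    by rewrite big_ord_recl [RHS]big_ord_recr/= addrC.
  have -> : \sum_(j < m.+1) (ln (t j) - ln (y j)) =
      \sum_(j < m.+1) (2 * ln (a j.+1) - 2 * (ln (rho j) / 2)).
    apply: eq_bigr => j _; rewrite /t lnM ?posrE ?divr_gt0 ?exprn_gt0 ?a_gt0//.
    by rewrite ln_div ?posrE// lnXn ?a_gt0// -mulr_natl; field.
  by rewrite sumrB -!mulr_sumr mulrBl -!mulrA.
have tm : t m / e <= (C / e) ^+ 2.
  rewrite expr_div_n [e ^+ 2]expr2 invfM mulrA ler_pM2r ?invr_gt0//.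
  rewrite /t ler_pM ?sqr_ge0 ?divr_ge0 ?(ltW (y_gt0 _)) ?(ltW (rho_gt0 _))//.
    have a1 := a_gt0 (ltn0Sn m); have a2 := a_le (ltn0Sn m).
    by rewrite lerXn2r ?nnegrE ?(ltW a1) ?(le_trans (ltW a1) a2).
  rewrite ler_pdivrMr// mulrC ler_pdivlMr// (le_trans (ler_wpM2l (ltW (y_gt0 m)) (y_ge m)))//.
  by rewrite -expr2 /rho lerDr sqr_ge0.
(* By the recursion every index other than 0 contributes exactly 1. Index 0 contributes e / y_0 = 1
   and the inserted term t_m / e. *)
have sum1 : \sum_(j < m.+1) expR (u1 j) + \sum_(j < m.+1) expR (u2 j) <=
    m.+1%:R + (C / e) ^+ 2.
  rewrite -big_split/= big_ord_recl /= /u1 /u2 !expRB !lnK ?posrE// divff ?gt_eqF//.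
  rewrite (eq_bigr (fun=> 1)); last first.
    move=> j _; rewrite /bump /= add1n !expRB !lnK ?posrE// -mulrDl yS divff//.
    by rewrite -yS gt_eqF.
  rewrite sumr_const card_ord -natr1; lra.
have main : e / (r * S) + A ^+ 2 / r ^+ 2 <= 1 + (C / e) ^+ 2 / m.+1%:R.
  apply: le_trans (lerD h1 h2) _; rewrite -mulrDl ler_pdivrMr// mulrDl mul1r.
  by rewrite divfK ?gt_eqF.
have r0 : 0 < r by rewrite rE expR_gt0.
have S0 : 0 < S := expR_gt0 _.
set kap := 1 + _ in main *.
have main2 : e * r + A ^+ 2 * S <= kap * r ^+ 2 * S.
  have := ler_wpM2r (ltW (mulr_gt0 (exprn_gt0 2 r0) S0)) main.
  have -> : (e / (r * S) + A ^+ 2 / r ^+ 2) * (r ^+ 2 * S) = e * r + A ^+ 2 * S.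
    by field; rewrite !gt_eqF.
  by rewrite mulrA.
have er : 0 < e * r by exact: mulr_gt0.
(* Replacing S by the larger [sn] requires this factor to be nonnegative; [main2] gives it because e
   r > 0. *)
have q0 : 0 < kap * r ^+ 2 - A ^+ 2.
  by rewrite -(pmulr_lgt0 _ S0) mulrBl; lra.
have := ler_wpM2l (ltW q0) S_le; rewrite !mulrBl; lra.
Qed.

End RiccatiMean.

(** * Almost everywhere bounds *)

Section GeneralizedEigenfunctionBound.
Variables (R : realType) (a b : nat -> R) (C : R).
Local Notation mu := (@lebesgue_measure R).
Hypothesis a_neq0 : forall n, (1 <= n)%N -> a n != 0.
Hypothesis a_bound : forall n, (1 <= n)%N -> `|a n| <= C.
Hypothesis b_bound : forall n, (1 <= n)%N -> `|b n| <= C.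

(** L depends on n; this is harmless because n is fixed while the parameter multiplying L^2 tends to
    0. *)
Lemma ortho_op_lipschitz n (E K : R) : exists L, forall x, `|x| <= K ->
  `|ortho_op a b n E - ortho_op a b n x| <= L * `|E - x|.
Proof.
set p := monic_op a b n.
have /factor_theorem[q qE] : root (p - p.[E]%:P) E.
  by rewrite rootE !hornerE subrr.
set c := \prod_(1 <= j < n.+1) a j.
exists ((\sum_(i < size q) `|q`_i| * K ^+ i) * `|c|^-1) => x xK.
have px : p.[x] - p.[E] = q.[x] * (x - E).
  have := congr1 (fun r => r.[x]) qE.
  by rewrite /= hornerD hornerN hornerC hornerM hornerXsubC.
rewrite distrC /ortho_op -/p -/c -mulrBl px !normrM normfV [`|x - E|]distrC.
rewrite mulrAC ler_wpM2r// ler_wpM2r ?invr_ge0// horner_coef.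
apply: le_trans (ler_norm_sum _ _ _) _; apply: ler_sum => i _.
by rewrite normrM ler_wpM2l// normrX lerXn2r ?nnegrE// (le_trans _ xK).
Qed.

Variables d w : nat -> nat -> R.
Hypothesis dw : spectral_data a b d w.

Let eps k : R := k.+1%:R^-1.
Let eps_gt0 k : 0 < eps k. Proof. by rewrite invr_gt0 ltr0n. Qed.
Let W N x : R := \sum_(n < N.+1) n.+1%:R ^- 2 * ortho_op a b n x ^+ 2.
Let Q k N E : R := \sum_(j < N.+1)
  w N j * W N (d N j) * (eps k / ((E - d N j) ^+ 2 + eps k ^+ 2)).

Let sum_inv_sqr N : \sum_(n < N.+1) (n.+1%:R : R) ^- 2 <= 2.
Proof.
suff : \sum_(n < N.+1) (n.+1%:R : R) ^- 2 <= 2 - N.+1%:R^-1.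
  by move/le_trans; apply; rewrite gerBl invr_ge0 ler0n.
elim: N => [|N IH]; first by rewrite big_ord1 expr1n invr1; lra.
rewrite big_ord_recr /=; apply: le_trans (lerD IH (lexx _)) _.
have n0 : 0 < N.+1%:R :> R by rewrite ltr0n.
rewrite -[N.+2%:R]natr1; set x : R := N.+1%:R in n0 *.
have x1 : 0 < x + 1 by lra.
rewrite -addrA lerD2l -subr_ge0.
have -> : - (x + 1)^-1 - (- x^-1 + (x + 1) ^- 2) = (x * (x + 1) ^+ 2)^-1.
  by field; rewrite !gt_eqF.
by rewrite invr_ge0 mulr_ge0 ?sqr_ge0// ltW.
Qed.

Let W_ge0 N x : 0 <= W N x.
Proof. by apply: sumr_ge0 => n _; rewrite mulr_ge0 ?invr_ge0 ?sqr_ge0 ?exprn_ge0. Qed.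

Let sum_wW N : \sum_(j < N.+1) w N j * W N (d N j) <= 2.
Proof.
have [_ o _ _] := dw N; apply: le_trans (sum_inv_sqr N).
rewrite (eq_bigr (fun j : 'I_N.+1 => \sum_(n < N.+1)
   n.+1%:R ^- 2 * (w N j * (ortho_op a b n (d N j) * ortho_op a b n (d N j))))); last first.
  by move=> j _; rewrite /W mulr_sumr; apply: eq_bigr => n _; rewrite expr2 mulrCA.
rewrite exchange_big /= le_eqVlt; apply/orP; left; apply/eqP; apply: eq_bigr => n _.
by rewrite -mulr_sumr o ?eqxx ?mulr1// -ltnS.
Qed.

Let Q_cont k N : continuous (Q k N).
Proof.
move=> x; apply: (@cvg_sum_ord R R _ _ N.+1
  (fun j E => w N j * W N (d N j) * (eps k / ((E - d N j) ^+ 2 + eps k ^+ 2)))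
  (fun j => w N j * W N (d N j) * (eps k / ((x - d N j) ^+ 2 + eps k ^+ 2)))) => j.
by apply: cvgM; [exact: cvg_cst|exact: (@continuous_poisson R _ _ (eps_gt0 k))].
Qed.

Let Q_integral k N T : 0 < T ->
  (\int[mu]_(E in `[(- T)%R, T]%classic) (Q k N E)%:E <= (2 * pi)%:E)%E.
Proof.
move=> T0; pose G E := \sum_(j < N.+1) w N j * W N (d N j) * atan ((E - d N j) / eps k).
have [w0 _ _ _] := dw N.
have dG (x : R) : is_derive x (1 : R) G (Q k N x).
  apply: (@is_derive_bigsum R N.+1
    (fun j E => w N j * W N (d N j) * atan ((E - d N j) / eps k))
    (fun j => w N j * W N (d N j) * (eps k / ((x - d N j) ^+ 2 + eps k ^+ 2)))) => j _.
  have h := is_derive_atan_affine x (d N j) (eps_gt0 k).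
  exact: (is_deriveZ (w N j * W N (d N j)) h).
rewrite (@FTC2_is_derive R (Q k N) G (- T) T _ dG (@Q_cont k N)); last by lra.
rewrite lee_fin /G -sumrB; apply: (@le_trans _ _ (\sum_(j < N.+1) w N j * W N (d N j) * pi)).
  apply: ler_sum => j _; rewrite -mulrBr ler_wpM2l ?mulr_ge0//.
  have := atan_ltpi2 ((T - d N j) / eps k); have := atan_gtNpi2 ((- T - d N j) / eps k); lra.
by rewrite -mulr_suml ler_pM2r ?pi_gt0.
Qed.

Let Q_ge0 k N E : 0 <= Q k N E.
Proof.
have [w0 _ _ _] := dw N; apply: sumr_ge0 => j _.
by rewrite !mulr_ge0 ?(ltW (eps_gt0 k)) ?invr_ge0 ?addr_ge0 ?sqr_ge0.
Qed.

(** Moving the polynomial from E to a point x of the spectrum costs L^2 (x - E)^2, and the Poisson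
    kernel turns (x - E)^2 into at most [eps k]. At x the square is one of the terms of [W], up to
    the factor (n + 1)^2. *)
Let poisson_sum_le n N k E L K : (n <= N)%N -> 0 <= K ->
  (forall j : 'I_N.+1, `|d N j| <= K) ->
  (forall x, `|x| <= K -> `|ortho_op a b n E - ortho_op a b n x| <= L * `|E - x|) ->
  ortho_op a b n E ^+ 2 * poisson_sum d w N E (eps k)
    <= 2 * n.+1%:R ^+ 2 * Q k N E + 2 * L ^+ 2 * eps k.
Proof.
move=> nN K0 dK HL; have [w0 _ _ _] := dw N.
have -> : 2 * L ^+ 2 * eps k = \sum_(j < N.+1) w N j * (2 * L ^+ 2 * eps k).
  by rewrite -mulr_suml (sum_weights dw) mul1r.
rewrite /poisson_sum /Q !mulr_sumr -big_split/=.
apply: ler_sum => j _.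
set x := d N j; set D := (x - E) ^+ 2 + eps k ^+ 2.
have D0 : 0 < D by exact: sqr_dist_gt0.
have -> : (E - x) ^+ 2 + eps k ^+ 2 = D by rewrite /D -[(E - x)]opprB sqrrN.
have e0 := eps_gt0 k.
have h1 : ortho_op a b n E ^+ 2 <= 2 * ortho_op a b n x ^+ 2 + 2 * L ^+ 2 * (x - E) ^+ 2.
  have := HL x (dK j); set p := ortho_op a b n E; set q := ortho_op a b n x => pq.
  have : (p - q) ^+ 2 <= (L * `|E - x|) ^+ 2.
    by rewrite -[leLHS]real_normK ?num_real// lerXn2r ?nnegrE// (le_trans _ pq).
  rewrite exprMn real_normK ?num_real// => h.
  by have := sqr_ge0 (p - 2 * q); nra.
have h2 : ortho_op a b n x ^+ 2 <= n.+1%:R ^+ 2 * W N x.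
  rewrite /W (bigD1 (Ordinal (nN : (n < N.+1)%N)))//= mulrDr mulrA.
  rewrite mulfV ?mul1r ?expf_neq0 ?pnatr_eq0// lerDl mulr_ge0 ?exprn_ge0//.
  by apply: sumr_ge0 => i _; rewrite mulr_ge0 ?invr_ge0 ?sqr_ge0 ?exprn_ge0.
have q0 : 0 <= eps k / D by rewrite divr_ge0 ?(ltW e0) ?(ltW D0).
have h3 : (x - E) ^+ 2 * (eps k / D) <= eps k.
  rewrite mulrA ler_pdivrMr// mulrC ler_pM2l// /D lerDl sqr_ge0//.
have h4 : ortho_op a b n E ^+ 2 * (eps k / D) <=
    2 * n.+1%:R ^+ 2 * W N x * (eps k / D) + 2 * L ^+ 2 * eps k.
  apply: le_trans (ler_wpM2r q0 h1) _; rewrite mulrDl lerD//.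
    by rewrite ler_wpM2r// -mulrA ler_pM2l.
  by rewrite -[leLHS]mulrA; apply: ler_wpM2l; [by rewrite mulr_ge0 ?sqr_ge0|exact: h3].
rewrite mulrCA; apply: le_trans (ler_wpM2l (w0 j) h4) _.
rewrite le_eqVlt; apply/orP; left; apply/eqP; ring.
Qed.

(* With p_n = ortho_op n and W the sum of the p_n^2 / (n+1)^2, the Poisson averages
   of W over the truncations have integral at most 2 pi, and they dominate
   p_n(E)^2 Im G(E + i e) up to O(e).  By Fatou's lemma, applied to the size of the
   truncations and then to e, their lower limit is finite almost everywhere. *)
Lemma ae_ortho_op_bound : {ae mu, forall E, Sigma_ac a b E ->
  exists M, forall n, ortho_op a b n E ^+ 2 <= M * n.+1%:R ^+ 2}.
Proof.
suff H (T : nat) : {ae mu, forall E, `[- T.+1%:R, T.+1%:R]%classic E -> Sigma_ac a b E ->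
    exists M, forall n, ortho_op a b n E ^+ 2 <= M * n.+1%:R ^+ 2}.
  have : {ae mu, forall E (T : nat), `[- T.+1%:R, T.+1%:R]%classic E -> Sigma_ac a b E ->
    exists M, forall n, ortho_op a b n E ^+ 2 <= M * n.+1%:R ^+ 2} by exact: ae_foralln.
  apply: (@filterS _ _ (ae_filter_ringOfSetsType mu)) => E HE.
  apply: (HE (Num.truncn `|E|)); rewrite /= in_itv/= -ler_norml.
  by rewrite ltW// truncnS_gt.
set D := `[- T.+1%:R, T.+1%:R]%classic.
have mD : measurable D by exact: measurable_itv.
have T0 : 0 < T.+1%:R :> R by rewrite ltr0n.
have mQ k N : measurable_fun D (fun E => (Q k N E)%:E).
  apply/measurable_EFinP; apply: measurable_funTS.
  exact: continuous_measurable_fun (@Q_cont k N).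
pose h k E := limn_einf (fun N => (Q k N E)%:E).
have hP k : [/\ measurable_fun D (h k), forall E, D E -> (0 <= h k E)%E &
    (\int[mu]_(E in D) h k E <= (2 * pi)%:E)%E].
  have [h1 h2 h3] := @fatou_bound R D (fun N E => (Q k N E)%:E) (fun=> (2 * pi)%:E) mD
    (mQ k) (fun N E _ => Q_ge0 k N E : (0 <= (Q k N E)%:E)%E) (fun N => Q_integral k N T0).
  by split => //; rewrite limn_einf_cst in h3.
have mh k := let: And3 h1 _ _ := hP k in h1.
have h0 k := let: And3 _ h2 _ := hP k in h2.
have hi k := let: And3 _ _ h3 := hP k in h3.
have [mH H0 iH] := fatou_bound mD mh h0 hi.
rewrite limn_einf_cst in iH.
have intH : mu.-integrable D (fun E => limn_einf (h ^~ E)).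
  apply/integrableP; split => //.
  apply: le_lt_trans (ltry (2 * pi)); apply: le_trans iH.
  by apply: ge0_le_integral => //; [exact: measurableT_comp|
     move=> x Dx; rewrite gee0_abs// H0].
have := @integrable_ae _ _ _ mu D mD _ intH.
apply: (@filterS _ _ (ae_filter_ringOfSetsType mu)) => E HE DE [l l0 El].
have Hfin := HE DE.
pose M0 := fine (limn_einf (h ^~ E)) + 1.
have HM0 : (limn_einf (h ^~ E) < M0%:E)%E.
  by rewrite -(fineK Hfin) lte_fin ltrDl.
have ne0 : \forall e \near 0^'+, complex.Im (green11 a b (E +i* e)%C) != 0.
  exact: cvgr_neq0 El l0.
have epsto0 : eps k @[k --> \oo] --> 0^'+.
  move=> U [r /= r0 rU]; have /cvgrPdist_lt/(_ _ r0) := @cvg_harmonic R.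
  by apply: filterS => k kr; apply: rU => /=; [exact: kr|exact: eps_gt0].
have cl : complex.Im (green11 a b (E +i* eps k)%C) @[k --> \oo] --> l.
  exact: cvg_comp _ _ epsto0 El.
have ne0k : \forall k \near \oo, complex.Im (green11 a b (E +i* eps k)%C) != 0.
  exact: epsto0 ne0.
have cP k : complex.Im (green11 a b (E +i* eps k)%C) != 0 ->
    poisson_sum d w N E (eps k) @[N --> \oo] --> complex.Im (green11 a b (E +i* eps k)%C).
  by move=> ?; apply: (poisson_sum_cvg_green a_neq0 dw) => //; exists C.
have C0 : 0 <= C by rewrite (le_trans (normr_ge0 (a 1%N))) ?a_bound.
(* [Sigma_ac] only says that l is nonzero; its sign is inherited from the Poisson sums. *)
have l_gt0 : 0 < l.
  rewrite lt_neqAle eq_sym l0/=; rewrite -(cvg_lim (@Rhausdorff R) cl); apply: limr_ge.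
    by apply/cvg_ex; exists l.
  near=> k.
  have nk : complex.Im (green11 a b (E +i* eps k)%C) != 0 by near: k; exact: ne0k.
  rewrite -(cvg_lim (@Rhausdorff R) (cP k nk)); apply: limr_ge.
    by apply/cvg_ex; exists (complex.Im (green11 a b (E +i* eps k)%C)); exact: cP.
  apply: nearW => N.
  have [w0 _ _ _] := dw N; apply: sumr_ge0 => j _; rewrite mulr_ge0// divr_ge0 ?(ltW (eps_gt0 k))//.
  by rewrite addr_ge0 ?sqr_ge0.
(* M0 exceeds the iterated lower limit of [Q] at E, and the 2 comes from the squared triangle
   inequality in [poisson_sum_le]. *)
exists (2 * M0 / l) => n.
rewrite mulrAC ler_pdivlMr//.
have [L HL] := ortho_op_lipschitz n E (3 * C).
set p := ortho_op a b n E.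
suff key del : 0 < del -> p ^+ 2 * l <= 2 * M0 * n.+1%:R ^+ 2 + (1 + 2 * p ^+ 2) * del.
  apply/ler_addgt0Pr => e e0.
  have q0 : 0 < 1 + 2 * p ^+ 2 by rewrite ltr_pwDl// mulr_ge0 ?sqr_ge0.
  have := key (e / (1 + 2 * p ^+ 2)) (divr_gt0 e0 q0).
  by rewrite [(1 + _) * (e / _)]mulrC divfK ?gt_eqF.
move=> del0.
have q0 : 0 < 2 * L ^+ 2 + 1 by rewrite ltr_wpDl// mulr_ge0 ?sqr_ge0.
have [k0 _ Hk0] : \forall k \near \oo, [/\ complex.Im (green11 a b (E +i* eps k)%C) != 0,
    `|l - complex.Im (green11 a b (E +i* eps k)%C)| <= del & 2 * L ^+ 2 * eps k <= del].
  near=> k; split; first by near: k; exact: ne0k.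
    by near: k; move/cvgrPdist_le: cl; apply.
  apply: (@le_trans _ _ ((2 * L ^+ 2 + 1) * eps k)).
    by rewrite ler_wpM2r ?(ltW (eps_gt0 k))// lerDl.
  rewrite mulrC -ler_pdivlMr//; apply: ltW.
  have : `|0 - eps k| < del / (2 * L ^+ 2 + 1).
    near: k; have /cvgrPdist_lt := @cvg_harmonic R; apply.
    exact: divr_gt0 del0 q0.
  by rewrite sub0r normrN gtr0_norm.
(* The nested lower limits dictate the order: k first, with [eps k] small, then N large depending on
   k. *)
have [k kk0 hk] := ex_lt_of_limn_einf k0 HM0.
have [g1 g2 g3] := Hk0 k kk0.
have [N0 _ HN0] : \forall N \near \oo,
    `|complex.Im (green11 a b (E +i* eps k)%C) - poisson_sum d w N E (eps k)| <= del.
  by move/cvgrPdist_le: (cP k g1); apply.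
have [N NN0 QN] := ex_lt_of_limn_einf (maxn N0 n) hk.
have [NN nN] : (N0 <= N)%N /\ (n <= N)%N by apply/andP; rewrite -geq_max.
have g4 := HN0 N NN.
have dK : forall j : 'I_N.+1, `|d N j| <= 3 * C.
  by move=> j; exact: (eigenvalue_bound a_neq0 dw a_bound b_bound).
have g5 := poisson_sum_le k nN (mulr_ge0 (ler0n _ 3) C0) dK HL.
rewrite lte_fin in QN; rewrite -/p in g5.
have p2 : 0 <= p ^+ 2 := sqr_ge0 p.
have n2 : 0 <= 2 * n.+1%:R ^+ 2 :> R by rewrite mulr_ge0 ?exprn_ge0.
have g6 := ler_wpM2l n2 (ltW QN).
move: g2 g4; rewrite !ler_norml => /andP[_ g2] /andP[_ g4].
have g7 : p ^+ 2 * l <= p ^+ 2 * (poisson_sum d w N E (eps k) + 2 * del).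
  by rewrite ler_wpM2l//; lra.
by move: g7; rewrite mulrDr; lra.
Unshelve. all: by end_near. Qed.

End GeneralizedEigenfunctionBound.

(** * Increments of logarithmic means in the height, integrated over the energy *)

Section LogIncrement.
Variable R : realType.
Local Notation mu := (@lebesgue_measure R).

Definition mean_log (n : nat) (d : nat -> R) (E e : R) : R :=
  (\sum_(j < n) log_dist E e (d j)) / n%:R.

Lemma log_distC (E e x : R) : log_dist E e x = log_dist x e E.
Proof. by rewrite /log_dist -[x - E]opprB sqrrN. Qed.

Lemma log_dist_le (E x s e : R) : 0 < s -> s <= e -> log_dist E s x <= log_dist E e x.
Proof.
move=> s0 se; have e0 := lt_le_trans s0 se.
rewrite /log_dist ler_pM2r// ler_ln ?posrE ?sqr_dist_gt0// lerD2l.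
by rewrite lerXn2r ?nnegrE ?(ltW s0) ?(ltW e0).
Qed.

Lemma mean_log_le n d (E s e : R) : 0 < s -> s <= e -> mean_log n d E s <= mean_log n d E e.
Proof.
move=> s0 se; rewrite /mean_log ler_wpM2r ?invr_ge0//.
by apply: ler_sum => j _; exact: log_dist_le.
Qed.

Let prim (d e x : R) := (x - d) * log_dist d e x + e * atan ((x - d) / e) - x.

Let is_derive_prim (x d e : R) : 0 < e -> is_derive x (1 : R) (prim d e) (log_dist d e x).
Proof.
move=> e0; have h1 := is_derive_log_dist x d e0; have h2 := is_derive_atan_affine x d e0.
have -> : prim d e = ((id \- cst d) * log_dist d e)
    \+ e \*: (fun y : R => atan ((y - d) / e)) \- id by apply/funext => y /=.
apply: is_derive_eq; rewrite /GRing.scale/= subr0 mulr1.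
by have := sqr_dist_gt0 x d e0 => /lt0r_neq0 ne; field.
Qed.

Let continuous_log_dist (d e : R) : 0 < e -> continuous (log_dist d e).
Proof.
move=> e0 x; apply: differentiable_continuous; apply/derivable1_diffP.
by have [] := is_derive_log_dist x d e0.
Qed.

(** By oddness in t it suffices to take t > 0. The logarithmic parts then differ by at most e^2 / 2
    and both arctangent parts lie in [0, pi e / 2], whatever s is. *)
Let prim_bound (e s t : R) : 0 < s -> s < e -> 1 <= `|t| ->
  `|(t * log_dist 0 e t + e * atan (t / e)) - (t * log_dist 0 s t + s * atan (t / s))|
    <= (e ^+ 2 + pi * e) / 2.
Proof.
move=> s0 se; have e0 := lt_trans s0 se.
wlog t0 : t / 0 <= t.
  move=> H; have [t0|t0] := leP 0 t; first exact: H.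
  move=> t1; have := H (- t); rewrite normrN oppr_ge0 => /(_ (ltW t0) t1).
  have L x : log_dist 0 x (- t) = log_dist 0 x t by rewrite /log_dist !subr0 sqrrN.
  rewrite !L !mulNr !atanN !mulrN -!opprD -opprB normrN; apply: le_trans.
  by rewrite le_eqVlt; apply/orP; left; apply/eqP; congr (`|_|); ring.
rewrite ger0_norm// => t1; have tt : 0 < t by exact: lt_le_trans t1.
have le := log_dist_le 0 t s0 (ltW se).
have up : log_dist 0 e t - log_dist 0 s t <= e ^+ 2 / (2 * t ^+ 2).
  have p1 := sqr_dist_gt0 t 0 e0; have p2 := sqr_dist_gt0 t 0 s0.
  rewrite /log_dist -mulrBl -ln_div ?posrE//.
  move: p1 p2; rewrite subr0 => p1 p2; have T2 : 0 < t ^+ 2 by rewrite exprn_gt0.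
  have r0 : 0 <= (e ^+ 2 - s ^+ 2) / (t ^+ 2 + s ^+ 2).
    by rewrite divr_ge0 ?(ltW p2)// subr_ge0 lerXn2r ?nnegrE ?(ltW s0) ?(ltW e0) ?(ltW se).
  have r1 : ln ((t ^+ 2 + e ^+ 2) / (t ^+ 2 + s ^+ 2)) <= (e ^+ 2 - s ^+ 2) / (t ^+ 2 + s ^+ 2).
    have -> : (t ^+ 2 + e ^+ 2) / (t ^+ 2 + s ^+ 2) = 1 + (e ^+ 2 - s ^+ 2) / (t ^+ 2 + s ^+ 2).
      by field; exact: lt0r_neq0.
    by apply: le_ln1Dx; exact: lt_le_trans r0.
  rewrite ler_pdivrMr//; apply: le_trans r1 _.
  have -> : e ^+ 2 / (2 * t ^+ 2) * 2 = e ^+ 2 / t ^+ 2 by field; exact: lt0r_neq0.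
  rewrite ler_pdivrMr// mulrAC ler_pdivlMr//.
  have n20 : 0 <= s ^+ 2 by exact: sqr_ge0.
  have e20 : 0 <= e ^+ 2 by exact: sqr_ge0.
  by nra.
have up2 : t * (log_dist 0 e t - log_dist 0 s t) <= e ^+ 2 / 2.
  apply: le_trans (ler_wpM2l t0 up) _.
  have -> : t * (e ^+ 2 / (2 * t ^+ 2)) = e ^+ 2 / 2 / t by field; rewrite gt_eqF.
  by rewrite ler_pdivrMr// ler_peMr// divr_ge0 ?sqr_ge0.
have lo2 : 0 <= t * (log_dist 0 e t - log_dist 0 s t) by rewrite mulr_ge0// subr_ge0.
have A1 : 0 <= e * atan (t / e) <= pi * e / 2.
  rewrite mulr_ge0 ?(ltW e0)//=; last first.
    by rewrite -(atan0 R) le_atan// divr_ge0 ?(ltW e0).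
  by have := ler_wpM2l (ltW e0) (ltW (atan_ltpi2 (t / e))); lra.
have A2 : 0 <= s * atan (t / s) <= pi * e / 2.
  rewrite mulr_ge0 ?(ltW s0)//=; last first.
    by rewrite -(atan0 R) le_atan// divr_ge0 ?(ltW s0).
  have := ler_wpM2l (ltW s0) (ltW (atan_ltpi2 (t / s))).
  have : s * (pi / 2) <= e * (pi / 2) by rewrite ler_wpM2r ?(ltW se)// divr_ge0 ?pi_ge0.
  lra.
move: A1 A2 => /andP[? ?] /andP[? ?]; rewrite ler_norml; apply/andP; split; lra.
Qed.

(** Pointwise the increment is unbounded as s tends to 0 at an eigenvalue, but its integral is
    bounded wherever the eigenvalues lie. The margin 1 keeps the endpoints at distance at least 1
    from them, as [prim_bound] requires. *)
Lemma mean_log_increment_integral n (d : nat -> R) (T e s : R) :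
  (0 < n)%N -> 0 < s -> s < e -> 0 < T -> (forall j, (j < n)%N -> `|d j| <= T - 1) ->
  (\int[mu]_(E in `[(- T)%R, T]%classic) (mean_log n d E e - mean_log n d E s)%:E
    <= (e ^+ 2 + pi * e)%:E)%E.
Proof.
move=> n0 s0 se T0 dT; have e0 := lt_trans s0 se.
have nR : 0 < n%:R :> R by rewrite ltr0n.
pose F E := (\sum_(j < n) (prim (d j) e E - prim (d j) s E)) / n%:R.
have fE E : mean_log n d E e - mean_log n d E s =
    (\sum_(j < n) (log_dist (d j) e E - log_dist (d j) s E)) / n%:R.
  by rewrite /mean_log -mulrBl -sumrB; congr (_ / _); apply: eq_bigr => j _;
     rewrite log_distC [in X in _ - X]log_distC.
under eq_integral do rewrite fE.
have dF x : is_derive x (1 : R) F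
    ((\sum_(j < n) (log_dist (d j) e x - log_dist (d j) s x)) / n%:R).
  have h : is_derive x (1 : R) (fun E => \sum_(j < n) (prim (d j) e E - prim (d j) s E))
      (\sum_(j < n) (log_dist (d j) e x - log_dist (d j) s x)).
    apply: (@is_derive_bigsum R n (fun j E => prim (d j) e E - prim (d j) s E)
      (fun j => log_dist (d j) e x - log_dist (d j) s x)) => j _.
    exact: is_deriveB (is_derive_prim x (d j) e0) (is_derive_prim x (d j) s0).
  have -> : F = n%:R^-1 \*: (fun E => \sum_(j < n) (prim (d j) e E - prim (d j) s E)).
    by apply/funext => y /=; rewrite /F mulrC.
  by rewrite mulrC; exact: is_deriveZ.
have cf : continuous (fun x => (\sum_(j < n) (log_dist (d j) e x - log_dist (d j) s x)) / n%:R).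
  move=> x; apply: cvgM; last exact: cvg_cst.
  apply: (@cvg_sum_ord R R _ _ n (fun j E => log_dist (d j) e E - log_dist (d j) s E)
    (fun j => log_dist (d j) e x - log_dist (d j) s x)) => j.
  by apply: cvgB; exact: continuous_log_dist.
have NTT : - T < T by lra.
rewrite (FTC2_is_derive NTT dF cf).
rewrite lee_fin /F -mulrBl ler_pdivrMr// -sumrB mulr_natr -[X in _ *+ X](card_ord n) -sumr_const.
apply: ler_sum => j _; have := dT j (ltn_ord j); rewrite ler_norml => /andP[d1 d2].
have Ld x y : log_dist (d j) x y = log_dist 0 x (y - d j) by rewrite /log_dist subr0.
have b1 : 1 <= `|T - d j| by rewrite ger0_norm; lra.
have b2 : 1 <= `|- T - d j| by rewrite ler0_norm; lra.
have := prim_bound s0 se b1; have := prim_bound s0 se b2.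
rewrite /prim !Ld !ler_norml => /andP[? ?] /andP[? ?]; lra.
Qed.

(* The integrals of the increments are O(e) by [mean_log_increment_integral], so
   that applying Fatou's lemma in s, i and k yields a lower limit of integral 0. *)
Lemma ae_mean_log_increment (m : nat -> nat) (d : nat -> nat -> R) (K : R) :
  (forall i, (0 < m i)%N) -> (forall i j, (j < m i)%N -> `|d i j| <= K) ->
  {ae mu, forall E, forall del, 0 < del -> forall k0, exists2 k, (k0 <= k)%N &
    forall i0, exists2 i, (i0 <= i)%N & forall s0, exists2 s, (s0 <= s)%N &
      mean_log (m i) (d i) E k.+1%:R^-1 - mean_log (m i) (d i) E (k.+1%:R^-1 / s.+2%:R) < del}.
Proof.
move=> m0 dK.
(* The lower height is small rather than 0, where the logarithm is singular at the eigenvalues;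
   [s.+2] makes it strictly smaller than the upper one. *)
pose X k i s E := mean_log (m i) (d i) E k.+1%:R^-1
  - mean_log (m i) (d i) E (k.+1%:R^-1 / s.+2%:R) : R.
have eta0 (k : nat) : 0 < k.+1%:R^-1 :> R by rewrite invr_gt0.
have s0 k s : 0 < k.+1%:R^-1 / s.+2%:R :> R by rewrite divr_gt0.
have slt k s : k.+1%:R^-1 / s.+2%:R < k.+1%:R^-1 :> R.
  by rewrite ltr_pdivrMr// ltr_pMr// ltr1n.
have X0 k i s E : 0 <= X k i s E by rewrite subr_ge0 mean_log_le// ltW.
have mlc n dd e : 0 < e -> continuous (fun E => mean_log n dd E e).
  move=> e0 x; apply: cvgM; last exact: cvg_cst.
  apply: (@cvg_sum_ord R R _ _ n (fun j E => log_dist E e (dd j)) (fun j => log_dist x e (dd j))) => j.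
  under eq_fun do rewrite log_distC.
  rewrite log_distC; exact: continuous_log_dist.
suff H (T : nat) : K + 1 <= T%:R -> {ae mu, forall E, `[- T.+1%:R, T.+1%:R]%classic E ->
    forall del, 0 < del -> forall k0, exists2 k, (k0 <= k)%N &
    forall i0, exists2 i, (i0 <= i)%N & forall s0, exists2 s, (s0 <= s)%N & X k i s E < del}.
  have HT (T : nat) : {ae mu, forall E, `[- T.+1%:R, T.+1%:R]%classic E -> K + 1 <= T%:R ->
      forall del, 0 < del -> forall k0, exists2 k, (k0 <= k)%N &
      forall i0, exists2 i, (i0 <= i)%N & forall s0, exists2 s, (s0 <= s)%N & X k i s E < del}.
    have [KT|KT] := leP (K + 1) T%:R.
      by apply: (@filterS _ _ (ae_filter_ringOfSetsType mu) _ _ _ (H T KT)) => E HE ? _; exact: HE.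
    by apply: aeW => E _.
  have := ae_foralln HT.
  apply: (@filterS _ _ (ae_filter_ringOfSetsType mu)) => E HE.
  pose T := maxn (Num.truncn `|E|) (Num.truncn `|K + 1|).+1.
  apply: (HE T).
    rewrite /= in_itv/= -ler_norml ltW// (lt_le_trans (truncnS_gt _))//.
    by rewrite ler_nat ltnS leq_maxl.
  apply: le_trans (ler_norm _) _; rewrite ltW// (lt_le_trans (truncnS_gt _))//.
  by rewrite ler_nat leq_maxr.
move=> KT; set D := `[- T.+1%:R, T.+1%:R]%classic.
have mD : measurable D by exact: measurable_itv.
have T0 : 0 < T.+1%:R :> R by rewrite ltr0n.
pose B k : \bar R := (k.+1%:R^-1 ^+ 2 + pi * k.+1%:R^-1)%:E.
have mX k i s : measurable_fun D (fun E => (X k i s E)%:E).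
  apply/measurable_EFinP; apply: measurable_funTS.
  apply: continuous_measurable_fun => x.
  by apply: cvgB; apply: mlc.
have iX k i s : (\int[mu]_(E in D) (X k i s E)%:E <= B k)%E.
  apply: mean_log_increment_integral => // j jm.
  by rewrite -natr1; have := dK i j jm; lra.
pose h1 k i E := limn_einf (fun s => (X k i s E)%:E).
pose h2 k E := limn_einf (fun i => h1 k i E).
have H1 k i : [/\ measurable_fun D (h1 k i), forall E, D E -> (0 <= h1 k i E)%E &
    (\int[mu]_(E in D) h1 k i E <= B k)%E].
  have [p1 p2 p3] := @fatou_bound R D (fun s E => (X k i s E)%:E) (fun=> B k) mD
    (mX k i) (fun s E _ => X0 k i s E : (0 <= (X k i s E)%:E)%E) (iX k i).
  by split => //; rewrite limn_einf_cst in p3.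
have H2 k : [/\ measurable_fun D (h2 k), forall E, D E -> (0 <= h2 k E)%E &
    (\int[mu]_(E in D) h2 k E <= B k)%E].
  have q1 i := let: And3 z _ _ := H1 k i in z.
  have q2 i := let: And3 _ z _ := H1 k i in z.
  have q3 i := let: And3 _ _ z := H1 k i in z.
  have [p1 p2 p3] := fatou_bound mD q1 q2 q3.
  by split => //; rewrite limn_einf_cst in p3.
have q1 i := let: And3 z _ _ := H2 i in z.
have q2 i := let: And3 _ z _ := H2 i in z.
have q3 i := let: And3 _ _ z := H2 i in z.
have [mH H0 iH] := fatou_bound mD q1 q2 q3.
have B0 : limn_einf B = 0%E.
  have : B @ \oo --> 0%E.
    apply: cvg_EFin; first exact: nearW.
    have hc : k.+1%:R^-1 @[k --> \oo] --> (0 : R) := @cvg_harmonic R.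
    rewrite -[X in _ --> X](_ : 0 ^+ 2 + pi * 0 = 0); last by rewrite expr2 !mulr0 addr0.
    apply: cvgD; first by rewrite /= expr2; apply: cvgM.
    by apply: cvgM => //; exact: cvg_cst.
  by move/cvg_limn_einf_sup => [].
rewrite B0 in iH.
have ae0 : ae_eq mu D (fun E => limn_einf (h2 ^~ E)) (cst 0%E).
  apply/ae_eq_integral_abs => //.
  apply/eqP; rewrite eq_le integral_ge0// andbT.
  apply: le_trans iH; rewrite le_eqVlt; apply/orP; left; apply/eqP.
  by apply: eq_integral => x /set_mem xD; rewrite gee0_abs// H0.
apply: (@filterS _ _ (ae_filter_ringOfSetsType mu) _ _ _ ae0) => E HE DE del del0 k0.
have := HE DE => /= h0.
have [|k kk hk] := @ex_lt_of_limn_einf R (h2 ^~ E) del%:E k0.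
  by rewrite h0 lte_fin.
exists k => // i0; have [i ii hi] := ex_lt_of_limn_einf i0 hk.
exists i => // s1; have [s ss hs] := ex_lt_of_limn_einf s1 hi.
by exists s.
Qed.

End LogIncrement.

(** * Inequalities for a single truncation *)

Section FiniteInequalities.
Variables (R : realType) (a b : nat -> R) (c C : R).
Hypothesis c_gt0 : 0 < c.
Hypothesis a_bound : forall n, (1 <= n)%N -> c <= a n <= C.
Variables d w : nat -> nat -> R.
Hypothesis dw : spectral_data a b d w.

Let a_gt0 n : (1 <= n)%N -> 0 < a n.
Proof. by move=> /a_bound/andP[ca _]; exact: lt_le_trans ca. Qed.

Let a_neq0 n : (1 <= n)%N -> a n != 0.
Proof. by move=> /a_gt0/lt0r_neq0. Qed.

Lemma prod_a_exp n : \prod_(1 <= j < n.+1) a j = expR (\sum_(j < n) ln (a j.+1)).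
Proof.
elim: n => [|n IH]; first by rewrite big_geq// big_ord0 expR0.
by rewrite big_nat_recr//= IH big_ord_recr/= expRD lnK// posrE a_gt0.
Qed.

Lemma geom_mean_exp n : geom_mean a n = expR ((\sum_(j < n) ln (a j.+1)) / n%:R).
Proof.
rewrite /geom_mean prod_a_exp /powR gt_eqF ?expR_gt0//.
by rewrite expRK mulrC.
Qed.

Lemma geom_mean_bound n : (0 < n)%N -> c <= geom_mean a n <= C.
Proof.
move=> n0; have nR : 0 < n%:R :> R by rewrite ltr0n.
have C0 : 0 < C by have /andP[h1] := a_bound (leqnn 1); apply: lt_le_trans; exact: lt_le_trans h1.
rewrite geom_mean_exp -{1}[c]lnK ?posrE// -{1}[C]lnK ?posrE// !ler_expR.
rewrite ler_pdivlMr// ler_pdivrMr// !mulr_natr.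
have cst x : x *+ n = \sum_(j < n) x :> R by rewrite sumr_const card_ord.
rewrite !cst.
by apply/andP; split; apply: ler_sum => j _; have /andP[h1 h2] := a_bound (ltn0Sn j);
  rewrite ler_ln ?posrE ?a_gt0.
Qed.

(** Modulus and argument of the product are read off the eigenvalues instead of the Riccati ratios,
    so that the inequality can follow the convergence of the counting functions. The data of the
    truncation of size n sit at index [n.-1]. *)
Lemma phase_potential_ineq n E e r s : (0 < n)%N -> 0 < e ->
  r = expR (mean_log n (d n.-1) E e) ->
  s = sin ((\sum_(j < n) (pi / 2 + atan ((d n.-1 j - E) / e))) / n%:R) ->
  (e * r + geom_mean a n ^+ 2 * s <= (1 + (C / e) ^+ 2 / n%:R) * r ^+ 2 * s) /\ 0 <= s.
Proof.
case: n => // m _ e0 rE sE.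
have [_ _ monicE _] := dw m.
have a_le n : (1 <= n)%N -> a n <= C by move=> /a_bound/andP[].
have phE : \sum_(j < m.+1) (pi / 2 + atan ((d m j - E) / e)) =
    \sum_(j < m.+1) arg_upper (riccati a b E e j).1 (riccati a b E e j).2.
  rewrite (sum_arg_riccati E monicE e0); apply: eq_bigr => j _.
  by rewrite /arg_upper -[E - d m j]opprB mulNr atanN opprK.
split.
  apply: (@riccati_mean_ineq _ _ b E _ _ e0 a_gt0 a_le _ _ _ _ (ltn0Sn m)).
  - by rewrite rE /mean_log /log_dist -!mulr_suml (sum_ln_riccati E monicE).
  - exact: geom_mean_exp.
  - by rewrite sE phE.
rewrite sE; apply: sin_ge0_pi; rewrite phE; apply/andP; split.
  by rewrite divr_ge0// sumr_ge0// => j _; rewrite ltW// arg_upper_gt0.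
rewrite ler_pdivrMr ?ltr0n// mulr_natr -[X in _ *+ X](card_ord m.+1) -sumr_const.
by apply: ler_sum => j _; rewrite ltW// arg_upper_lt_pi.
Qed.

(** As the height tends to 0, the product of the squared distances to the eigenvalues tends to the
    square of [ortho_op n E] times that of a(1)...a(n). The 1 in M + 1 is the slack for small
    positive heights. *)
Lemma mean_log_upper n E M e : (0 < n)%N -> 0 < e ->
  ortho_op a b n E ^+ 2 <= M ->
  exists s0, forall s, (s0 <= s)%N ->
    mean_log n (d n.-1) E (e / s.+2%:R) <= ln (geom_mean a n) + ln (M + 1) / (2 * n%:R).
Proof.
case: n => // m _ e0 pM.
have [_ _ monicE _] := dw m.
have M0 : 0 <= M by exact: le_trans (sqr_ge0 _) pM.
have mR : 0 < m.+1%:R :> R by rewrite ltr0n.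
pose A := \prod_(1 <= j < m.+2) a j.
have A0 : 0 < A by rewrite /A prod_a_exp expR_gt0.
pose q t := \prod_(j < m.+1) ((d m j - E) ^+ 2 + t ^+ 2) : R.
have q0 : q 0 <= A ^+ 2 * M.
  have -> : q 0 = (A * ortho_op a b m.+1 E) ^+ 2.
    rewrite /q /ortho_op mulrCA mulfV ?mulr1 ?gt_eqF// monicE horner_prod -prodrXl.
    apply: eq_bigr => j _; rewrite hornerXsubC expr0n /= addr0.
    by rewrite -opprB sqrrN.
  by rewrite exprMn ler_wpM2l ?sqr_ge0.
have qc : {for 0, continuous q}.
  have H n : \prod_(j < n) ((d m j - E) ^+ 2 + t ^+ 2) @[t --> (0 : R)] -->
      \prod_(j < n) ((d m j - E) ^+ 2 + (0 : R) ^+ 2).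
    elim: n => [|n IH].
      by rewrite big_ord0; under eq_fun do rewrite big_ord0; exact: cvg_cst.
    rewrite big_ord_recr; under eq_fun do rewrite big_ord_recr.
    apply: cvgM; first exact: IH.
    apply: cvgD; first exact: cvg_cst.
    by under eq_fun do rewrite expr2; rewrite expr2; apply: cvgM; exact: cvg_id.
  exact: H.
have sto0 : e / s.+2%:R @[s --> \oo] --> (0 : R).
  rewrite -(mulr0 e); apply: cvgM; first exact: cvg_cst.
  have := @cvg_harmonic R; rewrite -(cvg_shiftn 1).
  by under eq_fun do rewrite addn1.
have qs : q (e / s.+2%:R) @[s --> \oo] --> q 0 := cvg_comp _ _ sto0 qc.
have [s0 _ Hs] : \forall s \near \oo, q (e / s.+2%:R) < A ^+ 2 * (M + 1).
  apply: cvgr_lt qs _ _; apply: le_lt_trans q0 _.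
  by rewrite mulrDr mulr1 ltrDl exprn_gt0.
exists s0 => s /Hs qlt.
have es : 0 < e / s.+2%:R by rewrite divr_gt0.
have qpos : 0 < q (e / s.+2%:R) by apply: prodr_gt0 => j _; exact: sqr_dist_gt0.
have : ln (q (e / s.+2%:R)) <= ln (A ^+ 2 * (M + 1)).
  by rewrite ler_ln ?posrE ?mulr_gt0 ?exprn_gt0 ?ltW// ltr_wpDl.
rewrite lnM ?posrE ?exprn_gt0 ?ltr_wpDl// lnXn//.
rewrite /q (@ln_prod _ m.+1 (fun j => (d m j - E) ^+ 2 + (e / s.+2%:R) ^+ 2)); last first.
  by move=> j; exact: sqr_dist_gt0.
rewrite geom_mean_exp expRK /A prod_a_exp expRK /mean_log /log_dist -mulr_suml.
set S1 := \sum_(j < _) _; set S2 := \sum_(j < _) _ => h.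
rewrite mulrAC ler_pdivrMr// ler_pdivrMr//.
have -> : (S2 / m.+1%:R + ln (M + 1) / (2 * m.+1%:R)) * 2 * m.+1%:R = S2 *+ 2 + ln (M + 1).
  by rewrite -mulr_natl; field; rewrite gt_eqF.
done.
Qed.

End FiniteInequalities.

(** * Sublinear logarithms and lower limits of bounded sequences *)

Section SequenceFacts.
Variable R : realType.

Lemma ln_quadratic_sublinear (M del : R) : 0 <= M -> 0 < del ->
  \forall n \near \oo, ln (M * n.+1%:R ^+ 2 + 1) <= del * (2 * n%:R).
Proof.
move=> M0 del0; near=> n.
(* The threshold comes from 1 + y^3 / 6 <= exp y at y = 2 del n, together with n + 1 <= 2 n. *)
have nM : 3 * M / del ^+ 3 <= n%:R by near: n; exact: nbhs_infty_ger.
have n1 : 1 <= n%:R :> R by rewrite ler1n; near: n; exact: nbhs_infty_ge.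
rewrite -[leRHS]expRK ler_ln ?posrE ?expR_gt0 ?ltr_wpDl ?mulr_ge0 ?exprn_ge0//.
apply: le_trans (expR_ge1Dxn 2 _); last by rewrite !mulr_ge0 ?(ltW del0).
rewrite addrC lerD2l ler_pdivlMr ?ltr0n// -natr1.
move: nM n1; rewrite ler_pdivrMr ?exprn_gt0//; set x : R := n%:R => nM n1.
have -> : (3`!)%:R = 6 :> R by [].
have h1 : (x + 1) ^+ 2 <= 4 * x ^+ 2 by rewrite !expr2; nra.
have h2 : M * (x + 1) ^+ 2 * 6 <= M * (4 * x ^+ 2) * 6.
  by rewrite ler_wpM2r// ler_wpM2l.
apply: le_trans h2 _.
have -> : (del * (2 * x)) ^+ 3 = 8 * (x * del ^+ 3) * x ^+ 2 by ring.
have x2 : 0 <= x ^+ 2 := sqr_ge0 x.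
have := ler_wpM2r x2 nM; lra.
Unshelve. all: by end_near. Qed.

(** [phi] need not increase, as [n <= phi n] already makes it tend to infinity. Applied to the
    opposite sequence, the lemma describes the upper limit. *)
Lemma limn_inf_subseq (u : nat -> R) (m M : R) :
  (forall n, m <= u n <= M) ->
  (forall e, 0 < e -> \forall n \near \oo, limn_inf u - e <= u n) /\
  exists phi : nat -> nat, (forall n, (n <= phi n)%N) /\
    u (phi n) @[n --> \oo] --> limn_inf u.
Proof.
move=> uM.
have lb n : has_lbound (sdrop u n).
  by exists m => _ [k _ <-]; have /andP[] := uM k.
have infs_le n k : (n <= k)%N -> infs u n <= u k.
  by move=> nk; apply: ge_inf; [exact: lb|exists k].
have infs_ub n : infs u n <= M.
  by apply: le_trans (infs_le n n (leqnn n)) _; have /andP[] := uM n.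
have ndi : nondecreasing_seq (infs u).
  apply: nondecreasing_infs; exists m => _ [k _ <-]; by have /andP[] := uM k.
have ci : infs u @ \oo --> limn_inf u.
  rewrite /limn_inf; apply: nondecreasing_is_cvgn => //.
  by exists M => _ [n _ <-]; exact: infs_ub.
have infs_lim n : infs u n <= limn_inf u.
  by apply: nondecreasing_cvgn_le => //; apply/cvg_ex; exists (limn_inf u).
have low e : 0 < e -> \forall n \near \oo, limn_inf u - e <= u n.
  move=> e0; move/cvgrPdist_le : ci => /(_ e e0)[N _ HN].
  exists N => // n /= Nn; have := HN n Nn; rewrite ler_norml => /andP[_ h].
  by have := infs_le n n (leqnn n); lra.
split => //.
have ex n : exists k, (n <= k)%N /\ `|limn_inf u - u k| <= n.+1%:R^-1.
  have e0 : 0 < n.+1%:R^-1 :> R by rewrite invr_gt0.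
  have [N _ HN] := low _ e0.
  have : infs u (maxn n N) < limn_inf u + n.+1%:R^-1.
    by apply: le_lt_trans (infs_lim _) _; rewrite ltrDl.
  have ne : sdrop u (maxn n N) !=set0 by exists (u (maxn n N)); exists (maxn n N) => /=.
  move=> /(inf_lt ne)[_ [k /= nk <-] uk]; exists k.
  have [nk1 Nk] : (n <= k)%N /\ (N <= k)%N by apply/andP; rewrite -geq_max.
  split => //; have /= := HN k Nk; rewrite lerBlDr => h.
  by rewrite ler_norml lerBrDr addrC lerBlDr (ltW uk) lerBlDr addrC h.
have [phi phiP] := choice ex; exists phi; split; first by move=> n; have [] := phiP n.
apply/cvgrPdist_le => e e0.
have /cvgrPdist_le/(_ e e0) := @cvg_harmonic R; apply: filterS => n.
rewrite /harmonic sub0r normrN ger0_norm ?invr_ge0//; apply: le_trans.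
by have [] := phiP n.
Qed.

End SequenceFacts.

(** * The limiting inequality *)

Section LimitingInequality.
Variables (R : realType) (k : R -> R) (E T A : R).
Hypothesis T_gt0 : 0 < T.
Hypothesis A_gt0 : 0 < A.
Hypothesis k01 : forall x, 0 <= k x <= 1.
Hypothesis k_mono : {homo k : x y / x <= y}.

Let u e := log_potential k E T e.
Let sn e := sin (phase k E T e).

Hypothesis phase_potential : forall e, 0 < e ->
  e * expR (u e) + A ^+ 2 * sn e <= expR (u e) ^+ 2 * sn e /\ 0 <= sn e.

(** With r = exp g, the hypothesis reads e r <= A (r^2 - 1) sin t, and 1 - exp(-2 g) <= 2 g makes it
    linear in g. *)
Let potential_gap e : 0 < e -> e <= 2 * A * ((u e - ln A) * expR (u e - ln A)) * sn e.
Proof.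
move=> e0; have [+ s0] := phase_potential e0.
have -> : expR (u e) = A * expR (u e - ln A).
  by rewrite -{1}(lnK (A_gt0 : A \is Num.pos)) -expRD addrC subrK.
set g := u e - ln A; set r := expR g; set s := sn e in s0 *.
have r0 : 0 < r by exact: expR_gt0.
have h : r ^+ 2 - 1 <= 2 * g * r ^+ 2.
  have := expR_ge1Dx (- (2 * g)).
  rewrite -(ler_pM2r (exprn_gt0 2 r0)).
  have -> : expR (- (2 * g)) * r ^+ 2 = 1.
    by rewrite expr2 -!expRD -[RHS]expR0; congr expR; ring.
  lra.
move=> h1.
have h2 : A ^+ 2 * s * (r ^+ 2 - 1) <= A ^+ 2 * s * (2 * g * r ^+ 2).
  by rewrite ler_wpM2l// mulr_ge0 ?sqr_ge0.
have : (A * r) * e <= (A * r) * (2 * A * (g * r) * s).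
  have -> : A * r * (2 * A * (g * r) * s) = A ^+ 2 * s * (2 * g * r ^+ 2) by ring.
  apply: le_trans h2.
  have -> : A ^+ 2 * s * (r ^+ 2 - 1) = (A * r) ^+ 2 * s - A ^+ 2 * s by ring.
  rewrite lerBrDr; apply: le_trans h1.
  by rewrite [A * r * e]mulrC.
by rewrite ler_pM2l// mulr_gt0.
Qed.

(** A negative gap would make the right side of [potential_gap] nonpositive, whereas it is at least
    e. *)
Lemma log_potential_ge e : 0 < e -> ln A <= u e.
Proof.
move=> e0; rewrite leNgt; apply/negP => uA.
have [_ s0] := phase_potential e0.
have := potential_gap e0; apply/negP; rewrite -ltNge; apply: le_lt_trans e0.
apply: mulr_le0_ge0 => //; apply: mulr_ge0_le0; first by rewrite mulr_ge0 ?ltW.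
by apply: mulr_le0_ge0; rewrite ?expR_ge0// subr_le0 ltW.
Qed.

Hypothesis dk : derivable k E 1.

Let lipschitz al : derive1 k E < al -> 0 <= al /\
  exists2 tau, 0 < tau & forall x, `|x - E| <= tau -> `|k x - k E| <= al * `|x - E|.
Proof.
move=> Dal.
have cq : (fun h : R => h^-1 *: (k (h + E) - k E)) @ 0^' --> derive1 k E.
  have -> : (fun h : R => h^-1 *: (k (h + E) - k E)) =
      (fun h => h^-1 *: ((k \o shift E) (h *: 1) - k E)).
    by apply/funext => h /=; rewrite [h *: 1]mulr1.
  by rewrite derive1E; exact: dk.
have [tau /= tau0 Htau] := cvgr_lt _ cq _ Dal.
have quot h : h != 0 -> `|h| < tau -> 0 <= h^-1 * (k (h + E) - k E) < al.
  move=> h0 htau; apply/andP; split; last first.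
    by apply: (Htau h) => //=; rewrite sub0r normrN.
  have [hn|hp] := ltP h 0.
    by apply: mulr_le0; rewrite ?invr_le0 ?(ltW hn)// subr_le0 k_mono// gerDr ltW.
  by rewrite mulr_ge0 ?invr_ge0// subr_ge0 k_mono// lerDr.
split.
  have : tau / 2 != 0 by rewrite gt_eqF// divr_gt0.
  move=> /quot; rewrite gtr0_norm ?divr_gt0// => H.
  have /H/andP[h1 h2] : tau / 2 < tau by lra.
  exact: le_trans h1 (ltW h2).
exists (tau / 2); first by rewrite divr_gt0.
move=> x xE; have [->|xnE] := eqVneq x E; first by rewrite !subrr normr0 mulr0.
have h0 : x - E != 0 by rewrite subr_eq0.
have /andP[h1 h2] : 0 <= (x - E)^-1 * (k (x - E + E) - k E) < al.
  by apply: quot => //; lra.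
rewrite subrK in h1 h2.
have -> : k x - k E = ((x - E)^-1 * (k x - k E)) * (x - E) by rewrite mulrAC mulVf ?mul1r.
by rewrite normrM ler_wpM2r// ger0_norm// ltW.
Qed.

Lemma density_bound :
  (forall del e0, 0 < del -> 0 < e0 -> exists eta, 0 < eta < e0 /\ u eta <= ln A + del) ->
  1 <= 2 * pi * A * sin (pi * k E) * derive1 k E.
Proof.
move=> inf_u.
have kc : {for E, continuous k}.
  by apply: differentiable_continuous; apply/derivable1_diffP.
suff H al : derive1 k E < al -> 1 <= 2 * A * (al * pi) * sin (pi * (1 - k E)).
  set Q := 2 * pi * A * sin (pi * k E).
  have {}H al : derive1 k E < al -> 1 <= Q * al.
    move=> /H; rewrite mulrBr mulr1 sinB sinpi cospi mul0r sub0r mulN1r opprK.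
    by rewrite (_ : 2 * A * (al * pi) * _ = Q * al)//; rewrite /Q; ring.
  apply/ler_addgt0Pr => e e0.
  (* Needed for the choice al = k'(E) + e / Q; for Q = 0 the bound H would read 1 <= 0. *)
  have Q0 : 0 < Q.
    rewrite lt_neqAle; apply/andP; split.
      by apply/eqP => Q0; have := H (derive1 k E + 1); rewrite -Q0 mul0r ltrDl ltr01 ler10 => /(_ isT).
    rewrite /Q; apply: mulr_ge0; first by rewrite !mulr_ge0 ?pi_ge0 ?ltW.
    have /andP[k0 k1] := k01 E.
    by apply: sin_ge0_pi; rewrite mulr_ge0 ?pi_ge0//= ger_pMr// pi_gt0.
  have := H (derive1 k E + e / Q); rewrite ltrDl divr_gt0// => /(_ isT).
  by rewrite mulrDr [Q * (e / Q)]mulrC divfK// gt_eqF.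
move=> Dal; have [al0 [tau tau0 klip]] := lipschitz Dal.
set M := 2 * T / tau ^+ 3 + (2 * T ^+ 2)^-1.
have M0 : 0 <= M.
  by rewrite addr_ge0// ?divr_ge0 ?invr_ge0 ?mulr_ge0 ?exprn_ge0 ?ltW.
pose B e : R := al * pi * e + M * e ^+ 2.
(* The increment bound is uniform in its lower height, so this height may be any eta where [u] is
   within del of ln A. *)
have gap e : 0 < e -> u e - ln A <= B e.
  move=> e0; apply/ler_addgt0Pr => del del0.
  have [eta [/andP[eta0 etae] ue]] := inf_u del e del0 e0.
  have := log_increment_bound eta0 etae T_gt0 tau0 al0 k01 k_mono klip.
  rewrite -/(u e) -/(u eta) -/M -/(B e); lra.
have key e : 0 < e -> 1 <= 2 * A * ((al * pi + M * e) * expR (B e)) * sn e.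
  move=> e0; have [_ s0] := phase_potential e0.
  have B0 : 0 <= B e by apply: addr_ge0; rewrite !mulr_ge0 ?pi_ge0 ?sqr_ge0 ?(ltW e0).
  have g0 : 0 <= u e - ln A by rewrite subr_ge0 log_potential_ge.
  have := potential_gap e0; have := gap e e0; set g := u e - ln A in g0 * => gB h.
  have h2 : g * expR g <= B e * expR (B e).
    by apply: ler_pM => //; rewrite ?expR_ge0// ler_expR.
  rewrite -(ler_pM2l e0) mulr1; apply: le_trans h _.
  have -> : e * (2 * A * ((al * pi + M * e) * expR (B e)) * sn e)
      = 2 * A * (B e * expR (B e)) * sn e by rewrite /B; ring.
  by apply: ler_wpM2r => //; apply: ler_wpM2l => //; rewrite mulr_ge0 ?ltW.
have e_cvg : e @[e --> 0^'+] --> (0 : R) by exact: cvg_at_right_filter cvg_id.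
have B_cvg : B e @[e --> 0^'+] --> (0 : R).
  rewrite -[X in _ --> X](_ : al * pi * 0 + M * (0 * 0) = 0); last by rewrite !mulr0 addr0.
  apply: cvgD; first by apply: cvgM e_cvg; exact: cvg_cst.
  by under eq_fun do rewrite expr2; apply: cvgM; [exact: cvg_cst|exact: (cvgM e_cvg e_cvg)].
have sn_cvg : sn e @[e --> 0^'+] --> sin (pi * (1 - k E)).
  exact: cvg_comp _ _ (phase_cvg T_gt0 k01 k_mono kc) (@continuous_sin R _).
have lim_cvg : 2 * A * ((al * pi + M * e) * expR (B e)) * sn e @[e --> 0^'+]
    --> 2 * A * (al * pi) * sin (pi * (1 - k E)).
  apply: cvgM sn_cvg; apply: cvgM; first exact: cvg_cst.
  rewrite -[X in _ --> X]mulr1; apply: cvgM.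
    rewrite -[X in _ --> X]addr0; apply: cvgD; first exact: cvg_cst.
    by rewrite -[X in _ --> X](mulr0 M); apply: cvgM e_cvg; exact: cvg_cst.
  by rewrite -expR0; exact: cvg_comp _ _ B_cvg (@continuous_expR R _).
rewrite -(cvg_lim (@Rhausdorff R) lim_cvg); apply: limr_ge.
  by apply/cvg_ex; eexists; exact: lim_cvg.
by near=> e; apply: key; near: e; exact: nbhs_right_gt.
Unshelve. all: by end_near. Qed.

End LimitingInequality.

(** * Passage to the limit along a sequence of truncations *)

Section DensityOfStates.
Variables (R : realType) (a b : nat -> R) (c C : R).
Local Notation mu := (@lebesgue_measure R).
Hypothesis c_gt0 : 0 < c.
Hypothesis a_bound : forall n, (1 <= n)%N -> c <= a n <= C.
Hypothesis b_bound : forall n, (1 <= n)%N -> `|b n| <= C.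

Lemma ae_exists_itv (P : R -> Prop) (l v : R) : l < v ->
  {ae mu, forall x, P x} -> exists2 x, l < x < v & P x.
Proof.
move=> lv [N [mN N0 PN]]; apply: contrapT => H.
have sub : `]l, v[%classic `<=` N.
  move=> x /=; rewrite in_itv/= => xlv; apply: PN => Px; apply: H; by exists x.
have : (mu (`]l, v[%classic : set R) <= 0)%E.
  by rewrite -N0; apply: le_measure => //; rewrite inE//; exact: measurable_itv.
rewrite lebesgue_measure_itv/= lte_fin lv -EFinB lee_fin subr_le0.
by rewrite leNgt lv.
Qed.

Variables d w : nat -> nat -> R.
Hypothesis dw : spectral_data a b d w.

Variables (ni : nat -> nat) (k : R -> R) (A : R).
Hypothesis ni_gt0 : forall i, (0 < ni i)%N.
Hypothesis ni_cvg : ni i @[i --> \oo] --> \oo.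
Hypothesis k_mono : {homo k : x y / x <= y}.
Hypothesis k_cvg : {ae mu, forall E, norm_counting a b (ni i) E @[i --> \oo] --> k E}.
Hypothesis A_cvg : geom_mean a (ni i) @[i --> \oo] --> A.

Let a_gt0 n : (1 <= n)%N -> 0 < a n.
Proof. by move=> /a_bound/andP[ca _]; exact: lt_le_trans ca. Qed.

Let a_neq0 n : (1 <= n)%N -> a n != 0.
Proof. by move=> /a_gt0/lt0r_neq0. Qed.

Let a_norm n : (1 <= n)%N -> `|a n| <= C.
Proof. by move=> n1; rewrite gtr0_norm ?a_gt0//; have /andP[] := a_bound n1. Qed.

Let di i := d (ni i).-1.

Let countingE i E : norm_counting a b (ni i) E =
  (\sum_(j < ni i) (di i j <= E)%R%:R) / (ni i)%:R.
Proof.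
by have [_ _ _] := dw (ni i).-1; rewrite /di; case: (ni i) (ni_gt0 i).
Qed.

Let di_bound i j : (j < ni i)%N -> `|di i j| <= 3 * C.
Proof.
rewrite /di; case: (ni i) (ni_gt0 i) => // m _ jm.
exact: (eigenvalue_bound a_neq0 dw a_norm b_bound (Ordinal jm)).
Qed.

(** Convergence is known only almost everywhere; monotonicity carries the bounds to x from a point
    of convergence on either side. *)
Lemma ids_itv x : 0 <= k x <= 1.
Proof.
have c01 i E : 0 <= norm_counting a b (ni i) E <= 1.
  have nR : 0 < (ni i)%:R :> R by rewrite ltr0n.
  rewrite countingE divr_ge0 ?sumr_ge0//= ler_pdivrMr// mul1r.
  rewrite -[X in _ <= X%:R](card_ord (ni i)) -sumr_const ler_sum// => j _.
  by rewrite lern1 leq_b1.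
apply/andP; split.
  have x1 : x - 1 < x by rewrite ltrBlDr ltrDl.
  have [y /andP[_ yx] cy] := ae_exists_itv x1 k_cvg.
  apply: le_trans (k_mono (ltW yx)).
  rewrite -(cvg_lim (@Rhausdorff R) cy); apply: limr_ge; first by apply/cvg_ex; exists (k y).
  by apply: nearW => i; have /andP[] := c01 i y.
have x1 : x < x + 1 by rewrite ltrDl.
have [y /andP[xy _] cy] := ae_exists_itv x1 k_cvg.
apply: le_trans (k_mono (ltW xy)) _.
rewrite -(cvg_lim (@Rhausdorff R) cy); apply: limr_le; first by apply/cvg_ex; exists (k y).
by apply: nearW => i; have /andP[] := c01 i y.
Qed.

(** Half-width of an interval around E that contains in its interior all eigenvalues, whose moduli
    are at most 3 C. *)
Let T (E : R) : R := 3 * C + 1 + `|E|.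

Let C_ge0 : 0 <= C.
Proof. by rewrite (le_trans (normr_ge0 (a 1%N))) ?a_norm. Qed.

Let T_gt0 E : 0 < T E.
Proof. by rewrite /T; have := normr_ge0 E; have := C_ge0; lra. Qed.

Let di_itv E i j : (j < ni i)%N -> E - T E < di i j < E + T E.
Proof.
move=> /di_bound; rewrite ler_norml => /andP[d1 d2].
have := ler_norm E; have := lerNnormlW (lexx `|E|).
by rewrite /T => ? ?; apply/andP; split; lra.
Qed.

Let counting_cvg : {ae mu, forall x,
  (\sum_(j < ni i) (di i j <= x)%R%:R) / (ni i)%:R @[i --> \oo] --> k x}.
Proof.
apply: (@filterS _ _ (ae_filter_ringOfSetsType mu) _ _ _ k_cvg) => x.
by under eq_fun do rewrite countingE.
Qed.

Let mean_log_cvg E e : 0 < e ->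
  mean_log (ni i) (di i) E e @[i --> \oo] --> log_potential k E (T E) e.
Proof.
move=> e0; have lu : E - T E < E + T E by have := T_gt0 E; lra.
have [_] := mean_cvg lu ni_gt0 (di_itv E) (fun x => is_derive_log_dist x E e0)
  (@continuous_conj_poisson R E e e0) k_mono counting_cvg.
exact.
Qed.

Let mean_phase_cvg E e : 0 < e ->
  (\sum_(j < ni i) (pi / 2 + atan ((di i j - E) / e))) / (ni i)%:R @[i --> \oo]
    --> phase k E (T E) e.
Proof.
move=> e0; have lu : E - T E < E + T E by have := T_gt0 E; lra.
have dH (x : R) : is_derive x (1 : R) (fun x => pi / 2 + atan ((x - E) / e))
    (e / ((x - E) ^+ 2 + e ^+ 2)).
  have h := is_derive_atan_affine x E e0.
  have -> : (fun x => pi / 2 + atan ((x - E) / e)) = cst (pi / 2) \+ (fun x => atan ((x - E) / e)).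
    by [].
  by apply: is_derive_eq; rewrite add0r.
have [_] := mean_cvg lu ni_gt0 (di_itv E) dH (@continuous_poisson R E e e0) k_mono counting_cvg.
exact.
Qed.

Let A_ge : c <= A.
Proof.
rewrite -(cvg_lim (@Rhausdorff R) A_cvg); apply: limr_ge; first by apply/cvg_ex; exists A.
by apply: nearW => i; have /andP[] := geom_mean_bound c_gt0 a_bound (ni_gt0 i).
Qed.

Let A_gt0 : 0 < A. Proof. exact: lt_le_trans A_ge. Qed.

Let inv_ni_cvg : (ni i)%:R^-1 @[i --> \oo] --> (0 : R).
Proof. 
have h : n%:R^-1 @[n --> \oo] --> (0 : R).
  by apply/gtr0_cvgV0; [near=> n; rewrite ltr0n; near: n; exact: nbhs_infty_gt|exact: cvgr_idn].
exact: cvg_comp _ _ ni_cvg h.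
Unshelve. all: by end_near. Qed.

Let phase_potential_lim E e : 0 < e ->
  e * expR (log_potential k E (T E) e) + A ^+ 2 * sin (phase k E (T E) e)
    <= expR (log_potential k E (T E) e) ^+ 2 * sin (phase k E (T E) e)
  /\ 0 <= sin (phase k E (T E) e).
Proof.
move=> e0.
pose r i := expR (mean_log (ni i) (di i) E e).
pose s i := sin ((\sum_(j < ni i) (pi / 2 + atan ((di i j - E) / e))) / (ni i)%:R).
have fin i := phase_potential_ineq c_gt0 a_bound dw (ni_gt0 i) e0
  (erefl : r i = expR (mean_log (ni i) (d (ni i).-1) E e)) (erefl (s i)).
have rc : r i @[i --> \oo] --> expR (log_potential k E (T E) e).
  exact: cvg_comp _ _ (mean_log_cvg e0) (@continuous_expR R _).
have sc : s i @[i --> \oo] --> sin (phase k E (T E) e).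
  exact: cvg_comp _ _ (mean_phase_cvg e0) (@continuous_sin R _).
split; last first.
  rewrite -(cvg_lim (@Rhausdorff R) sc); apply: limr_ge; first by apply/cvg_ex; eexists; exact: sc.
  by apply: nearW => i; have [] := fin i.
have lc : e * r i + geom_mean a (ni i) ^+ 2 * s i @[i --> \oo] -->
    e * expR (log_potential k E (T E) e) + A ^+ 2 * sin (phase k E (T E) e).
  apply: cvgD; first by apply: cvgM => //; exact: cvg_cst.
  by apply: cvgM => //; rewrite expr2; under eq_fun do rewrite expr2; exact: cvgM.
have rrc : (1 + (C / e) ^+ 2 / (ni i)%:R) * r i ^+ 2 * s i @[i --> \oo] -->
    expR (log_potential k E (T E) e) ^+ 2 * sin (phase k E (T E) e).
  apply: cvgM => //; rewrite -[X in _ --> X]mul1r; apply: cvgM.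
    rewrite -[X in _ --> X]addr0; apply: cvgD; first exact: cvg_cst.
    by rewrite -[X in _ --> X](mulr0 ((C / e) ^+ 2)); apply: cvgM; [exact: cvg_cst|exact: inv_ni_cvg].
  by rewrite expr2; under eq_fun do rewrite expr2; exact: cvgM.
apply: (ler_cvg_to lc rrc); apply: nearW => i; by have [] := fin i.
Qed.

Let ln_geom_mean_cvg : ln (geom_mean a (ni i)) @[i --> \oo] --> ln A.
Proof. exact: cvg_comp _ _ A_cvg (continuous_ln A_gt0). Qed.

(** The half-width does not depend on [ni], so for two sequences with the same [k] the last two
    clauses speak of the same function. *)
Lemma ae_density_bound : {ae mu, forall E, Sigma_ac a b E ->
  [/\ derivable k E 1,
      1 <= 2 * pi * A * sin (pi * k E) * derive1 k E,
      forall e, 0 < e -> ln A <= log_potential k E (3 * C + 1 + `|E|) e &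
      forall del, 0 < del -> exists2 e, 0 < e &
        log_potential k E (3 * C + 1 + `|E|) e <= ln A + del]}.
Proof.
have h1 := nondecreasing_ae_derivable k_mono.
have h2 := ae_ortho_op_bound a_neq0 a_norm b_bound dw.
have h3 := ae_mean_log_increment ni_gt0 di_bound.
move: h3; apply: (@filterS3 _ _ (ae_filter_ringOfSetsType mu) _ _ _ _ _ h1 h2).
move=> E dk op incr SE; have [M HM] := op SE.
have M0 : 0 <= M.
  by have := HM 0%N; rewrite ortho_op0 !expr1n mulr1; exact: le_trans.
have inf_u del e0 : 0 < del -> 0 < e0 ->
    exists eta, 0 < eta < e0 /\ log_potential k E (T E) eta <= ln A + del.
  (* The four quarters of del pay for the convergence of the logarithmic means, that of the
     geometric means, the growth of the orthonormal polynomials, and the increment from a smaller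
     height. *)
  move=> del0 e00; pose dl := del / 4.
  have dl0 : 0 < dl by rewrite divr_gt0.
  have [k0 _ Hk0] : \forall n \near \oo, n.+1%:R^-1 < e0.
    have /cvgrPdist_lt/(_ _ e00) := @cvg_harmonic R; apply: filterS => n.
    by rewrite /harmonic sub0r normrN ger0_norm// invr_ge0.
  have [kk kk0 Hkk] := incr dl dl0 k0.
  have eta0 : 0 < kk.+1%:R^-1 :> R by rewrite invr_gt0.
  exists kk.+1%:R^-1; split; first by rewrite eta0 Hk0.
  have [i0 _ Hi0] : \forall i \near \oo,
    [/\ `|log_potential k E (T E) kk.+1%:R^-1 - mean_log (ni i) (di i) E kk.+1%:R^-1| <= dl,
        `|ln A - ln (geom_mean a (ni i))| <= dl &
        ln (M * (ni i).+1%:R ^+ 2 + 1) <= dl * (2 * (ni i)%:R)].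
    near=> i; split.
    - by near: i; have /cvgrPdist_le := mean_log_cvg (E := E) eta0; apply.
    - by near: i; move/cvgrPdist_le: ln_geom_mean_cvg; apply.
    - by near: i; exact: ni_cvg (ln_quadratic_sublinear M0 dl0).
  have [i ii0 Hi] := Hkk i0.
  have [g1 g2 g3] := Hi0 i ii0.
  (* How small the height must be depends on i; this is why [incr] offers arbitrarily large s for
     the chosen i. *)
  have [s0 Hs0] := mean_log_upper c_gt0 a_bound dw (ni_gt0 i) eta0 (HM (ni i)).
  have [s ss0 g4] := Hi s0.
  have g5 := Hs0 s ss0.
  have nR : 0 < 2 * (ni i)%:R :> R by rewrite mulr_gt0// ltr0n.
  move: g3; rewrite -ler_pdivrMr// => g3.
  move: g1 g2; rewrite !ler_norml => /andP[_ g1] /andP[g2 _].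
  have -> : del = dl + dl + dl + dl by rewrite /dl; lra.
  rewrite -/(di i) in g5.
  lra.
have pp := @phase_potential_lim E.
split => //.
- exact: (density_bound (T_gt0 E) A_gt0 ids_itv k_mono pp dk inf_u).
- by move=> e e0; exact: (log_potential_ge A_gt0 pp e0).
- by move=> del del0; have [e [/andP[e0 _] ?]] := inf_u del 1 del0 ltr01; exists e.
Unshelve. all: by end_near. Qed.

End DensityOfStates.

(** * Lower limits and convergence of the geometric means *)

Lemma cvg_infty_ge (phi : nat -> nat) : (forall n, (n <= phi n)%N) ->
  phi n @[n --> \oo] --> \oo.
Proof.
move=> ge U [N _ NU]; exists N => // n /= Nn; apply: NU => /=.
exact: leq_trans Nn (ge n).
Qed.

Theorem theorem1p3 (R : realType) (a b : nat -> R) (c C : R)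
  (hc : 0 < c) (hcC : c < C)
  (ha : forall n : nat, (1 <= n)%N -> c <= a n <= C)
  (hb : forall n : nat, (1 <= n)%N -> - C <= b n <= C) :
  (forall (ni : nat -> nat) (k : R -> R),
     (forall i : nat, (0 < ni i)%N) ->
     {homo ni : i j / (i <= j)%N} ->
     ni i @[i --> \oo] --> \oo ->
     {homo k : x y / x <= y} ->
     {ae lebesgue_measure, forall E : R,
        norm_counting a b (ni i) E @[i --> \oo] --> k E} ->
     {ae lebesgue_measure, forall E : R, Sigma_ac a b E ->
        derivable k E 1 /\
        1 <= 2 * pi * limn_inf (fun i => geom_mean a (ni i))
             * sin (pi * k E) * derive1 k E})
  /\
  (forall k : R -> R,
     {homo k : x y / x <= y} ->
     {ae lebesgue_measure, forall E : R,
        norm_counting a b n E @[n --> \oo] --> k E} ->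
     {ae lebesgue_measure, forall E : R, Sigma_ac a b E ->
        [/\ cvgn (geom_mean a),
            derivable k E 1 &
            1 <= 2 * pi * limn (geom_mean a) * sin (pi * k E) * derive1 k E]}).
Proof.
have b_bound n : (1 <= n)%N -> `|b n| <= C by move=> /hb; rewrite ler_norml.
have a_neq0 n : (1 <= n)%N -> a n != 0.
  by move=> /ha/andP[ca _]; rewrite gt_eqF// (lt_le_trans hc).
have [d [w dw]] := exists_spectral_data b a_neq0.
have A_bound (ni : nat -> nat) i : (0 < ni i)%N -> c <= geom_mean a (ni i) <= C.
  by move=> n0; exact: (geom_mean_bound hc ha n0).
have core (ni phi : nat -> nat) k A := @ae_density_bound R a b c C hc ha b_bound d w dw
  (ni \o phi) k A.
have ae_subseq (ni phi : nat -> nat) (k : R -> R) : phi n @[n --> \oo] --> \oo ->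
    {ae lebesgue_measure, forall E : R, norm_counting a b (ni i) E @[i --> \oo] --> k E} ->
    {ae lebesgue_measure, forall E : R,
      norm_counting a b ((ni \o phi) i) E @[i --> \oo] --> k E}.
  move=> phi_cvg; apply: (@filterS _ _ (ae_filter_ringOfSetsType lebesgue_measure)) => E kE.
  exact: cvg_comp _ _ phi_cvg kE.
split=> [ni k ni_gt0 _ ni_cvg k_mono k_cvg|k k_mono k_cvg].
  (* Along a subsequence realizing the lower limit the geometric means converge, while the counting
     functions keep their limit. *)
  have [_ [phi [/cvg_infty_ge phi_cvg A_cvg]]] :=
    limn_inf_subseq (fun i => A_bound ni i (ni_gt0 i)).
  have := core ni phi k _ (fun i => ni_gt0 (phi i)) (cvg_comp _ _ phi_cvg ni_cvg)
    k_mono (ae_subseq ni phi k phi_cvg k_cvg) A_cvg.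
  apply: (@filterS _ _ (ae_filter_ringOfSetsType lebesgue_measure)) => E HE SE.
  by have [dk k1 _ _] := HE SE.
(* The shift keeps the sizes of the truncations positive. *)
pose u n := geom_mean a n.+1.
have u_bound n : c <= u n <= C by exact: A_bound (fun n => n.+1) n isT.
have S_cvg : n.+1 @[n --> \oo] --> \oo by apply: cvg_infty_ge => n; exact: leqnSn.
have kS_cvg : {ae lebesgue_measure, forall E : R,
    norm_counting a b n.+1 E @[n --> \oo] --> k E} by exact: (ae_subseq id S).
have [u_ge [phi [/cvg_infty_ge phi_cvg A_cvg]]] := limn_inf_subseq u_bound.
(* The opposite of this second lower limit is the upper limit of [u]. *)
have [|u_le [psi [/cvg_infty_ge psi_cvg A'_cvg]]] := @limn_inf_subseq R (\- u) (- C) (- c).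
  by move=> n; rewrite /= !lerN2 andbC.
set A := limn_inf u in u_ge A_cvg; set B := limn_inf (\- u) in u_le A'_cvg.
have {}A'_cvg : u (psi n) @[n --> \oo] --> - B.
  by under eq_fun do rewrite -[u _]opprK; exact: cvgN A'_cvg.
have c1 := core S phi k A (fun=> isT) (cvg_comp _ _ phi_cvg S_cvg) k_mono
  (ae_subseq S phi k phi_cvg kS_cvg) A_cvg.
have c2 := core S psi k (- B) (fun=> isT) (cvg_comp _ _ psi_cvg S_cvg) k_mono
  (ae_subseq S psi k psi_cvg kS_cvg) A'_cvg.
have lim_gt0 (p : nat -> nat) (l : R) : u (p n) @[n --> \oo] --> l -> 0 < l.
  move=> ul; apply: lt_le_trans hc _; rewrite -(cvg_lim (@Rhausdorff R) ul); apply: limr_ge.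
    by apply/cvg_ex; exists l.
  by apply: nearW => n; have /andP[] := u_bound (p n).
apply: (@filterS2 _ _ (ae_filter_ringOfSetsType lebesgue_measure) _ _ _ _ c1 c2) => E h1 h2 SE.
have [dk k1 lA Al] := h1 SE; have [_ _ lB Bl] := h2 SE.
(* Both logarithms are the infimum of one potential. A single such E suffices, which is how the
   absolutely continuous spectrum enters the existence of the limit. *)
have AB : A = - B.
  apply: (@ln_inj R); rewrite ?posrE ?(lim_gt0 _ _ A_cvg) ?(lim_gt0 _ _ A'_cvg)//.
  apply/eqP; rewrite eq_le; apply/andP; split; apply/ler_addgt0Pr => del del0.
    by have [e e0] := Bl del del0; apply: le_trans; exact: lA.
  by have [e e0] := Al del del0; apply: le_trans; exact: lB.
have uA : u n @[n --> \oo] --> A.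
  apply/cvgrPdist_le => e e0.
  near=> n; have h3 : A - e <= u n by near: n; exact: u_ge.
  have h4 : B - e <= - u n by near: n; exact: u_le.
  rewrite ler_norml; apply/andP; split; move: h3 h4; rewrite AB; lra.
have gA : geom_mean a @ \oo --> A by rewrite -cvg_shiftS.
split => //; first by apply/cvg_ex; exists A.
by rewrite (cvg_lim (@Rhausdorff R) gA).
Unshelve. all: by end_near. Qed.
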